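(* Let $1<p<\infty$ and let $f\in C(\mathbb{R}^N)$ satisfy $|f(\xi)|\le C_f(1+|\xi|^\beta)$ for all $\xi\in\mathbb{R}^N$, where $C_f>0$ and $1\le\beta<p$. Let $\Omega\subset\mathbb{R}^N$ be a bounded domain, $T>0$ and $\Omega_T:=\Omega\times(0,T)$. Let $u,v\in L^\infty(\Omega_T)$ be, respectively, a weak subsolution and a weak supersolution to $\partial_t u-\Delta_p u=f(Du)$ in $\Omega_T$. Assume that for all $(x_0,t_0)\in\partial_p\Omega_T$ $$\limsup_{(x,t)\to(x_0,t_0)}u(x,t)\le\liminf_{(x,t)\to(x_0,t_0)}v(x,t).$$ Assume also that $Du\in L^\infty(\Omega_T)$. Then $u\le v$ a.e. in $\Omega_T$.
   Context: Points are $z=(x,t)\in\mathbb{R}^N\times\mathbb{R}$, $dz=dx\,dt$; $D$ denotes the gradient in the space variable $x$. The parabolic boundary is $\partial_p\Omega_T:=(\overline\Omega\times\{0\})\cup(\partial\Omega\times(0,T])$. For a bounded domain $\Omega'\subset\mathbb{R}^N$ and $t_1<t_2$, $\Omega'_{t_1,t_2}:=\Omega'\times(t_1,t_2)$. The parabolic Sobolev space $L^p(t_1,t_2;W^{1,p}(\Omega'))$ consists of measurable $u:\Omega'_{t_1,t_2}\to\mathbb{R}$ with $u(\cdot,t)\in W^{1,p}(\Omega')$ for a.e. $t$ and $\int_{\Omega'_{t_1,t_2}}|u|^p+|Du|^p\,dz<\infty$. Weak super-/subsolution: for a bounded domain $\Xi\subset\mathbb{R}^N\times\mathbb{R}$ (here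 $\Xi=\Omega_T$), $u:\Xi\to\mathbb{R}$ is a weak supersolution to $\partial_tu-\Delta_pu=f(Du)$ in $\Xi$ if whenever $\Omega'_{t_1,t_2}\Subset\Xi$ we have $u\in L^p(t_1,t_2;W^{1,p}(\Omega'))$ and $$\int_\Xi -u\,\partial_t\varphi+|Du|^{p-2}Du\cdot D\varphi-\varphi f(Du)\,dz\ge0$$ for all non-negative $\varphi\in C_0^\infty(\Omega'_{t_1,t_2})$. For weak subsolutions the inequality is reversed. *)

(* Defs.v *)
From HB Require Import structures.
From mathcomp Require Import all_boot all_order all_algebra.
From mathcomp Require Import all_classical all_reals all_analysis.

Set Implicit Arguments.
Unset Strict Implicit.
Unset Printing Implicit Defensive.

Import Order.TTheory GRing.Theory Num.Theory.
Import numFieldNormedType.Exports.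

Local Open Scope classical_set_scope.
Local Open Scope ring_scope.

(* The Borel sigma-algebra of R^n, generated by the coordinate projections
   (the analogue for row vectors of the library's structure on n.-tuple R). *)
Section measurable_row_vector.
Variables (R : realType) (n : nat).

Let coord : 'I_n -> 'rV[R]_n -> R := fun i x => x ord0 i.

Let rV_set0 : g_sigma_preimage coord set0.
Proof. exact: sigma_algebra0. Qed.

Let rV_setC A : g_sigma_preimage coord A -> g_sigma_preimage coord (~` A).
Proof. exact: sigma_algebraC. Qed.

Let rV_bigcup (F : (set 'rV[R]_n)^nat) :
  (forall i, g_sigma_preimage coord (F i)) ->
  g_sigma_preimage coord (\bigcup_i (F i)).
Proof. exact: sigma_algebra_bigcup. Qed.

HB.instance Definition _ := @isMeasurable.Build default_measure_display
  'rV[R]_n (g_sigma_preimage coord) rV_set0 rV_setC rV_bigcup.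

Lemma measurable_coord (i : 'I_n) :
  measurable_fun setT (fun x : 'rV[R]_n => x ord0 i).
Proof.
move=> _ Y mY; rewrite setTI; apply: sub_sigma_algebra.
rewrite -bigcup_seq/=; exists i => /=; first by rewrite mem_index_enum.
by exists Y => //; rewrite setTI.
Qed.

Lemma measurable_fun_rV d (T : measurableType d) (f : T -> 'rV[R]_n) :
  (forall i, measurable_fun setT (fun x => f x ord0 i)) ->
  measurable_fun setT f.
Proof.
move=> mf _ Y mY.
have : g_sigma_preimage (fun i => coord i \o f) (f @^-1` Y).
  by rewrite g_sigma_preimage_comp; exists Y => //; rewrite setTI.
rewrite setTI; move: (f @^-1` Y).
apply: smallest_sub; first exact: sigma_algebra_measurable.
move=> A; rewrite -bigcup_seq /= => -[i _ [B mB <-]]; exact: mf.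
Qed.

End measurable_row_vector.

Section sigma_finite_product.
Context d1 d2 (T1 : measurableType d1) (T2 : measurableType d2) (R : realType).

(* The instance that the library declares for product_measure1 is shadowed by
   the one for products of subprobabilities. *)
Lemma sigma_finite_product
    (m1 : {sigma_finite_measure set T1 -> \bar R})
    (m2 : {sigma_finite_measure set T2 -> \bar R}) :
  sigma_finite setT (m1 \x m2)%E.
Proof.
have /sigma_finiteP[F [TF ndF Foo]] := sigma_finiteT m1.
have /sigma_finiteP[G [TG ndG Goo]] := sigma_finiteT m2.
exists (fun n => F n `*` G n).
  rewrite -setXTT TF TG predeqE => -[x y]; split.
    move=> [/= [n _ Fnx] [k _ Gky]]; exists (maxn n k) => //; split.
    - by move: x Fnx; exact/subsetPset/ndF/leq_maxl.
    - by move: y Gky; exact/subsetPset/ndG/leq_maxr.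
  by move=> [n _ []/= ? ?]; split; exists n.
move=> k; have [mFk Fk] := Foo k; have [mGk Gk] := Goo k.
split; first exact: measurableX.
by rewrite product_measure1E// lte_mul_pinfty// ge0_fin_numE.
Qed.

End sigma_finite_product.

Section sigma_finite_pushforward.
Context d1 d2 (T1 : measurableType d1) (T2 : measurableType d2) (R : realType).

Lemma sigma_finite_pushforward (m : {measure set T1 -> \bar R})
    (f : T1 -> T2) (g : T2 -> T1) :
  measurable_fun setT g -> cancel f g ->
  sigma_finite setT m -> sigma_finite setT (pushforward m f).
Proof.
move=> mg fK [F FT mF]; exists (fun k => g @^-1` F k).
  by rewrite -preimage_bigcup -FT preimage_setT.
move=> k; have [mFk Fk] := mF k; split.
  by rewrite -[X in measurable X]setTI; exact: mg.
rewrite /pushforward -comp_preimage.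
by rewrite (_ : g \o f = id)//; apply/funext => x /=; rewrite fK.
Qed.

End sigma_finite_pushforward.

Section lebesgue_rV.
Variable R : realType.
Local Notation mR := (measurableTypeR R).

Definition rV_cons n (z : mR * 'rV[R]_n) : 'rV[R]_n.+1 :=
  \row_i oapp (fun j => z.2 ord0 j) z.1 (unlift ord0 i).

Definition rV_uncons n (x : 'rV[R]_n.+1) : mR * 'rV[R]_n :=
  (x ord0 ord0, \row_j x ord0 (lift ord0 j)).

Lemma rV_cons0 n (z : mR * 'rV[R]_n) : rV_cons z ord0 ord0 = z.1.
Proof. by rewrite mxE unlift_none. Qed.

Lemma rV_consS n (z : mR * 'rV[R]_n) j :
  rV_cons z ord0 (lift ord0 j) = z.2 ord0 j.
Proof. by rewrite mxE liftK. Qed.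

Lemma rV_consK n : cancel (@rV_cons n) (@rV_uncons n).
Proof.
case=> a x; rewrite /rV_uncons rV_cons0; congr pair.
by apply/rowP => j; rewrite mxE rV_consS.
Qed.

Lemma measurable_rV_cons n : measurable_fun setT (@rV_cons n).
Proof.
apply: measurable_fun_rV => i.
case: (unliftP ord0 i) => [j ->|->].
  under eq_fun do rewrite rV_consS.
  exact: (measurableT_comp (measurable_coord j) measurable_snd).
under eq_fun do rewrite rV_cons0.
exact: measurable_fst.
Qed.

HB.instance Definition _ n :=
  isMeasurableFun.Build _ _ _ _ (@rV_cons n) (@measurable_rV_cons n).

Lemma measurable_rV_uncons n : measurable_fun setT (@rV_uncons n).
Proof.
apply/measurable_fun_pairP; split => /=; first exact: measurable_coord.
apply: measurable_fun_rV => j /=.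
under eq_fun do rewrite mxE.
exact: measurable_coord.
Qed.

Section step.
Variables (n : nat) (m : {sigma_finite_measure set 'rV[R]_n -> \bar R}).

Definition lebesgue_rV_step : set 'rV[R]_n.+1 -> \bar R :=
  pushforward (lebesgue_measure \x m)%E (@rV_cons n).

Let step0 : lebesgue_rV_step set0 = 0%E.
Proof. exact: measure0. Qed.

Let step_ge0 A : (0 <= lebesgue_rV_step A)%E.
Proof. exact: measure_ge0. Qed.

Let step_sigma_additive : semi_sigma_additive lebesgue_rV_step.
Proof. exact: measure_semi_sigma_additive. Qed.

HB.instance Definition _ := isMeasure.Build _ _ _ lebesgue_rV_step
  step0 step_ge0 step_sigma_additive.

Let step_sigma_finite : sigma_finite setT lebesgue_rV_step.
Proof.
apply: sigma_finite_pushforward (@measurable_rV_uncons n) (@rV_consK n) _.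
exact: sigma_finite_product.
Qed.

HB.instance Definition _ := Measure_isSigmaFinite.Build _ _ _
  lebesgue_rV_step step_sigma_finite.

End step.

(* Built by splitting off the first coordinate; lebesgue_rV_box gives its values
   on boxes, which characterise it. *)
Fixpoint lebesgue_rV n : {sigma_finite_measure set 'rV[R]_n -> \bar R} :=
  match n with
  | 0 => dirac (0 : 'rV[R]_0)
  | n'.+1 => lebesgue_rV_step (lebesgue_rV n')
  end.

Lemma measurable_rV_box n (A : 'I_n -> set mR) :
  (forall i, measurable (A i)) ->
  measurable [set x : 'rV[R]_n | forall i, A i (x ord0 i)].
Proof.
move=> mA; rewrite (_ : [set _ | _] =
    \bigcap_(i in @setT 'I_n) (fun x : 'rV[R]_n => x ord0 i) @^-1` A i).
  apply: fin_bigcap_measurable => // i _.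
  have := @measurable_coord R n i measurableT _ (mA i); rewrite setTI; exact.
by apply/seteqP; split => x /= h i; [move=> _|]; apply: h.
Qed.

Lemma lebesgue_rV_box n (A : 'I_n -> set mR) :
  (forall i, measurable (A i)) ->
  lebesgue_rV n [set x | forall i, A i (x ord0 i)] =
  (\big[*%E/1]_(i < n) lebesgue_measure (A i))%E.
Proof.
elim: n => [|n IH] in A * => mA.
  by rewrite big_ord0 /= diracE mem_set//; case.
have mS i : measurable (A (lift ord0 i)) by exact: mA.
rewrite big_ord_recl -IH// -(product_measure1E _ _ (mA ord0)
  (measurable_rV_box mS)) /=.
rewrite /lebesgue_rV_step /pushforward; congr (product_measure1 _ _ _).
apply/seteqP; split => -[a x] /= h.
  split=> [|i]; first by have := h ord0; rewrite rV_cons0.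
  by have := h (lift ord0 i); rewrite rV_consS.
case: h => h0 hS i.
case: (unliftP ord0 i) => [j ->|->]; first by rewrite rV_consS.
by rewrite rV_cons0.
Qed.

End lebesgue_rV.

Section function_spaces.
Variable R : realType.

(* The library's integral is a supremum over Borel simple functions, which is
   also the right value for functions that are Lebesgue measurable, i.e. almost
   everywhere equal to a Borel function; so the latter notion is used
   throughout and representatives need not be Borel. *)
Definition lebesgue_measurable d (T : measurableType d)
    (mu : {measure set T -> \bar R}) (D : set T) (w : T -> R) : Prop :=
  exists2 g : T -> R, measurable_fun D g &
    \forall x \ae mu, D x -> w x = g x.

Definition Linfty d (T : measurableType d)
    (mu : {measure set T -> \bar R}) (D : set T) (w : T -> R) : Prop :=
  lebesgue_measurable mu D w /\
  exists M : R, \forall x \ae mu, D x -> `|w x| <= M.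

Fixpoint Ck (V : normedModType R) (k : nat) (phi : V -> R) : Prop :=
  continuous phi /\
  match k with
  | 0 => True
  | k'.+1 => forall v : V,
      (forall x, derivable phi x v) /\ Ck k' (fun x => 'D_v phi x)
  end.

(* The space C_0^oo(U), each function being extended by zero. *)
Definition test_function (V : normedModType R) (U : set V) (phi : V -> R) :
    Prop :=
  [/\ forall k, Ck k phi,
      compact (closure [set x | phi x != 0]) &
      closure [set x | phi x != 0] `<=` U].

Definition domain (V : normedModType R) (U : set V) : Prop :=
  [/\ open U, connected U & U !=set0].

Definition compactly_contained (V : normedModType R) (A B : set V) : Prop :=
  compact (closure A) /\ closure A `<=` B.

End function_spaces.

Section sobolev.
Variables (R : realType) (N : nat).
Local Notation space := 'rV[R]_N.
Local Notation point := ('rV[R]_N * R)%type.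
Local Notation unit_vec i := (delta_mx ord0 i : 'rV[R]_N).

(* The norm of 'rV[R]_N in the library is the maximum norm. *)
Definition edot (x y : space) : R := \sum_(i < N) x ord0 i * y ord0 i.
Definition enorm (x : space) : R := Num.sqrt (edot x x).

Definition lebesgue_xt :
    {measure set ('rV[R]_N * measurableTypeR R)%type -> \bar R} :=
  (lebesgue_rV R N \x lebesgue_measure)%E.

Definition cylinder (U : set space) (a b : R) : set point :=
  U `*` [set t | a < t < b].

Definition parabolic_boundary (U : set space) (T : R) : set point :=
  (closure U `*` [set 0]) `|`
  ((closure U `\` interior U) `*` [set t | 0 < t <= T]).

Definition loc_integrable (U : set space) (w : space -> R) : Prop :=
  lebesgue_measurable (lebesgue_rV R N) U w /\
  forall K : set space, compact K -> K `<=` U ->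
    (\int[lebesgue_rV R N]_(x in K) (`|w x|)%:E < +oo)%E.

Definition weak_gradient (U : set space) (w : space -> R)
    (g : space -> space) : Prop :=
  [/\ loc_integrable U w,
      forall i, loc_integrable U (fun x => g x ord0 i) &
      forall (i : 'I_N) (phi : space -> R), test_function U phi ->
        (\int[lebesgue_rV R N]_(x in U) (w x * 'D_(unit_vec i) phi x)%:E =
         - \int[lebesgue_rV R N]_(x in U) (g x ord0 i * phi x)%:E)%E].

Definition sobolev (p : R) (U : set space) (w : space -> R) : Prop :=
  exists g : space -> space, [/\ weak_gradient U w g,
    (\int[lebesgue_rV R N]_(x in U) (`|w x| `^ p)%:E < +oo)%E &
    (\int[lebesgue_rV R N]_(x in U) (enorm (g x) `^ p)%:E < +oo)%E].

(* Du is a (jointly measurable) version of the gradient of u in x. *)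
Definition spatial_gradient (U : set space) (a b : R) (u : point -> R)
    (Du : point -> space) : Prop :=
  (forall i,
     lebesgue_measurable lebesgue_xt (cylinder U a b) (fun z => Du z ord0 i)) /\
  \forall t \ae (@lebesgue_measure R), a < t < b ->
    weak_gradient U (fun x => u (x, t)) (fun x => Du (x, t)).

(* The space L^p(a, b; W^{1,p}(U)). *)
Definition parabolic_sobolev (p : R) (U : set space) (a b : R)
    (u : point -> R) : Prop :=
  [/\ lebesgue_measurable lebesgue_xt (cylinder U a b) u,
      \forall t \ae (@lebesgue_measure R), a < t < b ->
        sobolev p U (fun x => u (x, t)) &
      exists2 Du : point -> space, spatial_gradient U a b u Du &
        (\int[lebesgue_xt]_(z in cylinder U a b)
           (`|u z| `^ p + enorm (Du z) `^ p)%:E < +oo)%E].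

Definition time_derivative (phi : point -> R) (z : point) : R :=
  'D_((0, 1) : point) phi z.

Definition space_gradient (phi : point -> R) (z : point) : space :=
  \row_i 'D_((unit_vec i, 0) : point) phi z.

(* At a zero of Du the first factor is 1 if p = 2 and 0 otherwise, so the flux
   |Du|^(p-2) Du vanishes there for every p. *)
Definition weak_form (p : R) (f : space -> R) (Xi : set point)
    (u : point -> R) (Du : point -> space) (phi : point -> R) : \bar R :=
  (\int[lebesgue_xt]_(z in Xi)
     (- u z * time_derivative phi z
      + enorm (Du z) `^ (p - 2) * edot (Du z) (space_gradient phi z)
      - phi z * f (Du z))%:E)%E.

(* The integrals over Xi below do not depend on Du outside the cylinder, which
   contains the support of phi. *)
Definition weak_supersolution (p : R) (f : space -> R) (Xi : set point)
    (u : point -> R) : Prop :=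
  forall (U : set space) (a b : R), domain U -> bounded_set U -> a < b ->
    compactly_contained (cylinder U a b) Xi ->
    parabolic_sobolev p U a b u /\
    forall (Du : point -> space) (phi : point -> R),
      spatial_gradient U a b u Du ->
      test_function (cylinder U a b) phi -> (forall z, 0 <= phi z) ->
      (0 <= weak_form p f Xi u Du phi)%E.

Definition weak_subsolution (p : R) (f : space -> R) (Xi : set point)
    (u : point -> R) : Prop :=
  forall (U : set space) (a b : R), domain U -> bounded_set U -> a < b ->
    compactly_contained (cylinder U a b) Xi ->
    parabolic_sobolev p U a b u /\
    forall (Du : point -> space) (phi : point -> R),
      spatial_gradient U a b u Du ->
      test_function (cylinder U a b) phi -> (forall z, 0 <= phi z) ->
      (weak_form p f Xi u Du phi <= 0)%E.

End sobolev.

(* Main.v *)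
Require Import Defs.
From HB Require Import structures.
From mathcomp Require Import all_boot all_order all_algebra.
From mathcomp Require Import all_classical all_reals all_analysis.
From mathcomp Require Import measurable_realfun ring lra.

(** The idea is to improve upper bounds of the excess [w = u - v - eta t], for a
    fixed [eta > 0]. Write [A x = |x|^(p-2) x] for the flux. Formally the difference
    of the two inequalities reads

      d_t w - div (A (Du) - A (Dv)) <= g,    g = f (Du) - f (Dv) - eta.

    Suppose [w <= m] and [0 < k <= m]. By the boundary condition the function
    [(w - k)_+^2 (c - t)_+^2], with [c < T], vanishes near the boundary of the
    cylinder ([compact_excess_set]) and may be used for testing. The time
    derivative contributes a nonnegative quantity, and what remains is

      int (2 E (w - k)_+ - g (w - k)_+^2) (c - t)_+^2 dz <= 0,

    where [E = (A (Du) - A (Dv)) . (Du - Dv)] is the monotonicity gap of the flux.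
    Since [Du] is bounded and [beta < p], strict monotonicity, compactness and the
    growth of the gap give [|f (Du) - f (Dv)| <= eta / 2 + C E]
    ([source_le_flux_gap]). If [C (m - k) <= 1], the integrand is therefore at least
    [eta / 2] times the test function, which must vanish: [w <= k] before the time
    [c] ([localized_bound], [excess_decreases_before]), hence everywhere. As [C] does
    not depend on [m], the infimum of the bounds is 0 ([excess_le_time]); finally
    [eta] tends to 0 ([weak_comparison]).

    The test function depends on [w], which has no derivative in time, so this
    argument has to be carried out for mollifications in space and time. A
    translated mollifier [rho (y - z)] is a test function in [y]; inserting it in the
    equations gives inequalities between mollified functions at each point [z] near
    the excess set ([weak_form_mollifier]), where the mollified gradients are
    gradients of mollifications ([conv_spatial_gradient]). These pointwise relations
    are multiplied by the smoothed test function and integrated by parts, which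
    only uses that derivatives of functions of bounded support have integral 0,
    a consequence of translation invariance ([integral_derive_eq0],
    [integral_energy_density_le0]).

    In the limit a product of a mollified flux and a mollified gradient appears, of
    which neither factor is bounded. It is dominated with the weight
    [H = (1 + |Du| + |Dv|)^p]: the components [G_i] of the difference of the fluxes
    and [D_i] of the difference of the gradients satisfy
    [|G_i y| |D_i y'| <= 2 (H y + H y')] for all pairs of points, so the product of
    the averages is bounded by an average of [H]. Those averages converge almost
    everywhere along a subsequence and keep the integral of [H], and Fatou's lemma
    applies ([energy_inequality]). *)

Set Implicit Arguments.
Unset Strict Implicit.
Unset Printing Implicit Defensive.

Import Order.TTheory GRing.Theory Num.Theory.
Import numFieldNormedType.Exports.

Local Open Scope classical_set_scope.
Local Open Scope ring_scope.

(** * Lebesgue measure in space-time and translations *)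

Section point_space.
Variables (R : realType) (N : nat).
Local Notation space := 'rV[R]_N.
Local Notation point := ('rV[R]_N * R)%type.
Local Notation mpoint := ('rV[R]_N * measurableTypeR R)%type.
Local Notation mu := (lebesgue_xt R N).

Lemma point_ballE (z y : point) (r : R) : 0 < r ->
  ball z r y <->
  (forall i, `|z.1 ord0 i - y.1 ord0 i| < r) /\ `|z.2 - y.2| < r.
Proof.
move=> r0; split.
  move=> -[/= [_ h1] h2]; split => // i; exact: (h1 ord0 i).
by move=> [h1 h2]; split => //=; split => // i j; rewrite (ord1 i); exact: h1.
Qed.

Lemma point_ball_box (z : point) (r : R) : 0 < r ->
  (ball z r : set mpoint) =
  [set x : space | forall i, `](z.1 ord0 i - r), (z.1 ord0 i + r)[%classic (x ord0 i)] `*`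
   (`](z.2 - r), (z.2 + r)[%classic : set (measurableTypeR R)) /\
  measurable [set x : space | forall i, `](z.1 ord0 i - r), (z.1 ord0 i + r)[%classic (x ord0 i)] /\
  measurable (`](z.2 - r), (z.2 + r)[%classic : set (measurableTypeR R)).
Proof.
move=> r0; split; last first.
  split => //.
  apply: (@measurable_rV_box R N (fun i => `](z.1 ord0 i - r), (z.1 ord0 i + r)[%classic)) => i.
  exact: measurable_itv.
apply/seteqP; split => y.
  move=> /(point_ballE _ _ r0)[h1 h2]; split => [i|] /=.
    by have := h1 i; rewrite /= in_itv /= ltr_norml => /andP[? ?]; apply/andP; split; lra.
  by move: h2; rewrite in_itv /= ltr_norml => /andP[? ?]; apply/andP; split; lra.
move=> [h1 h2]; apply/(point_ballE _ _ r0); split => [i|].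
  by have := h1 i; rewrite /= in_itv /= ltr_norml => /andP[? ?]; apply/andP; split; lra.
by move: h2; rewrite /= in_itv /= ltr_norml => /andP[? ?]; apply/andP; split; lra.
Qed.

Lemma measurable_point_ball (z : point) (r : R) :
  measurable (ball z r : set mpoint).
Proof.
have [r0|r0] := ltP 0 r; last first.
  rewrite (_ : ball z r = set0); first exact: measurable0.
  apply/seteqP; split => // y [[r0' _] _].
  by move: r0'; rewrite ltNge r0.
by have [-> [mA mB]] := point_ball_box z r0; exact: measurableX.
Qed.

(** The measurable sets are generated by coordinates, so openness has to be turned
    into a countable union: of the balls with rational centre and radius
    [1 / (n + 1)] that lie in the set. *)
Lemma open_measurable_point (O : set point) :
  open O -> measurable (O : set mpoint).
Proof.
move=> oO.
pose c (q : 'rV[rat]_N * rat) : point := (map_mx ratr q.1, ratr q.2).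
pose F (q : ('rV[rat]_N * rat) * nat) : set mpoint :=
  if `[< ball (c q.1) (q.2.+1%:R^-1) `<=` O >] then ball (c q.1) (q.2.+1%:R^-1)
  else set0.
have -> : (O : set mpoint) = \bigcup_q F q.
  apply/seteqP; split => [z Oz|z [q _]]; last first.
    by rewrite /F; case: asboolP => // h; exact: h.
  have /nbhs_ballP[e /= e0 he] : nbhs z O by exact: open_nbhs_nbhs.
  have e20 : 0 < e / 2 by rewrite divr_gt0.
  have [n _ /(_ _ (leqnn n)) /= hn] := near_infty_natSinv_lt (PosNum e20).
  have n0 : 0 < n.+1%:R^-1 :> R by rewrite invr_gt0.
  have rat_near (x : R) : exists q : rat, `|ratr q - x| < n.+1%:R^-1.
    move: (n.+1%:R^-1) n0 => r r0.
    have [|q] := @rat_in_itvoo R (x - r) (x + r); first lra.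
    rewrite in_itv /= => /andP[? ?]; exists q; rewrite ltr_norml.
    by apply/andP; split; lra.
  pose q1 : 'rV[rat]_N := \row_i projT1 (cid (rat_near (z.1 ord0 i))).
  pose q2 := projT1 (cid (rat_near z.2)).
  have cz : ball (c (q1, q2)) n.+1%:R^-1 z.
    apply/(point_ballE _ _ n0); split => [i|] /=.
      by rewrite !mxE; exact: (projT2 (cid (rat_near (z.1 ord0 i)))).
    exact: (projT2 (cid (rat_near z.2))).
  exists ((q1, q2), n) => //; rewrite /F asboolT //= => y cy.
  apply: he; apply: (@le_ball _ _ z (n.+1%:R^-1 + n.+1%:R^-1)).
    by rewrite (splitr e) lerD ?ltW.
  by apply: ball_triangle cy; apply: ball_sym.
apply: countable_bigcupT_measurable => // q; rewrite /F.
by case: asboolP => _; [exact: measurable_point_ball|exact: measurable0].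
Qed.

Lemma continuous_measurable_point (f : point -> R) :
  continuous f -> measurable_fun setT (f : mpoint -> R).
Proof.
move=> cf; apply: (measurability (@RGenOInfty.G R) (RGenOInfty.measurableE R)).
move=> _ [_ [x ->] <-]; rewrite setTI; apply: open_measurable_point.
rewrite (_ : _ @^-1` _ = f @^-1` [set y | x < y]); last first.
  by apply/seteqP; split => y /=; rewrite in_itv /= andbT.
by move/continuousP : cf; apply; exact: open_gt.
Qed.

Lemma continuous_measurable_rV (f : space -> R) :
  continuous f -> measurable_fun setT f.
Proof.
move=> cf; have cg : continuous (fun z : point => f z.1).
  by move=> z; apply: continuous_comp; [exact: cvg_fst|exact: cf].
have mg := continuous_measurable_point cg.
have -> : f = (fun z : mpoint => f z.1) \o (fun x => (x, 0)) by [].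
exact: measurableT_comp.
Qed.

(** The map [fun z => z + h], in the form of a map of products, for which the
    product measure is seen to be invariant factor by factor. *)
Definition shift_point (h z : mpoint) : mpoint := (z.1 + h.1, z.2 + h.2).

End point_space.

Section translation.
Variable R : realType.
Local Notation mR := (measurableTypeR R).

Lemma lebesgue_measure_shift (h : R) (A : set mR) : measurable A ->
  lebesgue_measure ((fun x => x + h) @^-1` A) = lebesgue_measure A.
Proof.
move=> mA.
have mh : measurable_fun setT (fun x : mR => (x + h : mR)).
  exact: measurable_funD.
pose ph := isMeasurableFun.Build _ _ mR mR _ mh.
pose sh : {mfun mR >-> mR} := HB.pack (fun x : mR => (x + h : mR)) ph.
apply/esym; apply: (lebesgue_measure_unique (mu := pushforward lebesgue_measure sh)) => //= _ [[a b]] _ <-.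
rewrite /pushforward.
have -> : sh @^-1` `]a, b] = `](a - h), (b - h)]%classic.
  apply/seteqP; split => x /=; rewrite !in_itv /= => /andP[? ?]; apply/andP; split; lra.
rewrite !lebesgue_measure_itv /= !lte_fin ltrD2r; case: ifP => // _.
by congr EFin; lra.
Qed.

Section product.
Context d1 d2 (T1 : measurableType d1) (T2 : measurableType d2).
Variables (m1 : {sigma_finite_measure set T1 -> \bar R})
  (m2 : {sigma_finite_measure set T2 -> \bar R}).
Variables (s1 : T1 -> T1) (s2 : T2 -> T2).
Hypotheses (ms1 : measurable_fun setT s1) (ms2 : measurable_fun setT s2).
Hypothesis (i1 : forall A, measurable A -> m1 (s1 @^-1` A) = m1 A).
Hypothesis (i2 : forall A, measurable A -> m2 (s2 @^-1` A) = m2 A).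

Lemma product_measure_invariant (A : set (T1 * T2)) : measurable A ->
  (m1 \x m2)%E ((fun z => (s1 z.1, s2 z.2)) @^-1` A) = (m1 \x m2)%E A.
Proof.
move=> mA.
have ms : measurable_fun setT (fun z : T1 * T2 => (s1 z.1, s2 z.2)).
  apply/measurable_fun_pairP; split => /=.
    exact: (measurableT_comp ms1 measurable_fst).
  exact: (measurableT_comp ms2 measurable_snd).
pose ph := isMeasurableFun.Build _ _ _ _ _ ms.
pose sh : {mfun (T1 * T2)%type >-> (T1 * T2)%type} := HB.pack (fun z : T1 * T2 => (s1 z.1, s2 z.2)) ph.
apply/esym.
apply: (@product_measure_unique _ _ _ _ _ m1 m2 (pushforward (m1 \x m2)%E sh)) => // B C mB mC.
rewrite /= /pushforward.
have -> : (sh @^-1` (B `*` C)) = (s1 @^-1` B) `*` (s2 @^-1` C) by [].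
have mB' : measurable (s1 @^-1` B) by rewrite -[X in measurable X]setTI; exact: ms1.
have mC' : measurable (s2 @^-1` C) by rewrite -[X in measurable X]setTI; exact: ms2.
transitivity (m1 (s1 @^-1` B) * m2 (s2 @^-1` C))%E.
  exact: product_measure1E.
by rewrite i1 // i2.
Qed.

End product.

Lemma measurable_shift_rV n (h : 'rV[R]_n) :
  measurable_fun setT (fun x : 'rV[R]_n => x + h).
Proof.
apply: measurable_fun_rV => i.
under eq_fun do rewrite mxE.
by apply: measurable_funD => //; exact: measurable_coord.
Qed.

Lemma measurable_shift_R (h : R) :
  measurable_fun setT (fun x : mR => (x + h : mR)).
Proof. exact: measurable_funD. Qed.

Lemma lebesgue_rV_shift n (h : 'rV[R]_n) (A : set 'rV[R]_n) : measurable A ->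
  lebesgue_rV R n ((fun x => x + h) @^-1` A) = lebesgue_rV R n A.
Proof.
elim: n => [|n IH] in h A * => mA.
  by congr (lebesgue_rV R 0 _); apply/funext => x /=; rewrite [x]thinmx0 [h]thinmx0 addr0.
rewrite /= /lebesgue_rV_step /pushforward.
have mA' : measurable (@rV_cons R n @^-1` A).
  by rewrite -[X in measurable X]setTI; exact: (@measurable_rV_cons R n).
rewrite -[RHS](product_measure_invariant (s1 := fun x : mR => (x + h ord0 ord0 : mR))
   (s2 := fun x : 'rV[R]_n => x + (rV_uncons h).2)) //.
- congr (product_measure1 _ _ _); apply/seteqP.
  have E (z : mR * 'rV[R]_n) : rV_cons z + h = rV_cons (z.1 + h ord0 ord0, z.2 + (rV_uncons h).2).
    apply/rowP => i; rewrite !mxE; case: (unliftP ord0 i) => [j ->|->] /=.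
      by rewrite ?liftK ?unlift_none /= !mxE.
    by rewrite ?liftK ?unlift_none.
  by split => z /=; rewrite E.
- exact: measurable_shift_R.
- exact: measurable_shift_rV.
- by move=> B mB; exact: lebesgue_measure_shift.
- by move=> B mB; exact: IH.
Qed.

Variable N : nat.
Local Notation mpoint := ('rV[R]_N * measurableTypeR R)%type.
Local Notation mu := (lebesgue_xt R N).

Lemma measurable_shift_point (h : mpoint) :
  measurable_fun setT (shift_point h : mpoint -> mpoint).
Proof.
apply/measurable_fun_pairP; split => /=.
  exact: (measurableT_comp (measurable_shift_rV h.1) measurable_fst).
exact: (measurableT_comp (measurable_shift_R h.2) measurable_snd).
Qed.

Lemma lebesgue_xt_shift (h : mpoint) (A : set mpoint) : measurable A ->
  mu (shift_point h @^-1` A) = mu A.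
Proof.
move=> mA; apply: (product_measure_invariant (s1 := fun x : 'rV[R]_N => x + h.1) (s2 := fun x : mR => (x + h.2 : mR))) => //.
- exact: measurable_shift_rV.
- exact: measurable_shift_R.
- by move=> B; exact: lebesgue_rV_shift.
- by move=> B; exact: lebesgue_measure_shift.
Qed.

Lemma ge0_integral_shift (h : mpoint) (f : mpoint -> \bar R) :
  measurable_fun setT f -> (forall z, 0 <= f z)%E ->
  (\int[mu]_z f (shift_point h z) = \int[mu]_z f z)%E.
Proof.
move=> mf f0.
pose ph := isMeasurableFun.Build _ _ _ _ _ (measurable_shift_point h).
pose sh : {mfun mpoint >-> mpoint} := HB.pack (shift_point h) ph.
transitivity (\int[pushforward mu sh]_z f z)%E.
  apply/esym.
  by rewrite (ge0_integral_pushforward (measurable_shift_point h)) //=.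
by apply: eq_measure_integral => A mA _; exact: lebesgue_xt_shift.
Qed.

Lemma integrable_shift (h : mpoint) (f : mpoint -> R) :
  mu.-integrable setT (EFin \o f) -> mu.-integrable setT (EFin \o (f \o shift_point h)).
Proof.
move=> /integrableP[mf fi]; apply/integrableP; split.
  exact: (measurableT_comp mf (measurable_shift_point h)).
rewrite (ge0_integral_shift h (f := fun z => `|(f z)%:E|)%E) //.
exact: measurableT_comp.
Qed.

Lemma Rintegral_shift (h : mpoint) (f : mpoint -> R) :
  mu.-integrable setT (EFin \o f) ->
  \int[mu]_z f (shift_point h z) = \int[mu]_z f z.
Proof.
move=> fi; rewrite /Rintegral; congr fine.
have mf : measurable_fun setT (EFin \o f) by case/integrableP : fi.
rewrite integralE [RHS]integralE; congr (_ - _)%E.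
  rewrite -(ge0_integral_shift h (measurable_funepos mf) (funepos_ge0 _)).
  by apply: eq_integral => z _; rewrite !funeposE.
rewrite -(ge0_integral_shift h (measurable_funeneg mf) (funeneg_ge0 _)).
by apply: eq_integral => z _; rewrite !funenegE.
Qed.

End translation.

(** * Null sets and the Lebesgue integral *)

Section almost_everywhere.
Context d (T : measurableType d) (R : realType).
Variable mu : {measure set T -> \bar R}.

Import HBNNSimple.

Let le_nonneg (f g : T -> \bar R) :
  (forall x, 0 <= f x)%E -> (forall x, 0 <= g x)%E ->
  (\forall x \ae mu, f x = g x) ->
  (\int[mu]_x f x <= \int[mu]_x g x)%E.
Proof.
move=> f0 g0 [A [mA A0 fgA]].
rewrite [leLHS]ge0_integralTE // [leRHS]ge0_integralTE //.
apply: ge_ereal_sup => _ [h /= hf <-].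
have mC : measurable (~` A) by exact: measurableC.
rewrite -integralT_nnsfun (@ge0_negligible_integral _ _ _ mu setT A) //; last first.
- by move=> x _; rewrite lee_fin.
- exact/measurable_EFinP/measurable_funP.
rewrite setTD integral_nnsfun // mrestrict.
apply: ereal_sup_ubound; exists (proj_nnsfun h mC) => //= x.
suff: ((((h : T -> R) \_ (~` A)) x)%:E <= g x)%E by rewrite mrestrict.
rewrite patchE; case: ifPn => [/set_mem xA|_]; last exact: g0.
suff <- : f x = g x by exact: hf.
by apply: contrapT => h'; apply: xA; exact: fgA.
Qed.

(** The integral is a supremum of integrals of simple functions below the
    integrand, and such a function may be cut off on a null set. *)
Lemma eq_integral_ae (D : set T) (f g : T -> \bar R) :
  (\forall x \ae mu, D x -> f x = g x) ->
  (\int[mu]_(x in D) f x = \int[mu]_(x in D) g x)%E.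
Proof.
move=> fg; rewrite integral_mkcond [RHS]integral_mkcond integralE [RHS]integralE.
have E : \forall x \ae mu, (f \_ D) x = (g \_ D) x.
  apply: filterS fg => x h; rewrite !patchE; case: ifPn => // /set_mem; exact: h.
by congr (_ - _)%E; apply/eqP; rewrite eq_le; apply/andP; split; apply: le_nonneg => //;
  apply: filterS E => x h; rewrite ?funeposE ?funenegE h.
Qed.

(** Along a subsequence the integrals are summable, hence so are the functions at
    almost every point, and their terms tend to 0 there. *)
Lemma cvg_L1_ae_subsequence (h : nat -> T -> R) :
  (forall n, measurable_fun setT (h n)) -> (forall n x, 0 <= h n x) ->
  (\int[mu]_x (h n x)%:E @[n --> \oo] --> 0)%E ->
  exists s : nat -> nat, (forall n, (n <= s n)%N) /\
    \forall x \ae mu, h (s n) x @[n --> \oo] --> 0.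
Proof.
move=> mh h0 ch.
have ex (n : nat) : exists m : nat, (n <= m)%N /\
    (\int[mu]_x (h m x)%:E <= (1 / (2 ^ n.+1)%:R)%:E)%E.
  have e0 : 0 < 1 / (2 ^ n.+1)%:R :> R.
    by rewrite divr_gt0 // ltr0n expn_gt0.
  move: ch => /fine_cvgP[ch1 /cvgrPdist_le /(_ _ e0) ch2].
  near \oo => m; exists m; split; first by near: m; exact: nbhs_infty_ge.
  have fm : (\int[mu]_x (h m x)%:E \is a fin_num)%E by near: m.
  rewrite -(fineK fm) lee_fin.
  have : `|0 - fine (\int[mu]_x (h m x)%:E)| <= 1 / (2 ^ n.+1)%:R by near: m.
  by rewrite sub0r normrN; apply: le_trans; exact: ler_norm.
pose s n := projT1 (cid (ex n)).
have sP n := projT2 (cid (ex n)).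
exists s; split; first by move=> n; exact: (sP n).1.
have mhs n : measurable_fun setT (fun x => (h (s n) x)%:E) by exact/measurable_EFinP.
have I1 : (\int[mu]_x (\sum_(0 <= n <oo) (h (s n) x)%:E) <= 1%:E)%E.
  rewrite integral_nneseries //; last by move=> n x _; rewrite lee_fin.
  apply: le_trans (epsilon_trick0 xpredT (ler01)).
  by apply: lee_nneseries => [n _ _|n _]; [apply: integral_ge0 => x _; rewrite lee_fin|exact: (sP n).2].
have I2 : mu.-integrable setT (fun x => \sum_(0 <= n <oo) (h (s n) x)%:E)%E.
  apply/integrableP; split.
    by apply: ge0_emeasurable_sum => // n x _ _; rewrite lee_fin.
  rewrite (eq_integral (fun x => \sum_(0 <= n <oo) (h (s n) x)%:E)%E); last first.
    by move=> x _; rewrite gee0_abs // nneseries_ge0 // => n _ _; rewrite lee_fin.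
  exact: le_lt_trans I1 (ltry _).
apply: filterS (integrable_ae measurableT I2) => x /(_ I) fx.
have S1 : (\sum_(0 <= n <oo) (h (s n) x)%:E < +oo)%E by rewrite ltey_eq fx.
have tl := nneseries_tail_cvg S1 (fun n _ => h0 (s n) x).
have : ((h (s n) x)%:E @[n --> \oo] --> 0)%E.
  apply: (squeeze_cvge _ (cvg_cst _) tl); apply: nearW => n.
  rewrite lee_fin h0 /=.
  have := @nneseries_lim_ge R (fun k => (h (s k) x)%:E) xpredT n n.+1 (fun k _ _ => h0 (s k) x).
  by rewrite big_nat1.
by move=> /fine_cvgP[].
Unshelve. all: by end_near. Qed.

End almost_everywhere.

Section ae_rules.
Context d (T : measurableType d) (R : realType).
Variable mu : {measure set T -> \bar R}.

Lemma ae_imply (P Q : T -> Prop) : (forall x, P x -> Q x) ->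
  (\forall x \ae mu, P x) -> \forall x \ae mu, Q x.
Proof. by move=> PQ; apply: filterS. Qed.

Lemma ae_imply2 (P Q S : T -> Prop) : (forall x, P x -> Q x -> S x) ->
  (\forall x \ae mu, P x) -> (\forall x \ae mu, Q x) ->
  \forall x \ae mu, S x.
Proof. by move=> PQS; apply: filterS2. Qed.

End ae_rules.

Section slices.
Context d1 d2 (T1 : measurableType d1) (T2 : measurableType d2) (R : realType).
Variables (m1 : {sigma_finite_measure set T1 -> \bar R})
  (m2 : {sigma_finite_measure set T2 -> \bar R}).

(** By Tonelli's theorem the sections of a null set have measure 0 for almost
    every parameter. *)
Lemma ae_slice (P : T1 * T2 -> Prop) :
  (\forall z \ae (m1 \x m2)%E, P z) ->
  \forall y \ae m2, \forall x \ae m1, P (x, y).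
Proof.
move=> [A [mA A0 PA]].
have mI : measurable_fun setT (fun z : T1 * T2 => (\1_A z)%:E : \bar R).
  by apply/measurable_EFinP.
have : (\int[m1 \x m2]_z (\1_A z)%:E = 0)%E.
  by rewrite integral_indic // setIT; exact: A0.
rewrite (@fubini_tonelli2 _ _ _ _ _ m1 m2) //.
set G := fubini_G _ _ => G0.
have mG : measurable_fun setT G by exact: measurable_fun_fubini_tonelli_G.
have Gge y : (0 <= G y)%E by apply: integral_ge0 => x _; rewrite lee_fin.
have : (\int[m2]_y `|G y|)%E = 0%E.
  by rewrite -[RHS]G0; apply: eq_integral => y _; rewrite gee0_abs.
move=> /(ae_eq_integral_abs _ measurableT mG); apply: filterS => y /(_ I) Gy.
exists (ysection A y); split.
- exact: measurable_ysection.
- rewrite -[ysection A y]setIT -(integral_indic m1 measurableT); last exact: measurable_ysection.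
  rewrite -[RHS]Gy; apply: eq_integral => x _.
  by rewrite !indicE mem_ysection.
- by move=> x nP; rewrite /ysection /= inE; exact: PA.
Qed.

End slices.

Section positive_measure.
Variables (R : realType) (N : nat).
Local Notation point := ('rV[R]_N * R)%type.
Local Notation mpoint := ('rV[R]_N * measurableTypeR R)%type.
Local Notation mu := (lebesgue_xt R N).

Lemma lebesgue_xt_ball (z : point) (r : R) : 0 < r ->
  exists2 c : R, 0 < c & mu (ball z r : set mpoint) = c%:E.
Proof.
move=> r0.
have [-> [mA mB]] := point_ball_box z r0.
pose c := (2 * r) ^+ N * (2 * r).
exists c; first by rewrite mulr_gt0 ?exprn_gt0 ?mulr_gt0.
pose I (a : R) : set (measurableTypeR R) := `](a - r), (a + r)[%classic.
transitivity (lebesgue_rV R N [set x | forall i, I (z.1 ord0 i) (x ord0 i)] *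
  lebesgue_measure (I z.2))%E; first exact: product_measure1E.
have L (a : R) : lebesgue_measure (I a) = (2 * r)%:E.
  rewrite lebesgue_measure_itv /= lte_fin ifT; last by lra.
  by rewrite -EFinB; congr EFin; lra.
rewrite (@lebesgue_rV_box R N (fun i => I (z.1 ord0 i))) //; last by move=> i; exact: measurable_itv.
rewrite L.
rewrite (eq_bigr (fun=> (2 * r)%:E)); last by move=> i _; exact: L.
rewrite prodEFin -EFinM; congr EFin.
by rewrite /c prodr_const card_ord.
Qed.

Lemma bounded_finite_measure (A : set mpoint) : measurable A ->
  bounded_set (A : set point) -> (mu A < +oo)%E.
Proof.
move=> mA [M [Mr hM]].
have M1 : M < `|M| + 1 by rewrite (le_lt_trans (ler_norm _)) // ltrDl.
have M2 : 0 < `|M| + 2 by rewrite ltr_wpDl.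
have [c c0 cE] := lebesgue_xt_ball 0 M2.
apply: (@le_lt_trans _ _ (mu (ball (0 : point) (`|M| + 2) : set mpoint))); last by rewrite cE ltry.
apply: le_measure; rewrite ?inE //; first exact: measurable_point_ball.
move=> z /(hM _ M1) /= zM; rewrite -ball_normE /= sub0r normrN.
by apply: le_lt_trans zM _; rewrite ltrD2l ltr1n.
Qed.

(** Balls have positive measure. This links the suprema and infima in the boundary
    condition, which range over all points, to bounds known only almost
    everywhere. *)
Lemma ae_meets_open (O : set point) (P : point -> Prop) :
  open O -> O !=set0 -> (\forall z \ae mu, O z -> P z) -> exists2 z, O z & P z.
Proof.
move=> oO [z Oz] [A [mA A0 PA]].
have /nbhs_ballP[e /= e0 he] : nbhs z O by exact: open_nbhs_nbhs.
have [c c0 cE] := lebesgue_xt_ball z e0.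
apply: contrapT => nex.
have : (mu (ball z e : set mpoint) <= mu A)%E.
  apply: le_measure; rewrite ?inE //; first exact: measurable_point_ball.
  move=> y zy; apply: PA => /= h; apply: nex; exists y; first exact: he.
  by apply: h; exact: he.
by rewrite cE A0 lee_fin leNgt c0.
Qed.

End positive_measure.

(** * Smooth functions and mollifiers *)

Section smoothness.
Variable R : realType.

Section space.
Variable V : normedModType R.
Implicit Types f g phi : V -> R.

Lemma CkS k phi : Ck k.+1 phi -> Ck k phi.
Proof.
elim: k phi => [|k IH] phi [cphi h]; first by split.
by split => // v; have [dv Cv] := h v; split => //; exact: IH.
Qed.

Lemma Ck_cst k (c : R) : Ck k (fun _ : V => c).
Proof.
elim: k c => [|k IH] c; first by split => //; exact: cst_continuous.
split; first exact: cst_continuous.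
move=> v; split; first by move=> x; exact: derivable_cst.
have -> : (fun x => 'D_v (fun _ : V => c) x) = fun=> 0; last exact: IH.
by apply/funext => x; exact: derive_cst.
Qed.

Lemma CkD k f g : Ck k f -> Ck k g -> Ck k (fun x => f x + g x).
Proof.
elim: k f g => [|k IH] f g [cf hf] [cg hg].
  by split => // x; apply: cvgD; [exact: cf|exact: cg].
split; first by move=> x; apply: cvgD; [exact: cf|exact: cg].
move=> v; have [df Cf] := hf v; have [dg Cg] := hg v; split.
  by move=> x; exact: derivableD.
have -> : (fun x => 'D_v (fun x => f x + g x) x) = fun x => 'D_v f x + 'D_v g x; last exact: IH.
by apply/funext => x; rewrite -deriveD.
Qed.

Lemma CkM k f g : Ck k f -> Ck k g -> Ck k (fun x => f x * g x).
Proof.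
elim: k f g => [|k IH] f g Cf Cg.
  by case: Cf => cf _; case: Cg => cg _; split => // x; apply: cvgM; [exact: cf|exact: cg].
have [cf hf] := Cf; have [cg hg] := Cg.
split; first by move=> x; apply: cvgM; [exact: cf|exact: cg].
move=> v; have [df Dfk] := hf v; have [dg Dgk] := hg v; split.
  by move=> x; exact: derivableM.
have -> : (fun x => 'D_v (fun x => f x * g x) x) = fun x => f x * 'D_v g x + g x * 'D_v f x; last first.
  by apply: CkD; apply: IH => //; exact: CkS.
by apply/funext => x; rewrite -[LHS]/('D_v (f * g) x) deriveM.
Qed.

Lemma Ck_prod k (I : Type) (s : seq I) (F : I -> V -> R) :
  (forall i, Ck k (F i)) -> Ck k (fun x => \prod_(i <- s) F i x).
Proof.
move=> hF; elim: s => [|i s IH].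
  by rewrite (_ : (fun x => _) = fun=> 1); [exact: Ck_cst|apply/funext => x; rewrite big_nil].
rewrite (_ : (fun x => _) = fun x => F i x * \prod_(j <- s) F j x).
  exact: CkM.
by apply/funext => x; rewrite big_cons.
Qed.

End space.

(** Along an affine map every difference quotient is a difference quotient of the
   outer function. *)
Section affine.
Variables (V W : normedModType R) (L L0 : V -> W).
Hypothesis affL : forall (h : R) v x, L (h *: v + x) = h *: L0 v + L x.

Let quotientE (f : W -> R) v x :
  (fun h : R => h^-1 *: (((f \o L) \o shift x) (h *: v) - (f \o L) x)) =
  (fun h : R => h^-1 *: ((f \o shift (L x)) (h *: L0 v) - f (L x))).
Proof. by apply/funext => h /=; rewrite affL. Qed.

Lemma derivable_affine (f : W -> R) v x :
  derivable f (L x) (L0 v) -> derivable (f \o L) x v.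
Proof. by rewrite /derivable quotientE. Qed.

Lemma derive_affine (f : W -> R) v x : 'D_v (f \o L) x = 'D_(L0 v) f (L x).
Proof. by rewrite /derive quotientE. Qed.

Lemma Ck_affine k (f : W -> R) : continuous L -> Ck k f -> Ck k (f \o L).
Proof.
move=> cL; elim: k f => [|k IH] f [cf hf].
  by split => // x; apply: continuous_comp; [exact: cL|exact: cf].
split; first by move=> x; apply: continuous_comp; [exact: cL|exact: cf].
move=> v; have [df Cf] := hf (L0 v); split.
  by move=> x; apply: (@derivable_affine f v x); exact: df.
have -> : (fun x => 'D_v (f \o L) x) = (fun y => 'D_(L0 v) f y) \o L; last exact: IH.
by apply/funext => x; rewrite derive_affine.
Qed.

End affine.

(** For gluing the zero function to functions that vanish to second order. *)
Lemma is_derive_quadratic (f : R -> R) (C : R) :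
  (forall h, `|h| <= 1 -> `|f h| <= C * h ^+ 2) -> is_derive (0 : R) (1 : R) f 0.
Proof.
move=> hf.
have f0 : f 0 = 0.
  have := hf 0; rewrite normr0 expr0n /= mulr0 => /(_ ler01).
  by rewrite normr_le0 => /eqP.
have C0 : 0 <= C.
  by have := hf 1; rewrite normr1 expr1n mulr1 => /(_ (lexx _)); apply: le_trans.
have lim0 : (fun h : R => h^-1 *: ((f \o shift 0) (h *: (1 : R)) - f 0)) @ 0^' --> (0 : R).
  apply/cvgrPdist_le => e e0.
  have d0 : 0 < Num.min 1 (e / (C + 1)).
    by rewrite lt_min ltr01 divr_gt0 // ltr_wpDl.
  near=> h.
  have h0 : h != 0 by near: h; exact: nbhs_dnbhs_neq.
  have hd : `|h| < Num.min 1 (e / (C + 1)).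
    near: h; apply: dnbhs0_lt; exact: d0.
  move: hd; rewrite lt_min => /andP[h1 h2].
  rewrite sub0r normrN /= addr0 f0 subr0 -[h%:A]/(h * 1) mulr1.
  rewrite -[_ *: _]/(h^-1 * f h) normrM normfV.
  have nh0 : 0 < `|h| by rewrite normr_gt0.
  rewrite ler_pdivrMl //; apply: le_trans (hf _ (ltW h1)) _.
  rewrite -real_normK ?num_real // expr2 mulrA mulrC ler_wpM2l //.
  move: h2; rewrite ltr_pdivlMr ?ltr_wpDl // => /ltW; apply: le_trans.
  by rewrite mulrDr mulr1 mulrC lerDl.
split; first by apply/cvg_ex; exists 0.
exact/cvg_lim.
Unshelve. all: by end_near. Qed.

(** The functions [s^-n exp(-1/s)], extended by zero to [s <= 0]; the
    derivative of one is a combination of two others, so all are smooth. *)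
Definition flat (n : nat) (s : R) : R :=
  if 0 < s then s^-1 ^+ n * expR (- s^-1) else 0.

Lemma flat_ge0 n s : 0 <= flat n s.
Proof.
rewrite /flat; case: ifPn => // s0.
by rewrite mulr_ge0 ?expR_ge0 // exprn_ge0 // invr_ge0 ltW.
Qed.

Lemma flat0_gt0 s : (0 < flat 0 s) = (0 < s).
Proof. by rewrite /flat; case: ifPn => h; rewrite ?expr0 ?mul1r ?expR_gt0 // ltxx. Qed.

Lemma flat0_le1 s : flat 0 s <= 1.
Proof.
rewrite /flat; case: ifPn => // s0; rewrite expr0 mul1r.
by rewrite -expR0 ler_expR oppr_le0 invr_ge0 ltW.
Qed.

Lemma flat_quadratic n s : flat n s <= (n.+2)`!%:R * s ^+ 2.
Proof.
rewrite /flat; case: ifPn => [s0|_]; last by rewrite mulr_ge0 // sqr_ge0.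
have i0 : 0 <= s^-1 by rewrite invr_ge0 ltW.
have F0 : 0 < (n.+2)`!%:R :> R by rewrite ltr0n fact_gt0.
rewrite expRN ler_pdivrMr ?expR_gt0 //.
have := expR_ge1Dxn n.+1 i0.
have : 0 <= 1 :> R by [].
move=> h1 h2.
have {h1 h2} : s^-1 ^+ n.+2 / (n.+2)`!%:R <= expR s^-1 by apply: le_trans h2; rewrite lerDr.
rewrite ler_pdivrMr // => h.
have s2 : 0 < s ^+ 2 by rewrite exprn_gt0.
have -> : s^-1 ^+ n = s^-1 ^+ n.+2 * s ^+ 2.
  by rewrite -addn2 exprD -mulrA -exprMn mulVf ?gt_eqF // expr1n mulr1.
have := ler_wpM2r (ltW s2) h.
by move/le_trans; apply; rewrite le_eqVlt; apply/orP; left; apply/eqP; ring.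
Qed.

Lemma is_derive_flat (n : nat) (s : R) :
  is_derive s (1 : R) (flat n) (flat n.+2 s - n%:R * flat n.+1 s).
Proof.
have [s0|s0|->] := ltgtP s 0.
- rewrite /flat ltNge ltW //= mulr0 subr0.
  apply: (@near_eq_is_derive _ _ _ (cst 0)).
    near=> x; rewrite ltNge ltW //=; near: x.
    exact: lt_nbhsl.
- have sn0 : s != 0 by rewrite gt_eqF.
  have d1 : is_derive s 1 (fun x : R => x^-1) (- s ^- 2).
    have := is_deriveV sn0 (is_derive_id s 1).
    by case=> h1 h2; split => //; rewrite h2; exact: mulr1.
  have d2 : is_derive s 1 (fun x => - x^-1) (s ^- 2).
    by rewrite -[X in is_derive _ _ _ X]opprK; exact: is_deriveN.
  have d3 : is_derive s 1 (fun x => expR (- x^-1)) (expR (- s^-1) * s ^- 2).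
    exact: (@is_derive1_comp R expR (fun x => - x^-1)).
  have d4 : is_derive s 1 (fun x : R => x^-1 ^+ n) (- (n%:R * s^-1 ^+ n.+1)).
    case: (n) => [|m].
      rewrite mul0r oppr0; exact: is_derive_cst.
    have [h1 h2] := is_deriveX m.+1 d1.
    rewrite (_ : (fun x : R => _) = (fun x : R => x^-1) ^+ m.+1); last by rewrite exprfctE.
    split; first exact: h1.
    rewrite h2 -[_ *: _]/(_ * _) -exprVn !exprS -mulr_natr; ring.
  have d5 := is_deriveM d4 d3.
  have d6 : is_derive s (1 : R) (fun x => x^-1 ^+ n * expR (- x^-1))
      (flat n.+2 s - n%:R * flat n.+1 s).
    rewrite /flat s0; apply: DeriveDef; first by case: d5.
    have -> : (fun x : R => x^-1 ^+ n * expR (- x^-1)) = (fun x : R => x^-1 ^+ n) * (fun x : R => expR (- x^-1)) by [].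
    rewrite (@derive_val _ _ _ _ _ _ _ d5).
    by rewrite -![_ *: _]/(_ * _) -exprVn !exprS; ring.
  apply: near_eq_is_derive d6.
  by near=> x; rewrite /flat ifT //; near: x; exact: lt_nbhsr.
- rewrite /flat ltxx mulr0 subr0.
  apply: (@is_derive_quadratic _ (n.+2)`!%:R) => h _.
  by rewrite ger0_norm ?flat_ge0 // flat_quadratic.
Unshelve. all: by end_near. Qed.

Lemma derive_scalar (f : R -> R) (s v df : R) :
  is_derive s (1 : R) f df -> is_derive s v f (v * df).
Proof.
move=> [d1 <-]; have /derivable1_diffP df1 := d1.
split; first exact: diff_derivable.
by rewrite !deriveE // -[in LHS](mulr1 v) -[v * 1]/(v *: 1) linearZ.
Qed.

Lemma flat_Ck k n : Ck k (flat n).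
Proof.
have cf m : continuous (flat m).
  move=> s; apply: differentiable_continuous; apply/derivable1_diffP.
  by have [] := is_derive_flat m s.
elim: k n => [|k IH] n; first by split.
split => // v; have dv s := derive_scalar v (is_derive_flat n s).
split; first by move=> s; have [] := dv s.
have -> : (fun x => 'D_v (flat n) x) =
    fun x => v * flat n.+2 x + (- v * n%:R) * flat n.+1 x.
  by apply/funext => s; have [_ ->] := dv s; ring.
by apply: CkD; apply: CkM => //; exact: Ck_cst.
Qed.

End smoothness.

Lemma closed_norm_le (R : realType) (V : normedModType R) (z : V) (r : R) :
  closed [set y : V | `|y - z| <= r].
Proof.
apply: (@preimage_closed _ _ (fun y : V => `|y - z|) [set y | y <= r]); last exact: closed_le.
move=> y _; apply: (@continuous_comp _ _ _ (fun y : V => y - z) (fun x => `|x|)).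
  by apply: cvgB; [exact: cvg_id|exact: cvg_cst].
exact: norm_continuous.
Qed.

Section compactness.
Variables (R : realType) (N : nat).
Local Notation point := ('rV[R]_N * R)%type.

Lemma point_normE (z : point) (M : R) :
  `|z| <= M <-> `|z.1| <= M /\ `|z.2| <= M.
Proof.
rewrite prod_normE ge_max; split; first by move=> /andP[].
by move=> [-> ->].
Qed.

Lemma rV_norm_le (x : 'rV[R]_N) (M : R) :
  0 <= M -> (forall i, `|x ord0 i| <= M) -> `|x| <= M.
Proof.
move=> M0 h; rewrite [leLHS]/Num.Def.normr /= mx_normrE.
by apply/bigmax_leP; split => // -[i j] _ /=; rewrite (ord1 i).
Qed.

Lemma point_bounded_closed_compact (A : set point) :
  bounded_set A -> closed A -> compact A.
Proof.
move=> [M [Mr hM]] cA.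
have {}hM z : A z -> `|z| <= M + 1 by apply: hM; rewrite ltrDl.
pose B1 : set 'rV[R]_N := [set x | `|x| <= M + 1].
have cB1 : compact B1.
  apply: bounded_closed_compact.
    exists (M + 1); split; first exact: num_real.
    by move=> y yM x /= /le_trans; apply; exact: ltW.
  have -> : B1 = [set x | `|x - 0| <= M + 1].
    by apply/seteqP; split => x /=; rewrite subr0.
  exact: closed_norm_le.
apply: (subclosed_compact cA (compact_setX cB1 (@segment_compact R (- (M + 1)) (M + 1)))).
move=> z /hM /point_normE [h1 h2]; split => //=.
by rewrite in_itv /= -ler_norml.
Qed.

End compactness.

Section mollifier.
Variables (R : realType) (N : nat).
Local Notation point := ('rV[R]_N * R)%type.
Local Notation mpoint := ('rV[R]_N * measurableTypeR R)%type.
Local Notation mu := (lebesgue_xt R N).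

(** Evenness gives the kernel [rho (y - z)] the mass 1 in [z] as well as in [y]. *)
Definition mollifier (r : R) (rho : point -> R) : Prop :=
  [/\ forall k, Ck k rho, forall z, 0 <= rho z,
      forall z, rho z != 0 -> `|z| < r, forall z, rho (- z) = rho z &
      \int[mu]_z rho z = 1].

Lemma integrable_bounded_support (f : point -> R) (M r : R) :
  measurable_fun setT (f : mpoint -> R) -> (forall z, `|f z| <= M) ->
  (forall z, f z != 0 -> `|z| < r) ->
  mu.-integrable setT (EFin \o f).
Proof.
move=> mf fM fr.
have M0 : 0 <= M by apply: le_trans (fM 0).
have [r0|r0] := leP r 0.
  have -> : f = fun=> 0.
    apply/funext => z; apply/eqP; apply/negPn/negP => /fr.
    by rewrite ltNge (le_trans r0).
  exact: integrable0.
have [c c0 cE] := lebesgue_xt_ball (0 : point) r0.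
apply/integrableP; split; first exact/measurable_EFinP.
pose B : set mpoint := ball (0 : point) r.
have mB : measurable B by exact: measurable_point_ball.
have le1 : (\int[mu]_z `|(f z)%:E| <= \int[mu]_(z in B) (cst M%:E) z)%E.
  rewrite [leRHS]integral_mkcond; apply: ge0_le_integral => //.
  - by apply: measurableT_comp => //; exact/measurable_EFinP.
  - by apply/(measurable_restrictT _ _).1 => //; exact: measurable_cst.
  - move=> z _; rewrite patchE; case: ifPn => [_|]; first by rewrite lee_fin fM.
    rewrite notin_setE /B -ball_normE /= sub0r normrN => nb.
    have -> : f z = 0; last by rewrite normr0.
    by apply/eqP; apply/negPn/negP => /fr.
apply: le_lt_trans le1 _.
by rewrite integral_cst // [X in (_ * X)%E]cE -EFinM ltry.
Qed.

(** A product over all coordinates of the bump [flat 0 (r - s) * flat 0 (r + s)],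
    divided by its integral. The ball of the maximum norm is exactly where all
    factors are nonzero. *)
Lemma mollifier_exists (r : R) : 0 < r -> exists rho, mollifier r rho.
Proof.
move=> r0.
pose eta s := flat 0 (r - s) * flat 0 (r + s) : R.
have eta0 s : 0 <= eta s by rewrite mulr_ge0 ?flat_ge0.
have eta1 s : eta s <= 1 by rewrite mulr_ile1 ?flat_ge0 ?flat0_le1.
have etaP s : (eta s != 0) = (`|s| < r).
  rewrite mulf_eq0 negb_or.
  have E t : (flat 0 t != 0) = (0 < t :> R).
    by rewrite -flat0_gt0 lt_neqAle flat_ge0 andbT eq_sym.
  by rewrite !E subr_gt0 ltr_norml -ltrBlDl sub0r andbC.
have etaC k : Ck k eta.
  have aff (c e : R) : Ck k (fun s : R => flat 0 (c + e * s)).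
    apply: (@Ck_affine R R R (fun s => c + e * s) (fun s => e * s)).
    - by move=> h v x; rewrite -![_ *: _]/(_ * _); ring.
    - by move=> s; apply: cvgD; [exact: cvg_cst|apply: cvgM; [exact: cvg_cst|exact: cvg_id]].
    - exact: flat_Ck.
  have -> : eta = fun s => flat 0 (r + (-1) * s) * flat 0 (r + 1 * s).
    by apply/funext => s; rewrite /eta mulN1r mul1r.
  exact: CkM.
pose b (z : point) := (\prod_(i < N) eta (z.1 ord0 i)) * eta z.2.
have bC k : Ck k b.
  apply: CkM.
    apply: (@Ck_prod _ _ _ _ _ (fun i (z : point) => eta (z.1 ord0 i))) => i.
    apply: (@Ck_affine _ _ _ (fun z : point => z.1 ord0 i) (fun z : point => z.1 ord0 i)) => //.
      by move=> h v x; rewrite !mxE.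
    move=> z; apply: (@continuous_comp _ _ _ fst (fun x : 'rV[R]_N => x ord0 i)).
      exact: cvg_fst.
    exact: coord_continuous.
  apply: (@Ck_affine _ _ _ (fun z : point => z.2) (fun z : point => z.2)) => //.
  by move=> z; exact: cvg_snd.
have b0 z : 0 <= b z by rewrite mulr_ge0 // prodr_ge0.
have b1 z : b z <= 1.
  by rewrite mulr_ile1 ?prodr_ge0 // prodr_ile1 // => i _; rewrite eta0 eta1.
have bP z : (b z != 0) <-> `|z| < r.
  have -> : `|z| < r <-> ball (0 : point) r z by rewrite -ball_normE /= sub0r normrN.
  rewrite point_ballE // mulf_eq0 negb_or; split.
    move=> /andP[/prodf_neq0 h1]; rewrite etaP => h2.
    split => [i|]; last by rewrite sub0r normrN.
    by rewrite mxE sub0r normrN -etaP; exact: h1.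
  move=> [h1 h2]; apply/andP; split; last by rewrite etaP; move: h2; rewrite sub0r normrN.
  by apply/prodf_neq0 => i _; rewrite etaP; have := h1 i; rewrite mxE sub0r normrN.
have mb : measurable_fun setT (b : mpoint -> R).
  by apply: continuous_measurable_point; have [] := bC 0%N.
have ib : mu.-integrable setT (EFin \o b).
  apply: (@integrable_bounded_support _ 1 r) => // z; first by rewrite ger0_norm.
  by move=> /bP.
pose c := \int[mu]_z b z.
have cge : 0 <= c by apply: Rintegral_ge0.
have c0 : 0 < c.
  rewrite lt_neqAle cge andbT eq_sym; apply/eqP => c0.
  have : (\int[mu]_z `|(b z)%:E| = 0)%E.
    transitivity (\int[mu]_z (b z)%:E)%E.
      by apply: eq_integral => z _; rewrite gee0_abs ?lee_fin.
    by rewrite -(fineK (integrable_fin_num measurableT ib)) [X in X%:E]c0.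
  move=> /(ae_eq_integral_abs _ measurableT) H.
  have {}H : ae_eq mu setT (fun z => (b z)%:E) (cst 0) by apply: H; exact/measurable_EFinP.
  have [||z] := @ae_meets_open R N (ball 0 r) (fun z => b z = 0) (ball_open _ r).
    by exists 0; exact: ballxx.
    by apply: filterS H => z /(_ I) [->].
  rewrite -ball_normE /= sub0r normrN => /bP + bz.
  by rewrite bz eqxx.
exists (fun z => c^-1 * b z); split.
- by move=> k; apply: CkM => //; exact: Ck_cst.
- by move=> z; rewrite mulr_ge0 // invr_ge0.
- by move=> z; rewrite mulf_eq0 negb_or => /andP[_ /bP].
- move=> z; congr (_ * _); rewrite /b; congr (_ * _); last by rewrite /eta opprK mulrC.
  by apply: eq_bigr => i _; rewrite mxE /eta opprK mulrC.
- by rewrite RintegralZl // mulVf // gt_eqF.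
Qed.

Lemma mollifier_test_function (r : R) (rho : point -> R) (U : set point) z :
  mollifier r rho -> (forall y, `|y - z| <= r -> U y) ->
  test_function U (fun y => rho (y - z)).
Proof.
move=> [rC r0 rs _ _] zU.
have sub : closure [set y | rho (y - z) != 0] `<=` [set y | `|y - z| <= r].
  rewrite [X in _ `<=` X](_ : _ = closure [set y | `|y - z| <= r]).
    by apply: closure_subset => y /= /rs /ltW.
  exact/closure_id/closed_norm_le.
split.
- move=> k; apply: (@Ck_affine _ _ _ (fun y : point => y - z) id) => //.
    by move=> h v x; rewrite addrA.
  by move=> y; apply: cvgB; [exact: cvg_id|exact: cvg_cst].
- apply: point_bounded_closed_compact; last exact: closed_closure.
  exists (r + `|z|); split; first exact: num_real.
  move=> M hM y /sub /= yr; apply: le_trans (ltW hM).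
  by rewrite -[y](subrK z); apply: le_trans (ler_normD _ _) _; rewrite lerD2r.
- by move=> y /sub; exact: zU.
Qed.

End mollifier.

(** * Convolution *)

Section convolution.
Variables (R : realType) (N : nat).
Local Notation point := ('rV[R]_N * R)%type.
Local Notation mpoint := ('rV[R]_N * measurableTypeR R)%type.
Local Notation mu := (lebesgue_xt R N).

Let prod_mu : set mpoint -> \bar R := (lebesgue_rV R N \x lebesgue_measure)%E.

Let sf : sigma_finite setT prod_mu.
Proof. exact: sigma_finite_product. Qed.

Let sf_mixin := Measure_isSigmaFinite.Build _ _ _ (lebesgue_rV R N \x lebesgue_measure)%E sf.

(** The measure of space-time bundled with its sigma-finiteness, as Tonelli's
    theorem for pairs of points requires. *)
Definition lebesgue_xt_sigma_finite :
    {sigma_finite_measure set mpoint -> \bar R} :=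
  HB.pack (lebesgue_rV R N \x lebesgue_measure)%E sf_mixin.

Local Notation musf := lebesgue_xt_sigma_finite.

Definition L1 (f : point -> R) : Prop := mu.-integrable setT (EFin \o (f : mpoint -> R)).

Definition bounded_measurable (k : point -> R) : Prop :=
  measurable_fun setT (k : mpoint -> R) /\ exists M, forall z, `|k z| <= M.

(** The kernel is evaluated at [y - z], so that for fixed [z] it is a function of
    the variable of integration that may serve as a test function. *)
Definition conv (f k : point -> R) (z : point) : R :=
  \int[mu]_y (f y * k ((y : point) - z)).

Lemma L1_measurable f : L1 f -> measurable_fun setT (f : mpoint -> R).
Proof. by move=> /integrableP[/measurable_EFinP]. Qed.

Lemma measurable_shiftN (z : point) :
  measurable_fun setT (fun y : mpoint => (y : point) - z : mpoint).
Proof. exact: (measurable_shift_point (- z)). Qed.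

Lemma L1M f k : L1 f -> bounded_measurable k -> L1 (fun y => f y * k y).
Proof.
move=> If [mk [M kM]].
have := @integrableMl _ _ _ mu setT measurableT (EFin \o (f : mpoint -> R)) k If mk.
apply; exists M; split; first exact: num_real.
by move=> M' MM' y _ /=; apply: le_trans (kM y) (ltW MM').
Qed.

Lemma L1D f g : L1 f -> L1 g -> L1 (fun y => f y + g y).
Proof. by move=> If Ig; exact: (integrableD measurableT If Ig). Qed.

Lemma L1Z (c : R) f : L1 f -> L1 (fun y => c * f y).
Proof.
move=> If; rewrite /L1.
have -> : EFin \o ((fun y => c * f y) : mpoint -> R) =
    (fun y => c%:E * (EFin \o (f : mpoint -> R)) y)%E.
  by apply/funext => y /=; rewrite EFinM.
exact: (integrableZl measurableT c If).
Qed.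

Lemma L1_norm f : L1 f -> L1 (fun y => `|f y|).
Proof. by move=> If; exact: (integrable_norm If). Qed.

Lemma bounded_measurable_shift k z :
  bounded_measurable k -> bounded_measurable (fun y => k (y - z)).
Proof.
move=> [mk [M kM]]; split; last by exists M.
exact: (measurableT_comp mk (measurable_shiftN z)).
Qed.

Lemma L1_conv_integrand f k z :
  L1 f -> bounded_measurable k -> L1 (fun y => f y * k (y - z)).
Proof. by move=> If bk; apply: L1M => //; exact: bounded_measurable_shift. Qed.

Let measurable_sub2 :
  measurable_fun setT (fun w : mpoint * mpoint => (w.2 : point) - (w.1 : point) : mpoint).
Proof.
apply/measurable_fun_pairP; split => /=.
  apply: measurable_fun_rV => i; under eq_fun do rewrite !mxE.
  have m2 : measurable_fun setT (fun w : mpoint * mpoint => w.2.1 ord0 i).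
    exact: (measurableT_comp (measurable_coord i) (measurableT_comp measurable_fst measurable_snd)).
  have m1 : measurable_fun setT (fun w : mpoint * mpoint => w.1.1 ord0 i).
    exact: (measurableT_comp (measurable_coord i) (measurableT_comp measurable_fst measurable_fst)).
  exact: measurable_funB.
have m2 : measurable_fun setT (fun w : mpoint * mpoint => w.2.2).
  exact: (measurableT_comp measurable_snd measurable_snd).
have m1 : measurable_fun setT (fun w : mpoint * mpoint => w.1.2).
  exact: (measurableT_comp measurable_snd measurable_fst).
exact: measurable_funB.
Qed.

Lemma measurable_conv_integrand f k :
  measurable_fun setT (f : mpoint -> R) -> measurable_fun setT (k : mpoint -> R) ->
  measurable_fun setT (fun w : mpoint * mpoint => f w.2 * k ((w.2 : point) - (w.1 : point))).
Proof.
move=> mf mk; apply: measurable_funM.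
  exact: (measurableT_comp mf measurable_snd).
exact: (measurableT_comp mk measurable_sub2).
Qed.

Lemma measurable_conv f k : L1 f -> bounded_measurable k ->
  measurable_fun setT (conv f k : mpoint -> R).
Proof.
move=> /L1_measurable mf [mk _].
have mI := measurable_conv_integrand mf mk.
pose F (w : mpoint * mpoint) := (f w.2 * k ((w.2 : point) - (w.1 : point)))%:E.
have -> : conv f k = fine \o (fun z : mpoint =>
   \int[musf]_y F^\+%E (z, y) - \int[musf]_y F^\-%E (z, y))%E.
  apply/funext => z /=; rewrite /conv /Rintegral integralE; congr fine.
  by congr (_ - _)%E; apply: eq_integral => y _; rewrite ?funeposE ?funenegE.
apply: measurableT_comp; first exact: fine_measurable.
apply: emeasurable_funB; apply: measurable_fun_fubini_tonelli_F => //.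
- by apply: measurable_funepos; exact/measurable_EFinP.
- by apply: measurable_funeneg; exact/measurable_EFinP.
Qed.

Lemma conv_bound f k M : L1 f -> bounded_measurable k -> (forall z, `|k z| <= M) ->
  forall z, `|conv f k z| <= M * \int[mu]_y `|f y|.
Proof.
move=> If bk kM z.
have Iz := L1_conv_integrand z If bk.
apply: le_trans (le_normr_Rintegral measurableT Iz) _.
rewrite -RintegralZl //; last exact: integrable_norm.
apply: le_Rintegral => //.
- exact: integrable_norm.
- exact: (L1Z M (L1_norm If)).
- by move=> y _; rewrite normrM mulrC ler_wpM2r.
Qed.

Lemma bounded_measurable_conv f k : L1 f -> bounded_measurable k ->
  bounded_measurable (conv f k).
Proof.
move=> If bk; split; first exact: measurable_conv.
have [_ [M kM]] := bk; exists (M * \int[mu]_y `|f y|); exact: conv_bound.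
Qed.

Lemma convD f g k z : L1 f -> L1 g -> bounded_measurable k ->
  conv (fun y => f y + g y) k z = conv f k z + conv g k z.
Proof.
move=> If Ig bk; rewrite -RintegralD //; [|exact: L1_conv_integrand..].
by apply: eq_Rintegral => y _; rewrite mulrDl.
Qed.

Lemma convZ (c : R) f k z : L1 f -> bounded_measurable k ->
  conv (fun y => c * f y) k z = c * conv f k z.
Proof.
move=> If bk; rewrite -RintegralZl //; last exact: L1_conv_integrand.
by apply: eq_Rintegral => y _; rewrite mulrA.
Qed.

(** Differentiation under the integral sign. The minus sign is on the direction,
    as the kernel is evaluated at [y - z]. *)
Lemma is_derive_conv f k v z : L1 f -> bounded_measurable k ->
  (forall y, derivable k y v) -> bounded_measurable ('D_v k) ->
  is_derive z (- v) (conv f k) (conv f ('D_v k) z).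
Proof.
move=> If bk dk bDk.
have [_ [M DM]] := bDk.
have M0 : 0 <= M by apply: le_trans (DM 0).
pose g (s : R) (y : mpoint) : R := f y * k ((y : point) - (z - s *: v)).
have aff (y : point) (h : R) (w x : R) :
    y - (z - (h *: w + x) *: v) = h *: (w *: v) + (y - (z - x *: v)).
  rewrite -[h *: w]/(h * w) scalerDl -scalerA !opprB.
  by rewrite -(addrA (h *: (w *: v))) (addrCA y).
have dg (s : R) (y : mpoint) : is_derive s (1 : R) (g ^~ y) (f y * 'D_v k ((y : point) - (z - s *: v))).
  have H : is_derive s (1 : R) (k \o (fun s : R => (y : point) - (z - s *: v)))
      ('D_v k ((y : point) - (z - s *: v))).
    split.
      by apply: (derivable_affine (aff y)); rewrite scale1r.
    by rewrite (derive_affine (aff y)) scale1r.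
  exact: (is_deriveZ (f y) H).
have Ig s : mu.-integrable setT (EFin \o g s).
  exact: (L1_conv_integrand (z - s *: v) If bk).
have IG : mu.-integrable setT (EFin \o (fun y => M * `|f y|)).
  exact: (L1Z M (L1_norm If)).
have pE s y : partial1of2 g s y = f y * 'D_v k ((y : point) - (z - s *: v)).
  by rewrite partial1of2E; have [_ ->] := dg s y.
have := @cvg_differentiation_under_integral R _ _ mu g setT measurableT 0 (-1) 1.
move=> /(_ _ (fun s _ => Ig s) _ (fun y => M * `|f y|) _ IG).
have E : (fun h : R => h^-1 *: ((conv f k \o shift z) (h *: (- v)) - conv f k z)) =
  (fun h : R => h^-1 *: (\int[mu]_y g (h + 0) y - \int[mu]_y g 0 y)).
  apply/funext => h; rewrite /g addr0 scale0r subr0 /conv /=.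
  by rewrite scalerN [- _ + z]addrC.
move=> H.
have {}H : h^-1 *: (\int[mu]_y g (h + 0) y - \int[mu]_y g 0 y) @[h --> 0^'] -->
    \int[mu]_y (partial1of2 g) 0 y.
  apply: H.
  - by rewrite /= in_itv /= ltrN10 ltr01.
  - by move=> s y _ _; have [] := dg s y.
  - by move=> y; rewrite mulr_ge0.
  - by move=> s y _ _; rewrite pE normrM mulrC ler_wpM2r.
have RE : \int[mu]_y (partial1of2 g) 0 y = conv f ('D_v k) z.
  by apply: eq_Rintegral => y _; rewrite pE scale0r subr0.
rewrite RE -E in H.
by split; [apply/cvg_ex; exists (conv f ('D_v k) z)|exact/cvg_lim].
Qed.

End convolution.

(** * Mollification *)

Section mollifier_properties.
Variables (R : realType) (N : nat).
Local Notation point := ('rV[R]_N * R)%type.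
Local Notation mpoint := ('rV[R]_N * measurableTypeR R)%type.
Local Notation mu := (lebesgue_xt R N).
Local Notation musf := (lebesgue_xt_sigma_finite R N).

Lemma derive_opp_direction (V : normedModType R) (k : V -> R) (x v : V) :
  derivable k x v -> derivable k x (- v) /\ 'D_(- v) k x = - 'D_v k x.
Proof.
move=> dk.
have aff (h w s : R) : (h *: w + s) *: v + x = h *: (w *: v) + (s *: v + x).
  by rewrite scalerDl scalerA addrA.
have x0 : (0 : R) *: v + x = x by rewrite scale0r add0r.
have d1 : derivable (k \o (fun s : R => s *: v + x)) 0 1.
  by apply: (derivable_affine aff); rewrite x0 scale1r.
have e1 : 'D_1 (k \o (fun s : R => s *: v + x)) 0 = 'D_v k x.
  by rewrite (derive_affine aff) x0 scale1r.
have aff' (h w s : R) : (h *: w + s) *: (- v) + x = h *: (w *: (- v)) + (s *: (- v) + x).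
  by rewrite scalerDl scalerA addrA.
have [d2 e2] := derive_scalar (-1) (DeriveDef d1 e1).
have E (h : R) : h^-1 *: ((k \o shift x) (h *: - v) - k x) =
    h^-1 *: (((k \o (fun s : R => s *: v + x)) \o shift (0 : R)) (h *: (-1)) -
       (k \o (fun s : R => s *: v + x)) 0).
  rewrite /= x0 addr0 -[h *: -1]/(h * -1) mulrN1; congr (_ *: (k (_ + _) - _)).
  by rewrite scalerN scaleNr.
split.
  by move: d2; rewrite /derivable; under [in X in X -> _]eq_fun do rewrite -E.
by rewrite -mulN1r -e2 /derive; under [in RHS]eq_fun do rewrite -E.
Qed.

Lemma continuous_bounded_support (k : point -> R) r : continuous k ->
  (forall z, k z != 0 -> `|z| <= r) -> bounded_measurable k.
Proof.
move=> ck kr; split; first exact: continuous_measurable_point.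
have cB : compact [set z : point | `|z - 0| <= r].
  apply: point_bounded_closed_compact; last exact: closed_norm_le.
  exists r; split; first exact: num_real.
  by move=> M rM z /=; rewrite subr0 => /le_trans; apply; exact: ltW.
have : compact (k @` [set z : point | `|z - 0| <= r]).
  by apply: continuous_compact => //; exact: continuous_subspaceT.
move=> /compact_bounded [M [_ hM]].
exists (`|M| + 1) => z.
have M0 : 0 <= `|M| + 1 by rewrite addr_ge0.
have [->|/eqP kz] := eqVneq (k z) 0; first by rewrite normr0.
apply: (hM (`|M| + 1)); first by rewrite (le_lt_trans (ler_norm M)) // ltrDl.
by exists z => //=; rewrite subr0; apply: kr; apply/eqP.
Qed.

Lemma derive_support (k : point -> R) r v :
  (forall z, k z != 0 -> `|z| <= r) -> forall z, 'D_v k z != 0 -> `|z| <= r.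
Proof.
move=> kr z; apply: contraNT; rewrite -ltNge => rz; apply/eqP.
rewrite -[RHS](derive_cst (0 : R) z v); apply: near_eq_derive.
have : nbhs z (~` [set y : point | `|y - 0| <= r]).
  apply: open_nbhs_nbhs; split; first exact/closed_openC/closed_norm_le.
  by rewrite /= subr0; apply/negP; rewrite -ltNge.
apply: filterS => y /=; rewrite subr0 => yr.
by apply/eqP; apply: contraT => /kr.
Qed.

Section one.
Variables (r : R) (rho : point -> R).
Hypothesis mol : mollifier r rho.

Lemma mollifier_ge0 z : 0 <= rho z. Proof. by have [] := mol. Qed.

Lemma mollifier_support z : rho z != 0 -> `|z| <= r.
Proof. by have [_ _ h _ _] := mol => /h /ltW. Qed.

Lemma mollifier_bounded : bounded_measurable rho.
Proof.
apply: (@continuous_bounded_support _ r); last exact: mollifier_support.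
by have [h _ _ _ _] := mol; have [] := h 0%N.
Qed.

Lemma mollifier_derivable (v z : point) : derivable rho z v.
Proof. by have [h _ _ _ _] := mol; have [_ /(_ v)[]] := h 1%N. Qed.

Lemma mollifier_derive_bounded (v : point) : bounded_measurable ('D_v rho).
Proof.
apply: (@continuous_bounded_support _ r).
  by have [h _ _ _ _] := mol; have [_ /(_ v)[_ []]] := h 1%N.
exact: derive_support mollifier_support.
Qed.

Lemma is_derive_mollification f (v z : point) : L1 f ->
  is_derive z v (conv f rho) (- conv f ('D_v rho) z).
Proof.
move=> If; have dv y := derive_opp_direction (@mollifier_derivable v y).
have E : 'D_(- v) rho = fun y => - 'D_v rho y by apply/funext => y; have [] := dv y.
have bN : bounded_measurable ('D_(- v) rho) by exact: mollifier_derive_bounded.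
have [d1 d2] := is_derive_conv z If mollifier_bounded (fun y => (dv y).1) bN.
rewrite opprK in d1 d2; split => //.
rewrite d2 E /conv -mulN1r -RintegralZl //.
  by apply: eq_Rintegral => y _; rewrite mulN1r mulrN.
exact: (L1_conv_integrand z If (mollifier_derive_bounded v)).
Qed.

Lemma mollifier_mass_left (z : point) : (\int[mu]_y (rho ((y : point) - z))%:E = 1)%E.
Proof.
have [mr _] := mollifier_bounded.
pose h : mpoint := - z.
transitivity (\int[mu]_y (EFin \o (rho : mpoint -> R)) (shift_point h y))%E; first by [].
rewrite ge0_integral_shift; last 2 first.
- exact/measurable_EFinP.
- by move=> y; rewrite lee_fin mollifier_ge0.
have [_ _ _ _ m1] := mol.
have Ir : mu.-integrable setT (EFin \o (rho : mpoint -> R)).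
  have [M hM] := mollifier_bounded.2.
  apply: (@integrable_bounded_support _ _ _ M r) => //.
  by have [] := mol.
by rewrite -(fineK (integrable_fin_num measurableT Ir)) [X in X%:E]m1.
Qed.

Lemma mollifier_mass_right (y : point) :
  (\int[mu]_z (rho (y - (z : point)))%:E = 1)%E.
Proof.
have [_ _ _ ev _] := mol.
rewrite -(mollifier_mass_left y); apply: eq_integral => z _.
by rewrite -ev opprB.
Qed.

(** Averaging preserves mass, by Tonelli's theorem. *)
Lemma mollification_integral_ge0 (g : point -> R) :
  measurable_fun setT (g : mpoint -> R) -> (forall z, 0 <= g z) ->
  (\int[mu]_z \int[mu]_y (g y * rho ((y : point) - (z : point)))%:E =
   \int[mu]_y (g y)%:E)%E.
Proof.
move=> mg g0.
have [mr _] := mollifier_bounded.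
pose F (w : mpoint * mpoint) := (g w.2 * rho ((w.2 : point) - (w.1 : point)))%:E.
have mF : measurable_fun setT F.
  by apply/measurable_EFinP; exact: measurable_conv_integrand.
have F0 w : (0 <= F w)%E by rewrite lee_fin mulr_ge0 // mollifier_ge0.
have := @fubini_tonelli _ _ _ _ R musf musf F mF F0.
rewrite /F /= => ->; apply: eq_integral => y _.
under eq_integral do rewrite EFinM.
rewrite ge0_integralZl //.
- by rewrite [X in (_ * X)%E]mollifier_mass_right mule1.
- apply/measurable_EFinP.
  have := measurableT_comp mr (measurable_shiftN (y : point)).
  have [_ _ _ ev _] := mol.
  by congr measurable_fun; apply/funext => z /=; rewrite -ev opprB.
- by move=> z _; rewrite lee_fin mollifier_ge0.
- by rewrite lee_fin.
Qed.

Lemma EFin_conv f k (z : point) : L1 f -> bounded_measurable k ->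
  (\int[mu]_y (f y * k ((y : point) - z))%:E = (conv f k z)%:E)%E.
Proof.
move=> If bk; rewrite /conv /Rintegral fineK //.
exact: integrable_fin_num (L1_conv_integrand z If bk).
Qed.

Lemma conv_ge0 f z : (forall y, 0 <= f y) -> 0 <= conv f rho z.
Proof. by move=> f0; apply: Rintegral_ge0 => y _; apply: mulr_ge0 => //; exact: mollifier_ge0. Qed.

Lemma integral_mollification_ge0 g : L1 g -> (forall y, 0 <= g y) ->
  (\int[mu]_z (conv g rho z)%:E = \int[mu]_z (g z)%:E)%E.
Proof.
move=> Ig g0; rewrite -(mollification_integral_ge0 (L1_measurable Ig) g0).
by apply: eq_integral => z _; rewrite (EFin_conv _ Ig mollifier_bounded).
Qed.

Lemma norm_conv_le f z : L1 f -> `|conv f rho z| <= conv (fun y => `|f y|) rho z.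
Proof.
move=> If; have br := mollifier_bounded.
apply: le_trans (le_normr_Rintegral measurableT (L1_conv_integrand z If br)) _.
rewrite le_eqVlt; apply/orP; left; apply/eqP/eq_Rintegral => y _.
by rewrite normrM (ger0_norm (mollifier_ge0 _)).
Qed.

Let measurable_mollification f : L1 f ->
  measurable_fun setT (fun z : mpoint => (conv f rho z)%:E).
Proof. by move=> If; apply/measurable_EFinP; exact: (measurable_conv If mollifier_bounded). Qed.

Lemma norm_mollification_le f : L1 f ->
  (\int[mu]_z `|(conv f rho z)%:E| <= \int[mu]_z `|(f z)%:E|)%E.
Proof.
move=> If.
have -> : (\int[mu]_z `|(f z)%:E| = \int[mu]_z (conv (fun y => `|f y|%R) rho z)%:E)%E.
  by rewrite (integral_mollification_ge0 (L1_norm If)).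
apply: ge0_le_integral => //.
- by apply: measurableT_comp => //; exact: measurable_mollification.
- exact: (measurable_mollification (L1_norm If)).
- by move=> z _; rewrite lee_fin norm_conv_le.
Qed.

Lemma L1_mollification f : L1 f -> L1 (conv f rho).
Proof.
move=> If; apply/integrableP; split; first exact: measurable_mollification.
by apply: le_lt_trans (norm_mollification_le If) _; have /integrableP[] := If.
Qed.

(** The mollification at [z] is an average of the values of [f] at distance at
    most [r]. *)
Lemma conv_le_near f (z : point) (c : R) : L1 f ->
  (\forall y \ae mu, `|(y : point) - z| <= r -> f y <= c) ->
  conv f rho z <= c.
Proof.
move=> If fc; have br := mollifier_bounded.
rewrite -lee_fin -(EFin_conv z If br).
have If' := L1_conv_integrand z If br.
have Ir : mu.-integrable setT (fun y : mpoint => (rho ((y : point) - z))%:E).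
  apply/integrableP; split.
    by apply/measurable_EFinP; have [] := bounded_measurable_shift z br.
  under eq_integral do rewrite gee0_abs ?lee_fin ?mollifier_ge0 //.
  by rewrite mollifier_mass_left ltry.
apply: (@le_trans _ _ (\int[mu]_y (c%:E * (rho ((y : point) - z))%:E))%E); last first.
  by rewrite integralZl // mollifier_mass_left mule1.
have Ic := integrableZl measurableT c Ir.
pose G (y : mpoint) : R := Num.max (f y * rho ((y : point) - z)) (c * rho ((y : point) - z)).
have -> : (\int[mu]_y (c%:E * (rho ((y : point) - z))%:E) = \int[mu]_y (G y)%:E)%E.
  apply: eq_integral_ae; apply: ae_imply fc => y fy _.
  rewrite /G -EFinM; congr EFin; apply/esym/max_idPr.
  have [->|rn] := eqVneq (rho (y - z)) 0; first by rewrite !mulr0.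
  by rewrite ler_wpM2r ?mollifier_ge0 //; apply: fy; exact: mollifier_support.
have Gm : measurable_fun setT G.
  apply: measurable_maxr.
    exact: (L1_measurable If').
  apply: measurable_funM => //.
  by have [] := bounded_measurable_shift z br.
apply: le_integral => //.
  have := integrableD measurableT (integrable_abse If') (integrable_abse Ic).
  apply: le_integrable => //; first exact/measurable_EFinP.
  move=> y _ /=. rewrite lee_fin.
  rewrite [leRHS]ger0_norm ?addr_ge0 //.
  by rewrite /G; case: (leP (f y * rho (y - z))) => _; rewrite ?lerDl ?lerDr.
by move=> y _; rewrite lee_fin le_max lexx.
Qed.

End one.

End mollifier_properties.

(** * Convergence of mollifications in the mean *)

Section ereal_cvg0.
Variable R : realType.

Lemma cvge0_le (u : nat -> \bar R) : (forall n, 0 <= u n)%E ->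
  (forall e : R, 0 < e -> \forall n \near \oo, (u n <= e%:E)%E) ->
  (u @ \oo --> 0)%E.
Proof.
move=> u0 ue; apply/fine_cvgP; split.
  near=> n; rewrite ge0_fin_numE //; apply: (@le_lt_trans _ _ 1%:E); last exact: ltry.
  by near: n; exact: ue.
apply/cvgrPdist_le => e e0; near=> n.
have un : (u n <= e%:E)%E by near: n; exact: ue.
have fu : (u n \is a fin_num)%E by rewrite ge0_fin_numE // (le_lt_trans un) // ltry.
rewrite sub0r normrN ger0_norm /=; last exact: fine_ge0.
by rewrite -lee_fin fineK.
Unshelve. all: by end_near. Qed.

Lemma cvge0_near (u : nat -> \bar R) (e : R) : (forall n, 0 <= u n)%E ->
  (u @ \oo --> 0)%E -> 0 < e -> \forall n \near \oo, (u n <= e%:E)%E.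
Proof.
move=> u0 /fine_cvgP[fu /cvgrPdist_le /(_ e) h] e0.
near=> n.
have fn : (u n \is a fin_num)%E by near: n.
rewrite -(fineK fn) lee_fin; apply: le_trans (ler_norm _) _.
by rewrite -normrN -sub0r; near: n; exact: h.
Unshelve. all: by end_near. Qed.

End ereal_cvg0.

Section mollification_L1.
Variables (R : realType) (N : nat).
Local Notation point := ('rV[R]_N * R)%type.
Local Notation mpoint := ('rV[R]_N * measurableTypeR R)%type.
Local Notation mu := (lebesgue_xt R N).

Variables (r : nat -> R) (rho : nat -> point -> R).
Hypothesis mol : forall n, mollifier (r n) (rho n).
Hypothesis r0 : r @ \oo --> 0.

Definition mollification_error (f : point -> R) (n : nat) : \bar R :=
  (\int[mu]_z `|(conv f (rho n) z - f z)%:E|)%E.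

(** Convergence of the mollifications in the mean, as a property of the function:
    it is stable under linear combinations and limits in the mean, so it can be
    extended from indicators of open sets to all functions needed. *)
Definition approximable (f : point -> R) : Prop :=
  L1 f /\ (mollification_error f n @[n --> \oo] --> 0)%E.

Lemma mollification_error_ge0 f n : (0 <= mollification_error f n)%E.
Proof. exact: integral_ge0. Qed.

Lemma L1B (f g : point -> R) : L1 f -> L1 g -> L1 (fun y => f y - g y).
Proof.
move=> If Ig; have := L1D If (L1Z (-1) Ig).
by congr L1; apply/funext => y; rewrite mulN1r.
Qed.

Lemma convB (f g : point -> R) k z : L1 f -> L1 g -> bounded_measurable k ->
  conv (fun y => f y - g y) k z = conv f k z - conv g k z.
Proof.
move=> If Ig bk; rewrite -RintegralB //; [|exact: L1_conv_integrand..].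
by apply: eq_Rintegral => y _; rewrite mulrBl.
Qed.

Let mnorm (f : point -> R) : L1 f -> measurable_fun setT (fun z : mpoint => `|(f z)%:E|%E).
Proof. by move=> /integrableP[h _]; exact: measurableT_comp. Qed.

Let Ierr f n : L1 f -> L1 (fun z => conv f (rho n) z - f z).
Proof. by move=> If; apply: L1B => //; exact: L1_mollification (mol n) _ If. Qed.

(** Mollification is a contraction in the mean. *)
Lemma approximable_lim f : L1 f ->
  (forall e : R, 0 < e -> exists2 g, approximable g &
     (\int[mu]_z `|(f z - g z)%:E| <= e%:E)%E) ->
  approximable f.
Proof.
move=> If app; split => //; apply: cvge0_le; first exact: mollification_error_ge0.
move=> e e0.
have e3 : 0 < e / 3 by rewrite divr_gt0.
have [g [Ig cg] fg] := app _ e3.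
have := cvge0_near (mollification_error_ge0 g) cg e3.
apply: filterS => n gn.
have Ifg := L1B If Ig.
have bn := mollifier_bounded (mol n).
have -> : e = e / 3 + (e / 3 + e / 3) by field.
rewrite !EFinD.
apply: (@le_trans _ _ (\int[mu]_z `|(conv (fun y => f y - g y) (rho n) z)%:E| +
   (\int[mu]_z `|(conv g (rho n) z - g z)%:E| + \int[mu]_z `|(f z - g z)%:E|))%E); last first.
  apply: leeD; last by apply: leeD.
  exact: le_trans (norm_mollification_le (mol n) Ifg) fg.
have I1 := mnorm (L1_mollification (mol n) Ifg).
have I2 := mnorm (Ierr n Ig).
have I3 := mnorm Ifg.
rewrite -ge0_integralD // -ge0_integralD //; last by apply: emeasurable_funD.
apply: ge0_le_integral => //.
- exact: mnorm (Ierr n If).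
- by apply: emeasurable_funD => //; apply: emeasurable_funD.
- move=> z _; rewrite -!EFinD lee_fin convB //.
  have -> : conv f (rho n) z - f z = (conv f (rho n) z - conv g (rho n) z) +
    ((conv g (rho n) z - g z) - (f z - g z)) by ring.
  apply: le_trans (ler_normD _ _) _; rewrite lerD2l.
  by apply: le_trans (ler_normB _ _) _.
- by move=> z _; exact: adde_ge0.
Qed.

Lemma approximableD f g : approximable f -> approximable g ->
  approximable (fun z => f z + g z).
Proof.
move=> [If cf] [Ig cg]; split; first exact: L1D.
apply: (@squeeze_cvge _ _ _ _ (fun=> 0%E) _ (fun n => mollification_error f n + mollification_error g n)%E).
- apply: nearW => n; rewrite mollification_error_ge0 /=.
  have bn := mollifier_bounded (mol n).
  have I2 := mnorm (Ierr n If); have I3 := mnorm (Ierr n Ig).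
  rewrite /mollification_error -ge0_integralD //.
  apply: ge0_le_integral => //.
  + exact: mnorm (Ierr n (L1D If Ig)).
  + exact: emeasurable_funD.
  + move=> z _; rewrite -!EFinD lee_fin convD // opprD addrACA.
    exact: ler_normD.
- exact: cvg_cst.
- by rewrite -[X in _ --> X](adde0 0%E); apply: cvgeD.
Qed.

Lemma approximableZ (c : R) f : approximable f -> approximable (fun z => c * f z).
Proof.
move=> [If cf]; split; first exact: L1Z.
have -> : mollification_error (fun z => c * f z) = (fun n => `|c|%:E * mollification_error f n)%E.
  apply/funext => n; rewrite /mollification_error.
  have bn := mollifier_bounded (mol n).
  rewrite -ge0_integralZl //; last exact: mnorm (Ierr n If).
  by apply: eq_integral => z _; rewrite convZ // -mulrBr !abse_EFin normrM EFinM.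
rewrite -[X in _ --> X](mule0 `|c|%:E); apply: cvgeZl => //.
Qed.

Lemma approximable0 : approximable (fun=> 0).
Proof.
have I0 : L1 (fun _ : point => 0) by exact: integrable0.
split => //.
have -> : mollification_error (fun=> 0) = fun=> 0%E; last exact: cvg_cst.
apply/funext => n; apply: integral0_eq => z _.
have -> : conv (fun _ : point => 0) (rho n) z = 0.
  rewrite /conv /Rintegral; under eq_integral do rewrite mul0r.
  by rewrite integral0.
by rewrite subrr abse_EFin normr0.
Qed.

Lemma approximableB f g : approximable f -> approximable g ->
  approximable (fun z => f z - g z).
Proof.
move=> af ag; have := approximableD af (approximableZ (-1) ag).
by congr approximable; apply/funext => z; rewrite mulN1r.
Qed.

Lemma approximable_sum (I : Type) (s : seq I) (F : I -> point -> R) :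
  (forall i, approximable (F i)) -> approximable (fun z => \sum_(i <- s) F i z).
Proof.
move=> hF; elim: s => [|i s IH].
  by have := approximable0; congr approximable; apply/funext => z; rewrite big_nil.
have := approximableD (hF i) IH.
by congr approximable; apply/funext => z; rewrite big_cons.
Qed.

Let L1_indic (A : set mpoint) : measurable A -> (mu A < +oo)%E -> L1 (\1_A : mpoint -> R).
Proof.
move=> mA fA; apply/integrableP; split; first exact/measurable_EFinP.
rewrite (eq_integral (fun z : mpoint => (\1_A z)%:E)); last first.
  by move=> z _; rewrite gee0_abs ?lee_fin.
by rewrite integral_indic // setIT.
Qed.

(** For an open set the mollified indicator tends to 1 inside and keeps its
    mass, which forces convergence in the mean. *)
Lemma approximable_open (O : set point) : open O -> bounded_set O ->
  approximable (\1_(O : set mpoint) : mpoint -> R).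
Proof.
move=> oO bO; pose f : point -> R := \1_(O : set mpoint).
have mO := open_measurable_point oO.
have fO := bounded_finite_measure mO bO.
have If : L1 f by exact: L1_indic.
split => //.
have f0 z : 0 <= f z by rewrite /f indicE.
have f1 z : f z <= 1 by rewrite /f indicE; case: (_ \in _).
have a1 n z : conv f (rho n) z <= 1.
  by apply: (conv_le_near (mol n)) => //; apply: aeW.
have a0 n z : 0 <= conv f (rho n) z by exact: (conv_ge0 (mol n)).
pose h n (z : mpoint) : R := f z * (1 - conv f (rho n) z).
have mh n : measurable_fun setT (h n).
  apply: measurable_funM; first exact: L1_measurable.
  by apply: measurable_funB => //; exact: measurable_conv If (mollifier_bounded (mol n)).
have h0 n z : 0 <= h n z by rewrite mulr_ge0 // subr_ge0.
have E n : mollification_error f n = (2%:E * \int[mu]_z (h n z)%:E)%E.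
  have Ia := L1_mollification (mol n) If.
  have ma : measurable_fun setT (fun z : mpoint => (conv f (rho n) z)%:E).
    by have /integrableP[] := Ia.
  have mf : measurable_fun setT (fun z : mpoint => (f z)%:E) by have /integrableP[] := If.
  have mhE : measurable_fun setT (fun z => (h n z)%:E) by exact/measurable_EFinP.
  have ff : (\int[mu]_z (f z)%:E \is a fin_num)%E by exact: integrable_fin_num If.
  have key : (mollification_error f n + \int[mu]_z (f z)%:E =
      2%:E * \int[mu]_z (h n z)%:E + \int[mu]_z (f z)%:E)%E.
    rewrite -[X in (_ = _ + X)%E](integral_mollification_ge0 (mol n) If) //.
    rewrite -ge0_integralZl //; last by move=> z _; rewrite lee_fin.
    rewrite -!ge0_integralD //.
    - apply: eq_integral => z _; rewrite -EFinM -!EFinD; congr EFin.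
      rewrite /h /f indicE; case: (_ \in _) => /=; last first.
        by rewrite subr0 ger0_norm // mul0r mulr0 addr0 add0r.
      rewrite -/f ler0_norm ?subr_le0 //; ring.
    - by move=> z _; rewrite lee_fin mulr_ge0.
    - by apply: emeasurable_funM.
    - by move=> z _; rewrite lee_fin.
    - by apply: mnorm; exact: Ierr.
    - by move=> z _; rewrite lee_fin.
  by have := congr1 (fun x => x - \int[mu]_z (f z)%:E)%E key; rewrite !addeK.
rewrite (_ : mollification_error f = fun n => (2%:E * \int[mu]_z (h n z)%:E)%E); last exact/funext.
have Dc : (\int[mu]_z (h n z)%:E @[n --> \oo] --> \int[mu]_z (cst 0 z))%E.
  apply: (@dominated_cvg _ _ _ mu setT measurableT (fun n z => (h n z)%:E) (cst 0)%E (EFin \o f)) => //.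
  - by move=> n; exact/measurable_EFinP.
  - move=> z _; have [Oz|nOz] := pselect (O z); last first.
      under eq_fun do rewrite /h /f indicE memNset // mul0r.
      exact: cvg_cst.
    have /nbhs_ballP[e /= e0 he] : nbhs z O by exact: open_nbhs_nbhs.
    apply: cvg_near_cst.
    have : \forall n \near \oo, `|0 - r n| < e by move/cvgrPdist_lt: r0; apply.
    apply: filterS => n; rewrite sub0r normrN => rn.
    rewrite /h /f indicE mem_set // mul1r -/f; congr EFin.
    suff -> : conv f (rho n) z = 1 by rewrite subrr.
    have := mollifier_mass_left (mol n) z; rewrite /conv /Rintegral => m1.
    rewrite -[RHS]/(fine 1%:E) -m1; congr fine; apply: eq_integral => y _.
    have [->|rz] := eqVneq (rho n (y - z)) 0; first by rewrite mulr0.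
    rewrite /f indicE mem_set ?mul1r //; apply: he; rewrite -ball_normE /= distrC.
    apply: le_lt_trans (mollifier_support (mol n) rz) _.
    exact: le_lt_trans (ler_norm _) rn.
  - move=> n z _; rewrite gee0_abs ?lee_fin // /h.
    by rewrite ler_piMr // lerBlDr lerDl.
rewrite -[X in _ --> X](mule0 2%:E); apply: cvgeZl => //.
by rewrite integral0 in Dc.
Qed.

Let measurable_generated_by_open (A : set mpoint) :
  measurable A -> <<s [set O : set point | open O] >> A.
Proof.
move=> mA.
pose T' := g_sigma_algebraType [set O : set point | open O].
have mc (c : point -> R) : continuous c ->
    measurable_fun setT (c : T' -> measurableTypeR R).
  move=> cc; apply: (measurability (@RGenOInfty.G R) (RGenOInfty.measurableE R)).
  move=> _ [_ [x ->] <-]; rewrite setTI; apply: sub_sigma_algebra.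
  rewrite (_ : _ @^-1` _ = c @^-1` [set y | x < y]); last first.
    by apply/seteqP; split => y /=; rewrite in_itv /= andbT.
  by move/continuousP : cc; apply; exact: open_gt.
have m1 : measurable_fun setT (fun z : T' => (z : point).1).
  apply: measurable_fun_rV => i; apply: (mc (fun z : point => z.1 ord0 i)).
  move=> z; apply: (@continuous_comp _ _ _ fst (fun x : 'rV[R]_N => x ord0 i)).
    exact: cvg_fst.
  exact: coord_continuous.
have m2 : measurable_fun setT (fun z : T' => (z : point).2 : measurableTypeR R).
  by apply: mc => z; exact: cvg_snd.
have mid : measurable_fun setT (fun z : T' => (z : mpoint)).
  by apply/measurable_fun_pairP; split.
by have := mid measurableT A mA; rewrite setTI.
Qed.

Let indicI (A B : set mpoint) : \1_(A `&` B) = (\1_A \* \1_B : mpoint -> R).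
Proof.
apply/funext => z /=; rewrite !indicE in_setI.
by case: (_ \in A); case: (_ \in B); rewrite /= ?mulr1 ?mulr0.
Qed.

(** The sets for which this holds form a Dynkin system that contains the open
    sets; the ball keeps all measures finite. *)
Lemma approximable_set (A : set mpoint) (M : R) : measurable A ->
  approximable (\1_(A `&` (ball (0 : point) M : set mpoint)) : mpoint -> R).
Proof.
move=> mA; pose B : set mpoint := ball (0 : point) M.
have oB : open (B : set point) by exact: ball_open.
have bB : bounded_set (B : set point).
  exists M; split; first exact: num_real.
  move=> M' MM' z; rewrite /B -ball_normE /= sub0r normrN => zM.
  by rewrite ltW // (lt_trans zM).
have mB : measurable B by exact: open_measurable_point.
have fB : (mu B < +oo)%E by exact: bounded_finite_measure.
have fI C : measurable C -> (mu (C `&` B) < +oo)%E.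
  move=> mC; apply: le_lt_trans fB; apply: le_measure; rewrite ?inE //.
  exact: measurableI.
have genE : @measurable _ mpoint = <<s [set O : set point | open O] >>.
  apply/seteqP; split; first exact: measurable_generated_by_open.
  by apply: smallest_sub => [|O]; [exact: sigma_algebra_measurable|exact: open_measurable_point].
apply: (@dynkin_induction _ mpoint [set O : set point | open O]
   (fun A => approximable (\1_(A `&` B) : mpoint -> R))) => //.
- by move=> O O' oO oO'; exact: openI.
- by rewrite setTI; exact: approximable_open.
- move=> O oO; apply: approximable_open; first exact: openI.
  by have [M' [rM' hM']] := bB; exists M'; split => // x Mx z [_ /(hM' x Mx)].
- move=> S mS aS.
  have := approximableB (approximable_open oB bB) aS.
  congr approximable; apply/funext => z.
  rewrite (indicI (~` S) B) (indicI S B) /= !indicE in_setC.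
  by case: (z \in S); case: (z \in B); rewrite /= ?(mulr1, mulr0, mul0r, subrr, subr0).
- move=> F mF tF aF.
  pose U n := \big[setU/set0]_(k < n) F k.
  have mU n : measurable (U n) by apply: bigsetU_measurable => i _; exact: mF.
  have mUF : measurable (\bigcup_k F k) by exact: bigcupT_measurable.
  pose g n : point -> R := \1_(U n `&` B).
  have ag n : approximable (g n).
    elim: n => [|n IH].
      rewrite /g /U big_ord0 set0I.
      have := approximable0; congr approximable; apply/funext => z.
      by rewrite indicE in_set0.
    have := approximableD IH (aF n); congr approximable; apply/funext => z.
    rewrite /g (indicI (U n) B) (indicI (F n) B) (indicI (U n.+1) B) /= {2}/U big_ord_recr /= -/(U n) !indicE in_setU -mulrDl.
    congr (_ * _); have [Uz|] := boolP (z \in U n); last by rewrite add0r.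
    have [Fz|] := boolP (z \in F n); last by rewrite addr0.
    move: Uz; rewrite inE /U -bigcup_mkord => -[k /= kn Fk].
    move/trivIsetP: tF => /(_ k n I I); rewrite (ltn_eqF kn) => /(_ isT).
    by move=> kn0; have : (F k `&` F n) z; [split => //; exact/set_mem|rewrite kn0].
  apply: approximable_lim.
    by apply: L1_indic; [exact: measurableI|exact: fI].
  move=> e e0.
  pose f : point -> R := \1_((\bigcup_k F k) `&` B).
  have If : L1 f by apply: L1_indic; [exact: measurableI|exact: fI].
  have IB : L1 (\1_B : mpoint -> R) by exact: L1_indic.
  have H1 : {ae mu, forall z : mpoint, setT z -> (EFin \o g n) z @[n --> \oo] --> (EFin \o f) z}.
    apply: aeW => z _; apply: cvg_near_cst.
    have [[k _ Fk]|nF] := pselect ((\bigcup_k F k) z).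
      exists k.+1 => // n /= kn; rewrite /g /f /= (indicI (U n) B) (indicI _ B) /= !indicE; congr (_ * _)%:E.
      rewrite !mem_set //; first by exists k.
      by rewrite /U -bigcup_mkord; exists k.
    apply: nearW => n; rewrite /g /f /= (indicI (U n) B) (indicI _ B) /= !indicE; congr (_ * _)%:E.
    rewrite !memNset //; rewrite /U -bigcup_mkord => -[k _ Fk]; apply: nF.
    by exists k.
  have H2 : {ae mu, forall (z : mpoint) n, setT z -> (`|(EFin \o g n) z| <= (EFin \o (\1_B : mpoint -> R)) z)%E}.
    apply: aeW => z n _ /=; rewrite /g (indicI (U n) B) /= lee_fin normrM !indicE.
    by case: (z \in U n); case: (z \in B); rewrite /= ?(normr0, normr1, mulr1, mulr0, mul0r).
  have [_ Dc _] := dominated_convergence measurableT (fun n => measurable_int mu (ag n).1)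
     (measurable_int mu If) H1 IB H2.
  have [|n _ hn] := cvge0_near _ Dc e0; first by move=> n; exact: integral_ge0.
  exists (g n) => //; move: (hn n (leqnn n)); apply: le_trans.
  rewrite le_eqVlt; apply/orP; left; apply/eqP; apply: eq_integral => z _.
  by rewrite -EFinB !abse_EFin distrC.
- by rewrite -genE.
Qed.

Import HBSimple.

(** Integrable functions are limits in the mean of simple functions. *)
Lemma approximable_bounded_support (f : point -> R) (M : R) : L1 f ->
  (forall z, f z != 0 -> `|z| < M) -> approximable f.
Proof.
move=> If fM; pose B : set mpoint := ball (0 : point) M.
have mB : measurable B by exact: measurable_point_ball.
have [g_ [Ig _ cg]] := @approximation_sfun_integrable _ _ _ mu setT measurableT _ If.
apply: approximable_lim => // e e0.
have [|n _ hn] := cvge0_near _ cg e0; first by move=> n; exact: integral_ge0.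
pose g z := \sum_(y <- finmap.enum_fset (fset_set (range (g_ n)))) y * (\1_((g_ n @^-1` [set y]) `&` B) z : R).
have ag : approximable g.
  apply: approximable_sum => y; apply: approximableZ; apply: approximable_set.
  exact: measurable_sfunP.
exists g => //; move: (hn n (leqnn n)); apply: le_trans.
have gE (z : mpoint) : g z = g_ n z * \1_B z.
  rewrite /g [in RHS]fimfunE (fsbig_finite _ _ (fimfunP (g_ n))) /= mulr_suml.
  by apply: eq_bigr => y _; rewrite (indicI _ B) /= mulrA.
apply: ge0_le_integral => //.
- by apply: measurableT_comp => //; exact: measurable_int (L1B If ag.1).
- apply: measurableT_comp => //; apply: emeasurable_funB => //.
    exact: measurable_int If.
  exact: measurable_int (Ig n).
- move=> z _; rewrite gE -EFinB !abse_EFin lee_fin indicE.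
  have [zB|zB] := boolP (z \in B); first by rewrite mulr1.
  have -> : f z = 0.
    apply/eqP; apply: contraT => /fM zM; move: zB; rewrite notin_setE /B -ball_normE /=.
    by rewrite sub0r normrN.
  by rewrite mulr0 subrr normr0.
Qed.

(** One subsequence has to serve all the functions at once, since the energy
    density is built from all of them. *)
Lemma mollification_ae (I : finType) (F : I -> point -> R) :
  (forall i, approximable (F i)) ->
  exists s : nat -> nat, (forall n, (n <= s n)%N) /\
    \forall z \ae mu, forall i, conv (F i) (rho (s n)) z @[n --> \oo] --> F i z.
Proof.
move=> aF.
pose h n (z : mpoint) := \sum_i `|conv (F i) (rho n) z - F i z|.
have mi n i : measurable_fun setT (fun z : mpoint => `|conv (F i) (rho n) z - F i z|).
  exact: L1_measurable (L1_norm (Ierr n (aF i).1)).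
have mh n : measurable_fun setT (h n) by exact: measurable_sum.
have h0 n z : 0 <= h n z by exact: sumr_ge0.
have ch : (\int[mu]_x (h n x)%:E @[n --> \oo] --> 0)%E.
  rewrite (_ : (fun n => _) = (fun n => \sum_i mollification_error (F i) n)%E).
    rewrite [X in _ --> X](_ : _ = \sum_(i : I) 0)%E; last by rewrite big1.
    apply: cvg_nnesum => [i _|i _]; last exact: (aF i).2.
    by apply: nearW => n; exact: mollification_error_ge0.
  apply/funext => n; rewrite /h; under eq_integral do rewrite -sumEFin.
  rewrite ge0_integral_sum //; last by move=> i; exact/measurable_EFinP.
have [s [sn cs]] := cvg_L1_ae_subsequence mh h0 ch.
exists s; split => //; apply: ae_imply cs => z cz i.
apply/subr_cvg0; apply: norm_cvg0.
apply: (squeeze_cvgr _ (cvg_cst 0) cz); apply: nearW => n; rewrite normr_ge0 /=.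
by rewrite /h (bigD1 i) //= lerDl sumr_ge0.
Qed.

End mollification_L1.

(** * Integrals of directional derivatives *)

Section directional_calculus.
Variable R : realType.

Lemma is_derive_lineP (V : normedModType R) (F : V -> R) (z v : V) (d : R) :
  is_derive z v F d <-> is_derive (0 : R) (1 : R) (fun s => F (s *: v + z)) d.
Proof.
have E : (fun h : R => h^-1 *: ((F \o shift z) (h *: v) - F z)) =
    (fun h : R => h^-1 *: (((fun s => F (s *: v + z)) \o shift (0 : R)) (h *: (1 : R))
       - F ((0 : R) *: v + z))).
  apply/funext => h /=; rewrite scale0r add0r addr0.
  by rewrite -[h *: 1]/(h * 1) mulr1.
by split => -[]; rewrite /derivable /derive => h1 h2; split;
  rewrite /derivable /derive ?E // -E.
Qed.

Lemma is_derive_comp (V : normedModType R) (f : V -> R) (g : R -> R) (z v : V) (df dg : R) :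
  is_derive z v f df -> is_derive (f z) (1 : R) g dg ->
  is_derive z v (fun x => g (f x)) (dg * df).
Proof.
move=> /is_derive_lineP hf hg; apply/is_derive_lineP.
have hg' : is_derive (f ((0 : R) *: v + z)) (1 : R) g dg by rewrite scale0r add0r.
exact: (@is_derive1_comp R g (fun s => f (s *: v + z)) 0 _ _ hg' hf).
Qed.

(** Positive parts are differentiated in powers only: the square and the cube are
    continuously differentiable. *)
Definition pos (s : R) : R := Num.max s 0.

Lemma pos_ge0 s : 0 <= pos s. Proof. by rewrite /pos le_max lexx orbT. Qed.

Lemma pos_eq0 s : s <= 0 -> pos s = 0. Proof. by move=> h; apply/max_idPr. Qed.

Lemma pos_le_norm s : pos s <= `|s|.
Proof. by rewrite /pos ge_max ler_norm normr_ge0. Qed.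

Lemma is_derive_pos_pow (m : nat) (s : R) :
  is_derive s (1 : R) (fun x => pos x ^+ m.+2) (m.+2%:R * pos s ^+ m.+1).
Proof.
have [s0|s0|->] := ltgtP s 0.
- rewrite pos_eq0 ?ltW // expr0n /= mulr0.
  have dc := is_derive_cst (0 : R) s (1 : R).
  apply: near_eq_is_derive dc.
  near=> x; rewrite pos_eq0 ?expr0n //; apply: ltW; near: x; exact: lt_nbhsl.
- have -> : pos s = s by apply/max_idPl; exact: ltW.
  have d1 : is_derive s (1 : R) (fun x : R => x ^+ m.+2) (m.+2%:R * s ^+ m.+1).
    have [h1 h2] := is_deriveX m.+2 (is_derive_id s (1 : R)).
    have -> : (fun x : R => x ^+ m.+2) = (@id R) ^+ m.+2 by rewrite exprfctE.
    by split => //; rewrite h2; exact: mulr1.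
  apply: near_eq_is_derive d1; near=> x.
  have -> // : pos x = x; apply/max_idPl; apply: ltW; near: x; exact: lt_nbhsr.
- rewrite (pos_eq0 (lexx 0)) expr0n /= mulr0.
  apply: (@is_derive_quadratic _ _ 1) => h h1; rewrite mul1r.
  have p0 := pos_ge0 h.
  have ph := pos_le_norm h.
  rewrite ger0_norm ?exprn_ge0 // -[m.+2]addn2 exprD -[leRHS]mul1r.
  apply: ler_pM; rewrite ?exprn_ge0 //.
    by rewrite exprn_ile1 // (le_trans ph).
  by rewrite -[leRHS]real_normK ?num_real // lerXn2r ?nnegrE.
Unshelve. all: by end_near. Qed.

Lemma continuous_pos : continuous pos.
Proof. by move=> x; apply: continuous_max; [exact: cvg_id|exact: cvg_cst]. Qed.

End directional_calculus.

Section integral_of_derivative.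
Variables (R : realType) (N : nat).
Local Notation point := ('rV[R]_N * R)%type.
Local Notation mpoint := ('rV[R]_N * measurableTypeR R)%type.
Local Notation mu := (lebesgue_xt R N).

(** The difference quotients have integral zero because the measure is
    invariant under translation. *)
Lemma integral_derive_eq0 (psi : point -> R) (e : point) (r M : R) :
  bounded_measurable psi -> (forall z, psi z != 0 -> `|z| <= r) ->
  (forall z, derivable psi z e) -> (forall z, `|'D_e psi z| <= M) ->
  L1 ('D_e psi) /\ \int[mu]_z 'D_e psi z = 0.
Proof.
move=> [mpsi [B psiB]] psir dpsi DM.
have Ipsi : L1 psi.
  apply: (@integrable_bounded_support _ _ _ B (r + 1)) => // z /psir zr.
  by rewrite (le_lt_trans zr) // ltrDl.
pose h (n : nat) : R := n.+1%:R^-1.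
have h0 n : 0 < h n by rewrite invr_gt0.
have h1 n : h n <= 1 by rewrite invf_le1 // ler1n.
pose q n (z : point) : R := (h n)^-1 * (psi (h n *: e + z) - psi z).
have sh n (z : mpoint) : psi (h n *: e + z) = psi (shift_point (h n *: e) z).
  by congr psi; rewrite addrC.
have Ish n : L1 (fun z => psi (h n *: e + z)).
  have := integrable_shift (h n *: e : point) Ipsi.
  by congr integrable; apply/funext => z /=; rewrite sh.
have Iq n : L1 (q n) by apply: L1Z; exact: L1B.
have q0 n : \int[mu]_z q n z = 0.
  have E : \int[mu]_z psi (h n *: e + z) = \int[mu]_z psi z.
    rewrite -(Rintegral_shift (h n *: e : point) Ipsi).
    by apply: eq_Rintegral => z _; rewrite sh.
  rewrite /q RintegralZl //; last exact: L1B.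
  have -> : \int[mu]_z (psi (h n *: e + z) - psi z) = 0; last by rewrite mulr0.
  by have := RintegralB measurableT (Ish n) Ipsi => /= ->; rewrite E subrr.
pose r' := r + `|e| + 1.
pose Bd (z : mpoint) : R := `|M| * \1_(ball (0 : point) r' : set mpoint) z.
have mball : measurable (ball (0 : point) r' : set mpoint) by exact: measurable_point_ball.
have IBd : L1 Bd.
  apply: (@integrable_bounded_support _ _ _ `|M| r').
  - by apply: measurable_funM => //; exact: measurable_indic.
  - by move=> z; rewrite /Bd normrM normr_id indicE; case: (_ \in _); rewrite ?normr1 ?normr0 ?mulr1 ?mulr0.
  - move=> z; rewrite /Bd indicE; case: (boolP (z \in _)) => [|_]; last by rewrite mulr0 eqxx.
    by rewrite inE -ball_normE /= sub0r normrN.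
have qB n z : `|q n z| <= Bd z.
  rewrite /Bd indicE; case: (boolP (z \in _)) => [_|]; last first.
    rewrite notin_setE -ball_normE /= sub0r normrN => /negP; rewrite -leNgt => zr.
    have p0 y : r < `|y| -> psi y = 0.
      by move=> ry; apply/eqP; apply: contraT => /psir; rewrite leNgt ry.
    rewrite /q !p0 ?subrr ?mulr0 ?normr0 ?mulr0 //.
      by apply: lt_le_trans zr; rewrite /r' -addrA ltrDl ltr_wpDl.
    have : `|z| <= `|h n *: e + z| + `|h n *: e|.
      by have := ler_normB (h n *: e + z) (h n *: e); rewrite [_ + z]addrC addrK.
    rewrite normrZ (ger0_norm (ltW (h0 n))) => zh.
    have : h n * `|e| <= `|e| by rewrite ler_piMl.
    move: zr zh; rewrite /r'; move: (h n * `|e|) => a; lra.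
  rewrite mulr1.
  pose gl (s : R) := psi (s *: e + z).
  have dgl (s : R) : is_derive s (1 : R) gl ('D_e psi (s *: e + z)).
    have aff (a w x : R) : (a *: w + x) *: e + z = a *: (w *: e) + (x *: e + z).
      by rewrite scalerDl scalerA addrA.
    split.
      by apply: (derivable_affine aff); rewrite scale1r.
    by rewrite (derive_affine aff) scale1r.
  have cgl : {within `[0, h n], continuous gl}.
    apply: continuous_subspaceT => s; apply: differentiable_continuous.
    by apply/derivable1_diffP; have [] := dgl s.
  have [s _] := MVT_segment (ltW (h0 n)) (fun s _ => dgl s) cgl.
  rewrite /gl scale0r add0r subr0 => E.
  rewrite /q E mulrC mulfK ?gt_eqF //.
  by apply: le_trans (DM _) (ler_norm _).
have cq z : q n z @[n --> \oo] --> 'D_e psi z.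
  have hc : (forall n, h n != 0) /\ h n @[n --> \oo] --> 0.
    by split; [move=> n; rewrite gt_eqF|exact: cvg_harmonic].
  have := dpsi z; rewrite /derivable => /cvgr_dnbhsP.
  exact.
have mD : measurable_fun setT (fun z : mpoint => ('D_e psi z)%:E).
  apply: (emeasurable_fun_cvg (fun n (z : mpoint) => (q n z)%:E)).
    by move=> n; exact: measurable_int (Iq n).
  by move=> z _; apply/fine_cvgP; split; [exact: nearW|exact: cq].
have H1 : {ae mu, forall z : mpoint, setT z -> (EFin \o q n) z @[n --> \oo] --> ('D_e psi z)%:E}.
  by apply: aeW => z _; apply/fine_cvgP; split; [exact: nearW|exact: cq].
have H2 : {ae mu, forall (z : mpoint) n, setT z -> (`|(EFin \o q n) z| <= (EFin \o Bd) z)%E}.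
  by apply: aeW => z n _ /=; rewrite lee_fin.
have [ID _ Dc] := dominated_convergence measurableT (fun n => measurable_int mu (Iq n)) mD H1 IBd H2.
split => //.
have E0 : (fun n => \int[mu]_z (EFin \o q n) z)%E = fun=> 0%E.
  apply/funext => n; rewrite -(fineK (integrable_fin_num measurableT (Iq n))).
  by congr EFin; exact: q0.
rewrite [X in X @ _ --> _]E0 in Dc.
have E1 := cvg_unique (@ereal_hausdorff R) Dc (cvg_cst 0%E).
by rewrite /Rintegral [X in fine X]E1.
Qed.

End integral_of_derivative.

(** * The energy estimate for mollified functions *)

Section energy.
Variables (R : realType) (N : nat).
Local Notation point := ('rV[R]_N * R)%type.
Local Notation mpoint := ('rV[R]_N * measurableTypeR R)%type.
Local Notation mu := (lebesgue_xt R N).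

Definition time_dir : point := (0, 1).
Definition space_dir (i : 'I_N) : point := (delta_mx ord0 i, 0).

Lemma is_derive_mul (V : normedModType R) (F G : V -> R) (z v : V) (dF dG : R) :
  is_derive z v F dF -> is_derive z v G dG ->
  is_derive z v (fun x => F x * G x) (F z * dG + G z * dF).
Proof. by move=> hF hG; exact: is_deriveM. Qed.

Lemma is_derive_subc (V : normedModType R) (F : V -> R) (z v : V) (dF k : R) :
  is_derive z v F dF -> is_derive z v (fun x => F x - k) dF.
Proof.
move=> hF; rewrite -[dF]subr0.
exact: (is_deriveB hF (is_derive_cst k z v)).
Qed.

Lemma is_derive_time_cutoff (c : R) (z v : point) :
  is_derive z v (fun x : point => pos (c - x.2) ^+ 2) (2%:R * pos (c - z.2) ^+ 1 * - v.2).
Proof.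
apply: (@is_derive_comp _ _ (fun x : point => c - x.2) (fun s => pos s ^+ 2)); last first.
  exact: is_derive_pos_pow.
have aff (h : R) (u x : point) : (h *: u + x).2 = h *: u.2 + x.2 by [].
have d2 : is_derive z v (fun x : point => x.2) v.2.
  split; first by apply: (@derivable_affine _ _ _ snd snd aff id); exact: derivable_id.
  by rewrite (@derive_affine _ _ _ snd snd aff id) derive_id.
rewrite -[- v.2]add0r.
exact: (is_deriveB (is_derive_cst c z v) d2).
Qed.

Lemma conv_le_affine (r : R) (rho f H : point -> R) (z : point) (a b : R) :
  mollifier r rho -> L1 f -> L1 H -> (forall y, f y <= a * H y + b) ->
  conv f rho z <= a * conv H rho z + b.
Proof.
move=> mol If IH fH.
have br := mollifier_bounded mol.
rewrite -lerBlDl -convZ // -convB //; last exact: L1Z.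
apply: (conv_le_near mol); first by apply: L1B => //; exact: L1Z.
by apply: aeW => y _; rewrite lerBlDl.
Qed.

(** A product of two averages is a double average of products at different
    points; hence the hypothesis has to bound [f y * g y'] for all pairs. *)
Lemma conv_product_le (r : R) (rho f g H : point -> R) (z : point) (C : R) :
  mollifier r rho -> L1 f -> L1 g -> L1 H ->
  (forall y y', `|f y| * `|g y'| <= C * (H y + H y')) ->
  `|conv f rho z * conv g rho z| <= 2%:R * C * conv H rho z.
Proof.
move=> mol If Ig IH fg.
have br := mollifier_bounded mol.
have s1 y : `|f y| * conv (fun y => `|g y|) rho z <= C * conv H rho z + C * H y.
  rewrite -(convZ `|f y| z (L1_norm Ig) br).
  apply: (conv_le_affine z mol) => //; first by apply: L1Z; exact: L1_norm.
  by move=> y'; rewrite addrC -mulrDr.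
have s2 : conv (fun y => `|f y|) rho z * conv (fun y => `|g y|) rho z <=
    C * conv H rho z + C * conv H rho z.
  rewrite mulrC -(convZ _ z (L1_norm If) br).
  apply: (conv_le_affine z mol) => //; first by apply: L1Z; exact: L1_norm.
  by move=> y; rewrite mulrC addrC; exact: s1.
have -> : 2%:R * C * conv H rho z = C * conv H rho z + C * conv H rho z by ring.
apply: le_trans s2; rewrite normrM; apply: ler_pM => //; exact: (norm_conv_le mol).
Qed.

Section one_mollifier.
Variables (r : R) (rho : point -> R).
Hypothesis mol : mollifier r rho.
Variables (w g H : point -> R) (G D : 'I_N -> point -> R) (K : set point).
Variables (k c M C rK : R).
Hypotheses (Iw : L1 w) (Ig : L1 g) (IH : L1 H).
Hypotheses (IG : forall i, L1 (G i)) (ID : forall i, L1 (D i)).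
Hypothesis wM : forall z, `|w z| <= M.
Hypothesis H0 : forall z, 0 <= H z.
Hypothesis GDH : forall i y y', `|G i y| * `|D i y'| <= C * (H y + H y').
Hypothesis gH : forall y, `|g y| <= C * H y.
Hypothesis Kb : forall z, K z -> `|z| <= rK.
Hypothesis wk : forall z, ~ K z -> z.2 <= c -> conv w rho z <= k.
Hypothesis weak : forall z, K z ->
  - conv w ('D_time_dir rho) z + \sum_i conv (G i) ('D_(space_dir i) rho) z
  - conv g rho z <= 0.
Hypothesis grad : forall i z, K z ->
  conv w ('D_(space_dir i) rho) z = - conv (D i) rho z.

Let br := mollifier_bounded mol.
Let a := conv w rho.
Let P z := pos (a z - k).
Let X (z : point) := pos (c - z.2).

(** What testing with [(a - k)_+^2 (c - t)_+^2], [a] the mollification of [w],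
    leaves of the equation once the divergences and the time term of known sign
    are dropped. *)
Definition energy_density : point -> R := fun z =>
  2%:R * (\sum_i conv (G i) rho z * conv (D i) rho z) * (P z * X z ^+ 2)
  - conv g rho z * (P z ^+ 2 * X z ^+ 2).

(* The test function lives in [K], where the mollified equation holds. *)
Let PX_K z : P z != 0 -> X z != 0 -> K z.
Proof.
move=> Pz Xz; apply: contrapT => nK.
have [zc|zc] := leP z.2 c.
  by move: Pz; rewrite /P pos_eq0 ?eqxx // subr_le0; exact: wk.
by move: Xz; rewrite /X pos_eq0 ?eqxx // subr_le0 ltW.
Qed.

Definition energy_bound : R := (M + `|k| + 1) ^+ 3 * (`|c| + `|rK| + 1) ^+ 2.

Let M0 : 0 <= M. Proof. exact: le_trans (normr_ge0 _) (wM 0). Qed.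

Let P0 z : 0 <= P z. Proof. exact: pos_ge0. Qed.
Let X0 z : 0 <= X z. Proof. exact: pos_ge0. Qed.

Let aM z : `|a z| <= M.
Proof.
have h : forall y, w y <= M by move=> y; apply: le_trans (ler_norm _) (wM y).
have h' : forall y, - w y <= M.
  by move=> y; apply: le_trans (wM y); rewrite -normrN ler_norm.
rewrite ler_norml lerNl; apply/andP; split.
  rewrite -mulN1r -convZ //; apply: (conv_le_near mol); first exact: L1Z.
  by apply: aeW => y _; rewrite mulN1r.
by apply: (conv_le_near mol) => //; apply: aeW => y _.
Qed.

Lemma energy_bound_ge0 : 0 <= energy_bound.
Proof. by rewrite mulr_ge0 // exprn_ge0 // !addr_ge0. Qed.

Let PX_bound (i j : nat) z : (0 < i <= 3)%N -> (0 < j <= 2)%N ->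
  P z ^+ i * X z ^+ j <= energy_bound.
Proof.
move=> /andP[i0 i3] /andP[j0 j2].
have [->|Pz] := eqVneq (P z) 0.
  by rewrite expr0n gtn_eqF // mul0r energy_bound_ge0.
have [->|Xz] := eqVneq (X z) 0.
  by rewrite [X in _ * X]expr0n gtn_eqF // mulr0 energy_bound_ge0.
have zK := Kb (PX_K Pz Xz).
have p1 : P z <= M + `|k| + 1.
  apply: le_trans (pos_le_norm _) _; apply: le_trans (ler_normB _ _) _.
  by rewrite -addrA lerD // lerDl.
have x1 : X z <= `|c| + `|rK| + 1.
  apply: le_trans (pos_le_norm _) _; apply: le_trans (ler_normB _ _) _.
  rewrite -addrA lerD // (le_trans _ (_ : `|rK| <= _)) ?lerDl //.
  by apply: le_trans (ler_norm _); have /point_normE[] := zK.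
have e1 (x y : R) (m n : nat) : 0 <= x -> x <= y -> 1 <= y -> (m <= n)%N -> x ^+ m <= y ^+ n.
  move=> hx hxy hy mn; apply: (@le_trans _ _ (y ^+ m)).
    by rewrite lerXn2r // nnegrE (le_trans hx).
  by rewrite ler_weXn2l.
apply: ler_pM; rewrite ?exprn_ge0 //; apply: e1 => //.
  by rewrite lerDr addr_ge0.
by rewrite lerDr addr_ge0.
Qed.

Let mP : measurable_fun setT (P : mpoint -> R).
Proof.
apply: measurable_maxr => //; apply: measurable_funB => //; exact: measurable_conv.
Qed.

Let mX : measurable_fun setT (X : mpoint -> R).
Proof. by apply: measurable_maxr => //; apply: measurable_funB. Qed.

Let mPX (i j : nat) : measurable_fun setT (fun z : mpoint => P z ^+ i * X z ^+ j).
Proof. by apply: measurable_funM; exact: measurable_funX. Qed.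

Let bPX (i j : nat) : (0 < i <= 3)%N -> (0 < j <= 2)%N ->
  bounded_measurable (fun z => P z ^+ i * X z ^+ j).
Proof.
move=> hi hj; split; first exact: mPX.
by exists energy_bound => z; rewrite ger0_norm ?mulr_ge0 ?exprn_ge0 //; exact: PX_bound.
Qed.

Let bM (f h : point -> R) : bounded_measurable f -> bounded_measurable h ->
  bounded_measurable (fun z => f z * h z).
Proof.
move=> [mf [A fA]] [mh [B hB]]; split; first exact: measurable_funM.
by exists (A * B) => z; rewrite normrM ler_pM.
Qed.

Let bD (f h : point -> R) : bounded_measurable f -> bounded_measurable h ->
  bounded_measurable (fun z => f z + h z).
Proof.
move=> [mf [A fA]] [mh [B hB]]; split; first exact: measurable_funD.
by exists (A + B) => z; apply: le_trans (ler_normD _ _) _; exact: lerD.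
Qed.

Let bc (x : R) : bounded_measurable (fun _ : point => x).
Proof. by split => //; exists `|x|. Qed.

Let dP v z : is_derive z v (fun z => P z ^+ 3)
  (3%:R * P z ^+ 2 * - conv w ('D_v rho) z).
Proof.
apply: (is_derive_comp (g := fun s => pos s ^+ 3)).
  by apply: is_derive_subc; exact: is_derive_mollification mol _ _ _ Iw.
exact: is_derive_pos_pow.
Qed.

Let dP2 v z : is_derive z v (fun z => P z ^+ 2)
  (2%:R * P z ^+ 1 * - conv w ('D_v rho) z).
Proof.
apply: (is_derive_comp (g := fun s => pos s ^+ 2)).
  by apply: is_derive_subc; exact: is_derive_mollification mol _ _ _ Iw.
exact: is_derive_pos_pow.
Qed.

(* One third of the time derivative of [P ^ 3 X ^ 2] is [P ^ 2 X ^ 2 d_t a] minus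
   a multiple of [P ^ 3 X], whose sign is favourable. *)
Let time_term := fun z => P z ^+ 3 * X z ^+ 2.
Let time_term' z := - 3%:R * (P z ^+ 2 * X z ^+ 2) * conv w ('D_time_dir rho) z
   - 2%:R * (P z ^+ 3 * X z ^+ 1).

Let d_time z : is_derive z time_dir time_term (time_term' z).
Proof.
have := is_derive_mul (dP time_dir z) (is_derive_time_cutoff c z time_dir).
by congr is_derive; rewrite /time_term' -/(X z) /=; ring.
Qed.

(* The flux tested with [P ^ 2 X ^ 2]; the derivative of [P ^ 2] produces the
   product of the flux with the gradient. *)
Let space_term i := fun z => conv (G i) rho z * (P z ^+ 2 * X z ^+ 2).
Let space_term' i z := - conv (G i) ('D_(space_dir i) rho) z * (P z ^+ 2 * X z ^+ 2)
  - 2%:R * conv (G i) rho z * conv w ('D_(space_dir i) rho) z * (P z ^+ 1 * X z ^+ 2).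

Let d_space i z : is_derive z (space_dir i) (space_term i) (space_term' i z).
Proof.
have h1 := is_derive_mul (dP2 (space_dir i) z) (is_derive_time_cutoff c z (space_dir i)).
have := is_derive_mul (is_derive_mollification mol (space_dir i) z (IG i)) h1.
by congr is_derive; rewrite /space_term' -/(X z) /=; ring.
Qed.

Let supp (i j : nat) z : (0 < i)%N -> (0 < j)%N -> P z ^+ i * X z ^+ j != 0 -> `|z| <= rK.
Proof.
move=> i0 j0; rewrite mulf_eq0 negb_or !expf_eq0 i0 j0 /= => /andP[h1 h2].
by apply: Kb; exact: PX_K.
Qed.

Let bcv f v : L1 f -> bounded_measurable (conv f ('D_v rho)).
Proof. by move=> If; apply: bounded_measurable_conv => //; exact: (mollifier_derive_bounded mol). Qed.

Let bcr f : L1 f -> bounded_measurable (conv f rho).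
Proof. by move=> If; apply: bounded_measurable_conv. Qed.

Let int_time : L1 time_term' /\ \int[mu]_z time_term' z = 0.
Proof.
have E : 'D_time_dir time_term = time_term'.
  by apply/funext => z; have [_ ->] := d_time z.
have b' : bounded_measurable time_term'.
  apply: bD; last first.
    have := bM (bc (- 2%:R)) (bPX (i := 3) (j := 1) isT isT).
    by congr bounded_measurable; apply/funext => z; rewrite mulNr.
  by apply: bM; [apply: bM; [exact: bc|exact: bPX]|exact: bcv].
have [_ [B hB]] := b'.
rewrite -E; apply: (@integral_derive_eq0 _ _ _ _ rK B).
- exact: bPX.
- by move=> z; apply: supp.
- by move=> z; have [] := d_time z.
- by move=> z; have [_ ->] := d_time z; exact: hB.
Qed.

Let int_space i : L1 (space_term' i) /\ \int[mu]_z space_term' i z = 0.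
Proof.
have E : 'D_(space_dir i) (space_term i) = space_term' i.
  by apply/funext => z; have [_ ->] := d_space i z.
have b' : bounded_measurable (space_term' i).
  have h1 := bM (bcv (space_dir i) (IG i)) (bPX (i := 2) (j := 2) isT isT).
  have h2 := bM (bM (bcr (IG i)) (bcv (space_dir i) Iw)) (bPX (i := 1) (j := 2) isT isT).
  have := bD (bM (bc (-1)) h1) (bM (bc (- 2%:R)) h2).
  by congr bounded_measurable; apply/funext => z; rewrite /space_term'; ring.
have [_ [B hB]] := b'.
rewrite -E; apply: (@integral_derive_eq0 _ _ _ _ rK B).
- by apply: bM; [exact: bcr|exact: bPX].
- by move=> z; rewrite mulf_eq0 negb_or => /andP[_]; apply: supp.
- by move=> z; have [] := d_space i z.
- by move=> z; have [_ ->] := d_space i z; exact: hB.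
Qed.

Lemma energy_density_L1 : L1 energy_density.
Proof.
have h1 : bounded_measurable (fun z => \sum_i conv (G i) rho z * conv (D i) rho z).
  elim: (index_enum _) => [|i s IHs].
    by have := bc 0; congr bounded_measurable; apply/funext => z; rewrite big_nil.
  have := bD (bM (bcr (IG i)) (bcr (ID i))) IHs.
  by congr bounded_measurable; apply/funext => z; rewrite big_cons.
have h2 := bM (bM (bc 2%:R) h1) (bPX (i := 1) (j := 2) isT isT).
have h3 := bM (bcr Ig) (bPX (i := 2) (j := 2) isT isT).
have [mE [B hB]] : bounded_measurable energy_density.
  have := bD h2 (bM (bc (-1)) h3).
  by congr bounded_measurable; apply/funext => z; rewrite /energy_density; ring.
apply: (@integrable_bounded_support _ _ _ B (rK + 1)) => // z.
rewrite /energy_density => hz.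
suff : `|z| <= rK by move=> /le_lt_trans; apply; rewrite ltrDl.
apply: Kb; apply: PX_K; apply: contra hz => /eqP ->.
  by rewrite !expr0n /= !(mul0r, mulr0) subrr.
by rewrite !expr0n /= !(mul0r, mulr0) subrr.
Qed.

(** On [K] the equation bounds the density by a sum of derivatives of functions
    of bounded support, and off [K] everything vanishes. *)
Lemma integral_energy_density_le0 : \int[mu]_z energy_density z <= 0.
Proof.
have Isum : L1 (fun z => \sum_i space_term' i z).
  elim: (index_enum _) => [|i s IHs].
    have I0 : L1 (fun _ : point => 0 : R) by exact: integrable0.
    by move: I0; congr L1; apply/funext => z; rewrite big_nil.
  have := L1D (int_space i).1 IHs.
  by congr L1; apply/funext => z; rewrite big_cons.
have Esum : \int[mu]_z (\sum_i space_term' i z) = 0.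
  rewrite /Rintegral.
  under eq_integral do rewrite -sumEFin.
  rewrite integral_sum //; last by move=> i; exact: (int_space i).1.
  rewrite big1 // => i _.
  rewrite -(fineK (integrable_fin_num measurableT (int_space i).1)).
  by congr EFin; exact: (int_space i).2.
have It := L1Z 3%:R^-1 int_time.1.
apply: (@le_trans _ _ (\int[mu]_z (\sum_i space_term' i z - 3%:R^-1 * time_term' z))).
  apply: le_Rintegral => //; first exact: energy_density_L1.
    exact: (L1B Isum It).
  move=> z _.
  have [Pz|Pz] := eqVneq (P z) 0.
    rewrite /energy_density /space_term' /time_term' Pz !expr0n /= !(mul0r, mulr0, subr0, oppr0, addr0).
    by rewrite big1 // => i _; rewrite !(mul0r, mulr0, subr0, oppr0, addr0).
  have [Xz|Xz] := eqVneq (X z) 0.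
    rewrite /energy_density /space_term' /time_term' Xz !expr0n /= !(expr1, mul0r, mulr0, subr0, oppr0, addr0).
    by rewrite big1 // => i _; rewrite !(expr1, mul0r, mulr0, subr0, oppr0, addr0).
  have Kz := PX_K Pz Xz.
  have Q0 : 0 <= P z ^+ 2 * X z ^+ 2 by rewrite mulr_ge0 // exprn_ge0.
  have T0 : 0 <= P z ^+ 3 * X z ^+ 1 by rewrite mulr_ge0 // exprn_ge0.
  have W := ler_wpM2r Q0 (weak Kz).
  have -> : \sum_i space_term' i z =
     2%:R * (\sum_i conv (G i) rho z * conv (D i) rho z) * (P z * X z ^+ 2)
     - (\sum_i conv (G i) ('D_(space_dir i) rho) z) * (P z ^+ 2 * X z ^+ 2).
    rewrite mulr_sumr !mulr_suml -sumrB; apply: eq_bigr => i _.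
    by rewrite /space_term' grad //; ring.
  rewrite /energy_density /time_term'.
  move: W T0.
  move: (\sum_i conv (G i) ('D_(space_dir i) rho) z) => S1.
  move: (\sum_i conv (G i) rho z * conv (D i) rho z) => S2.
  move: (P z ^+ 2 * X z ^+ 2) => Q; move: (P z ^+ 3 * X z ^+ 1) => T.
  rewrite mul0r => W T0.
  lra.
by rewrite (RintegralB measurableT Isum It) Esum RintegralZl ?int_time.2 ?mulr0 ?subr0 //; exact: int_time.1.
Qed.

(** The bound is a fixed multiple of a mollification of [H], uniformly in the
    mollifier, which is what the passage to the limit needs. *)
Lemma energy_density_bound z :
  `|energy_density z| <= (4%:R * N%:R + 1) * C * energy_bound * conv H rho z.
Proof.
have Hn0 : 0 <= conv H rho z by exact: (conv_ge0 mol).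
have b0 := energy_bound_ge0.
have t1 : `|\sum_i conv (G i) rho z * conv (D i) rho z| <= N%:R * (2%:R * C * conv H rho z).
  apply: le_trans (ler_norm_sum _ _ _) _.
  apply: (@le_trans _ _ (\sum_(i < N) (2%:R * C * conv H rho z))).
    by apply: ler_sum => i _; apply: (conv_product_le z mol) => //; exact: GDH.
  by rewrite sumr_const card_ord -[X in X <= _]mulr_natl.
have t2 : `|conv g rho z| <= C * conv H rho z.
  apply: le_trans (norm_conv_le mol z Ig) _.
  rewrite -[leRHS]addr0; apply: (conv_le_affine z mol) => //; first exact: L1_norm.
  by move=> y; rewrite addr0.
have q1 : `|P z * X z ^+ 2| <= energy_bound.
  rewrite ger0_norm ?mulr_ge0 ?exprn_ge0 //.
  exact: (PX_bound (i := 1) (j := 2)).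
have q2 : `|P z ^+ 2 * X z ^+ 2| <= energy_bound.
  rewrite ger0_norm ?mulr_ge0 ?exprn_ge0 //.
  exact: (PX_bound (i := 2) (j := 2)).
apply: le_trans (ler_normB _ _) _.
rewrite !normrM -!normrM.
have s1 : `|2%:R * (\sum_i conv (G i) rho z * conv (D i) rho z) * (P z * X z ^+ 2)| <=
    2%:R * (N%:R * (2%:R * C * conv H rho z)) * energy_bound.
  rewrite normrM; apply: ler_pM => //.
  by rewrite normrM ger0_norm // ler_wpM2l.
have s2 : `|conv g rho z * (P z ^+ 2 * X z ^+ 2)| <= C * conv H rho z * energy_bound.
  by rewrite normrM; apply: ler_pM.
have := lerD s1 s2; rewrite !normrM => /le_trans; apply.
by rewrite le_eqVlt; apply/orP; left; apply/eqP; ring.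
Qed.

End one_mollifier.

End energy.

(** * Passage to the limit in the energy estimate *)

Section energy_limit.
Variables (R : realType) (N : nat).
Local Notation point := ('rV[R]_N * R)%type.
Local Notation mpoint := ('rV[R]_N * measurableTypeR R)%type.
Local Notation mu := (lebesgue_xt R N).

(** The energy density without mollification. *)
Definition limit_density (w g : point -> R) (G D : 'I_N -> point -> R) (k c : R) :
    point -> R := fun z =>
  2%:R * (\sum_i G i z * D i z) * (pos (w z - k) * pos (c - z.2) ^+ 2)
  - g z * (pos (w z - k) ^+ 2 * pos (c - z.2) ^+ 2).

(** The densities of the mollified functions converge almost everywhere along a
    subsequence and are bounded by mollifications of [H], which all have the
    integral of [H]; hence Fatou's lemma applies to their sum. *)
Lemma energy_inequality (r : nat -> R) (rho : nat -> point -> R)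
    (w g H : point -> R) (G D : 'I_N -> point -> R) (K : set point)
    (k c M C rK : R) :
  (forall n, mollifier (r n) (rho n)) -> r @ \oo --> 0 ->
  approximable rho w -> approximable rho g -> approximable rho H ->
  (forall i, approximable rho (G i)) -> (forall i, approximable rho (D i)) ->
  (forall z, `|w z| <= M) -> (forall z, 0 <= H z) -> 0 <= C ->
  (forall i y y', `|G i y| * `|D i y'| <= C * (H y + H y')) ->
  (forall y, `|g y| <= C * H y) ->
  (forall z, K z -> `|z| <= rK) ->
  (forall n z, ~ K z -> z.2 <= c -> conv w (rho n) z <= k) ->
  (forall n z, K z ->
    - conv w ('D_(time_dir R N) (rho n)) z
    + \sum_i conv (G i) ('D_(space_dir R i) (rho n)) z - conv g (rho n) z <= 0) ->
  (forall n i z, K z ->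
    conv w ('D_(space_dir R i) (rho n)) z = - conv (D i) (rho n) z) ->
  L1 (limit_density w g G D k c) /\
  \int[mu]_z limit_density w g G D k c z <= 0.
Proof.
move=> mol r0 aw ag aH aG aD wM H0 C0 GDH gH Kb wk weak grad.
(* All the functions that have to converge, as one finite family. *)
pose F (i : option (option (option ('I_N + 'I_N)))) : point -> R :=
  match i with
  | None => w | Some None => g | Some (Some None) => H
  | Some (Some (Some (inl i))) => G i | Some (Some (Some (inr i))) => D i
  end.
have aF i : approximable rho (F i) by case: i => [[[[]|]|]|] //=.
have [s [_ cF]] := mollification_ae mol aF.
pose E n := energy_density (rho (s n)) w g G D k c.
pose B := (4%:R * N%:R + 1) * C * energy_bound k c M rK.
pose L := limit_density w g G D k c.
have B0 : 0 <= B.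
  apply: mulr_ge0; last exact: (energy_bound_ge0 k c rK wM).
  by apply: mulr_ge0 => //; rewrite addr_ge0 // mulr_ge0.
have IE n : L1 (E n).
  exact: (energy_density_L1 (mol (s n)) aw.1 ag.1 (fun i => (aG i).1) (fun i => (aD i).1) wM Kb (wk (s n))).
have E0 n : \int[mu]_z E n z <= 0.
  exact: (integral_energy_density_le0 (mol (s n)) aw.1 ag.1 (fun i => (aG i).1) (fun i => (aD i).1) wM Kb (wk (s n)) (weak (s n)) (grad (s n))).
have EB n z : `|E n z| <= B * conv H (rho (s n)) z.
  exact: (energy_density_bound (mol (s n)) aw.1 ag.1 aH.1 (fun i => (aG i).1)
    (fun i => (aD i).1) wM H0 GDH gH Kb (wk (s n)) z).
have cH z : (forall i, conv (F i) (rho (s n)) z @[n --> \oo] --> F i z) ->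
    conv H (rho (s n)) z @[n --> \oo] --> H z.
  by move=> /(_ (Some (Some None))).
have cE z : (forall i, conv (F i) (rho (s n)) z @[n --> \oo] --> F i z) ->
    E n z @[n --> \oo] --> L z.
  move=> cz.
  have cp : pos (conv w (rho (s n)) z - k) @[n --> \oo] --> pos (w z - k).
    apply: (@cvg_comp _ _ _ (fun n => conv w (rho (s n)) z - k) (@pos R) \oo (nbhs (w z - k))).
      by apply: cvgB; [exact: (cz None)|exact: cvg_cst].
    exact: continuous_pos.
  have cp2 : pos (conv w (rho (s n)) z - k) ^+ 2 @[n --> \oo] --> pos (w z - k) ^+ 2.
    rewrite expr2; under eq_fun do rewrite expr2; exact: cvgM.
  apply: cvgB.
    apply: cvgM; last by apply: cvgM => //; exact: cvg_cst.
    apply: cvgM; first exact: cvg_cst.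
    elim: (index_enum _) => [|i l IHl].
      by rewrite big_nil; under eq_fun do rewrite big_nil; exact: cvg_cst.
    rewrite big_cons; under eq_fun do rewrite big_cons.
    apply: cvgD => //; apply: cvgM; first exact: (cz (Some (Some (Some (inl i))))).
    exact: (cz (Some (Some (Some (inr i))))).
  apply: cvgM; first exact: (cz (Some None)).
  by apply: cvgM => //; exact: cvg_cst.
have LB z : (forall i, conv (F i) (rho (s n)) z @[n --> \oo] --> F i z) ->
    `|L z| <= B * H z.
  move=> cz; have cz1 : `|E n z| @[n --> \oo] --> `|L z| by apply: cvg_norm; exact: cE.
  have cz2 : B * conv H (rho (s n)) z @[n --> \oo] --> B * H z.
    by apply: cvgM; [exact: cvg_cst|exact: cH].
  apply: (ler_cvg_to cz1 cz2); exact: nearW.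
have mL : measurable_fun setT (L : mpoint -> R).
  have mw := L1_measurable aw.1; have mg := L1_measurable ag.1.
  have mp : measurable_fun setT (fun z : mpoint => pos (w z - k)).
    by apply: measurable_maxr => //; apply: measurable_funB.
  have mX : measurable_fun setT (fun z : mpoint => pos (c - z.2)).
    by apply: measurable_maxr => //; apply: measurable_funB.
  apply: measurable_funB.
    apply: measurable_funM.
      apply: measurable_funM => //; apply: measurable_sum => i.
      by apply: measurable_funM; apply: L1_measurable; [exact: (aG i).1|exact: (aD i).1].
    by apply: measurable_funM => //; exact: measurable_funX.
  apply: measurable_funM => //.
  by apply: measurable_funM; exact: measurable_funX.
have IBH : L1 (fun z => B * H z) by apply: L1Z; exact: aH.1.
have IL : L1 L.
  apply/integrableP; split; first exact/measurable_EFinP.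
  have /integrableP[_] := IBH; apply: le_lt_trans.
  apply: ae_ge0_le_integral => //.
  - by apply: measurableT_comp => //; exact/measurable_EFinP.
  - by apply: measurableT_comp => //; exact: measurable_int IBH.
  - apply: ae_imply cF => z cz _; rewrite !abse_EFin lee_fin.
    by apply: le_trans (LB z cz) (ler_norm _).
split => //.
(* Adding the dominating mollification makes the densities nonnegative. *)
pose S n (z : mpoint) : \bar R := (E n z + B * conv H (rho (s n)) z)%:E.
have IBHn n : L1 (fun z => B * conv H (rho (s n)) z).
  by apply: L1Z; exact: (L1_mollification (mol (s n)) aH.1).
have IS n : L1 (fun z => E n z + B * conv H (rho (s n)) z) by exact: L1D.
have S0 n z : (0 <= S n z)%E.
  rewrite lee_fin -lerBlDr sub0r; have := EB n z.
  by rewrite ler_norml => /andP[].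
have intH n : \int[mu]_z (B * conv H (rho (s n)) z) = \int[mu]_z (B * H z).
  rewrite RintegralZl ?RintegralZl //; [|exact: aH.1|exact: (L1_mollification (mol (s n)) aH.1)].
  by congr (_ * _); rewrite /Rintegral (integral_mollification_ge0 (mol (s n)) aH.1).
have intS n : (\int[mu]_z S n z <= (\int[mu]_z (B * H z))%:E)%E.
  rewrite -(fineK (integrable_fin_num measurableT (IS n))) lee_fin.
  rewrite -[leLHS]/(\int[mu]_z (E n z + B * conv H (rho (s n)) z)).
  by rewrite (RintegralD measurableT (IE n) (IBHn n)) intH gerDr.
have Fa := fatou mu measurableT (fun n => measurable_int mu (IS n)) (fun n z _ => S0 n z).
have Fl : (\int[mu]_z limn_einf (S^~ z) = \int[mu]_z (L z + B * H z)%:E)%E.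
  apply: eq_integral_ae; apply: ae_imply cF => z cz _.
  have cS : S n z @[n --> \oo] --> (L z + B * H z)%:E.
    apply/fine_cvgP; split; first exact: nearW.
    by apply: cvgD; [exact: cE|apply: cvgM; [exact: cvg_cst|exact: cH]].
  by rewrite (cvg_limn_einf_sup cS).1.
have Le : (limn_einf (fun n => \int[mu]_z S n z) <= (\int[mu]_z (B * H z))%:E)%E.
  rewrite limn_einf_lim; apply: lime_le; first exact: is_cvg_einfs.
  apply: nearW => n; apply: le_trans (intS n).
  by apply: ereal_inf_lbound; exists n => /=.
have : (\int[mu]_z (L z + B * H z)%:E <= (\int[mu]_z (B * H z))%:E)%E.
  by rewrite -Fl; exact: le_trans Fa Le.
rewrite -(fineK (integrable_fin_num measurableT (L1D IL IBH))) lee_fin.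
rewrite -[leLHS]/(\int[mu]_z (L z + B * H z)).
by rewrite (RintegralD measurableT IL IBH) gerDr.
Qed.

End energy_limit.

(** * Strict monotonicity of the flux *)

Section p_laplacian_flux.
Variables (R : realType) (N : nat).
Local Notation space := 'rV[R]_N.

Lemma edot_ge0 (x : space) : 0 <= edot x x.
Proof. by apply: sumr_ge0 => i _; rewrite -expr2 sqr_ge0. Qed.

Lemma enorm_ge0 (x : space) : 0 <= enorm x. Proof. exact: sqrtr_ge0. Qed.

Lemma enorm_sqr (x : space) : enorm x ^+ 2 = edot x x.
Proof. by rewrite sqr_sqrtr // edot_ge0. Qed.

Lemma enorm_coord (x : space) i : `|x ord0 i| <= enorm x.
Proof.
rewrite -sqrtr_sqr ler_sqrt ?edot_ge0 // /edot (bigD1 i) //= expr2 lerDl.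
by apply: sumr_ge0 => j _; rewrite -expr2 sqr_ge0.
Qed.

Lemma enorm_eq0 (x : space) : enorm x = 0 -> x = 0.
Proof.
move=> x0; apply/rowP => i; rewrite mxE; apply/eqP; rewrite -normr_le0.
by rewrite -x0 enorm_coord.
Qed.

Lemma enorm0 : enorm (0 : space) = 0.
Proof. by rewrite /enorm /edot big1 ?sqrtr0 // => i _; rewrite mxE mul0r. Qed.

Lemma edot_lin (a b : R) (x y : space) :
  edot (a *: x - b *: y) (a *: x - b *: y) =
  a ^+ 2 * edot x x - 2%:R * a * b * edot x y + b ^+ 2 * edot y y.
Proof.
rewrite /edot !mulr_sumr -sumrB -big_split /=; apply: eq_bigr => i _.
by rewrite !mxE; ring.
Qed.

Lemma edot_le (x y : space) : edot x y <= enorm x * enorm y.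
Proof.
have [x0|x0] := eqVneq (enorm x) 0.
  by rewrite x0 mul0r (enorm_eq0 x0) /edot big1 // => i _; rewrite mxE mul0r.
have [y0|y0] := eqVneq (enorm y) 0.
  by rewrite y0 mulr0 (enorm_eq0 y0) /edot big1 // => i _; rewrite mxE mulr0.
have xy : 0 < enorm x * enorm y by rewrite mulr_gt0 // lt_neqAle enorm_ge0 eq_sym ?x0 ?y0.
have := edot_ge0 (enorm y *: x - enorm x *: y).
rewrite edot_lin -!enorm_sqr => h.
have {}h : 0 <= (2%:R * (enorm x * enorm y)) * (enorm x * enorm y - edot x y).
  by move: h; congr (_ <= _); ring.
by rewrite -subr_ge0; move: h; rewrite pmulr_rge0 // mulr_gt0.
Qed.

Lemma continuous_enorm : continuous (@enorm R N).
Proof.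
have ce : continuous (fun x : space => edot x x).
  rewrite /edot; elim: (index_enum _) => [|i s IHs].
    rewrite (_ : (fun x : space => _) = fun=> 0); first exact: cst_continuous.
    by apply/funext => y; rewrite big_nil.
  rewrite (_ : (fun x : space => _) =
      fun y : space => y ord0 i * y ord0 i + \sum_(j <- s) y ord0 j * y ord0 j).
    move=> x; have c := @coord_continuous R 1 N ord0 i x.
    exact: (cvgD (cvgM c c) (IHs x)).
  by apply/funext => y; rewrite big_cons.
move=> x; apply: (@continuous_comp _ _ _ (fun x : space => edot x x) (@Num.sqrt R)).
  exact: ce.
exact: sqrt_continuous.
Qed.

Lemma measurable_enorm d (T : measurableType d) (h : T -> space) :
  (forall i, measurable_fun setT (fun z => h z ord0 i)) ->
  measurable_fun setT (fun z => enorm (h z)).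
Proof.
move=> mh; have mh' : measurable_fun setT h by exact: measurable_fun_rV.
exact: (measurableT_comp (continuous_measurable_rV continuous_enorm) mh').
Qed.

Variable p : R.
Hypothesis p1 : 1 < p.

Definition flux (x : space) : space := enorm x `^ (p - 2) *: x.

Definition flux_gap (x y : space) : R := edot (flux x - flux y) (x - y).

Let p10 : 0 < p - 1. Proof. by rewrite subr_gt0. Qed.
Let p0 : 0 < p. Proof. exact: lt_trans p1. Qed.

Let powRm2 (a : R) : 0 <= a -> a `^ (p - 2) * a = a `^ (p - 1).
Proof.
move=> a0; rewrite -(mulr_powRB1 a0 p10) mulrC; congr (_ * _ `^ _); lra.
Qed.

Let powRm1 (a : R) : 0 <= a -> a `^ (p - 1) * a = a `^ p.
Proof. by move=> a0; rewrite -(mulr_powRB1 a0 p0) mulrC. Qed.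

(** The gap is a sum of two nonnegative terms: one compares the lengths of the
    vectors, the other measures the defect in the Cauchy-Schwarz inequality. *)
Lemma flux_gapE x y (a := enorm x) (b := enorm y) :
  flux_gap x y = (a `^ (p - 1) - b `^ (p - 1)) * (a - b)
   + (a `^ (p - 2) + b `^ (p - 2)) * (a * b - edot x y).
Proof.
rewrite -!powRm2 ?enorm_ge0 // -/a -/b.
have -> : flux_gap x y = a `^ (p - 2) * a ^+ 2
    - (a `^ (p - 2) + b `^ (p - 2)) * edot x y + b `^ (p - 2) * b ^+ 2.
  rewrite /a /b !enorm_sqr /flux_gap /flux /edot !mulr_sumr -sumrB -big_split /=.
  by apply: eq_bigr => i _; rewrite !mxE; ring.
by ring.
Qed.

Let gap1_ge0 (a b : R) : 0 <= a -> 0 <= b -> 0 <= (a `^ (p - 1) - b `^ (p - 1)) * (a - b).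
Proof.
move=> a0 b0; have [ab|ab] := leP a b.
  by rewrite mulr_le0 // subr_le0 // ge0_ler_powR // ltW.
by rewrite mulr_ge0 // subr_ge0 ?ge0_ler_powR // ltW.
Qed.

Lemma flux_gap_ge0 x y : 0 <= flux_gap x y.
Proof.
rewrite flux_gapE; apply: addr_ge0; first by apply: gap1_ge0; exact: enorm_ge0.
by apply: mulr_ge0; [rewrite addr_ge0 ?powR_ge0|rewrite subr_ge0 edot_le].
Qed.

(** If both terms vanish the lengths agree and the Cauchy-Schwarz inequality is an
    equality. *)
Lemma flux_gap_gt0 x y : x != y -> 0 < flux_gap x y.
Proof.
move=> xy; rewrite lt_neqAle flux_gap_ge0 andbT eq_sym; apply: contra xy => /eqP.
rewrite flux_gapE => /eqP.
set a := enorm x; set b := enorm y.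
have a0 : 0 <= a := enorm_ge0 x; have b0 : 0 <= b := enorm_ge0 y.
rewrite paddr_eq0 ?gap1_ge0 //; last first.
  by apply: mulr_ge0; [rewrite addr_ge0 ?powR_ge0|rewrite subr_ge0 edot_le].
move=> /andP[h1 h2].
have ab : a = b.
  have [ab|ab|//] := ltgtP a b.
    have := @gt0_ltr_powR R _ p10 a b; rewrite !nnegrE => /(_ a0 b0 ab) h.
    by move: h1; rewrite mulf_eq0 !subr_eq0 !lt_eqF.
  have := @gt0_ltr_powR R _ p10 b a; rewrite !nnegrE => /(_ b0 a0 ab) h.
  by move: h1; rewrite mulf_eq0 !subr_eq0 !gt_eqF.
have [az|an] := eqVneq a 0.
  by rewrite (enorm_eq0 az) (@enorm_eq0 y) // -/b -ab.
have ap : 0 < a by rewrite lt_neqAle eq_sym an.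
move: h2; rewrite -ab -mulr2n mulf_eq0 mulrn_eq0 /= (gt_eqF (powR_gt0 _ ap)) /= subr_eq0 => /eqP h2.
rewrite -subr_eq0; apply/eqP/enorm_eq0.
suff : edot (x - y) (x - y) = 0 by rewrite /enorm => ->; rewrite sqrtr0.
have := edot_lin 1 1 x y; rewrite !scale1r => ->.
by rewrite -!enorm_sqr -/a -/b -ab -h2; ring.
Qed.

(** At the origin the power [p - 2] may be negative, but the flux has length
    [enorm x `^ (p - 1)] with a positive exponent. *)
Lemma continuous_flux i : continuous (fun x : space => flux x ord0 i).
Proof.
move=> x; have -> : (fun x : space => flux x ord0 i) = (fun x : space => enorm x `^ (p - 2) * x ord0 i).
  by apply/funext => y; rewrite mxE.
have [x0|x0] := eqVneq (enorm x) 0; last first.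
  have xp : 0 < enorm x by rewrite lt_neqAle eq_sym x0 enorm_ge0.
  have c1 : {for x, continuous (fun y : space => enorm y `^ (p - 2))}.
    apply: (@continuous_comp _ _ _ (@enorm R N) (@powR R ^~ (p - 2))).
      exact: continuous_enorm.
    apply: differentiable_continuous; apply/derivable1_diffP.
    by apply: derivable_powR; rewrite in_itv /= andbT.
  exact: (cvgM c1 (@coord_continuous R 1 N ord0 i x)).
pose F (y : space) : R := enorm y `^ (p - 2) * y ord0 i.
have F0 : F 0 = 0 by rewrite /F mxE mulr0.
suff c0 : F @ (0 : space) --> F (0 : space) by rewrite (enorm_eq0 x0); exact: c0.
rewrite F0; apply: (@cvgrPdist_lt _ _ _ (nbhs (0 : space)) _ F 0).2 => e e0.
have d0 : 0 < e `^ (p - 1)^-1 by rewrite powR_gt0.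
have : \forall y \near (0 : space), `|enorm (0 : space) - enorm y| < e `^ (p - 1)^-1.
  by move/cvgrPdist_lt: (@continuous_enorm (0 : space)); apply.
apply: filterS => y; rewrite enorm0 sub0r normrN ger0_norm ?enorm_ge0 // => yd.
rewrite sub0r normrN /F normrM ger0_norm ?powR_ge0 //.
apply: (@le_lt_trans _ _ (enorm y `^ (p - 1))).
  by rewrite -(powRm2 (enorm_ge0 y)) ler_wpM2l ?powR_ge0 // enorm_coord.
have -> : e = (e `^ (p - 1)^-1) `^ (p - 1).
  by rewrite -powRrM mulVf ?gt_eqF // powRr1 // ltW.
by apply: gt0_ltr_powR => //; rewrite nnegrE ?enorm_ge0 // ltW.
Qed.

Lemma continuous_flux_gap :
  continuous (fun z : space * space => flux_gap z.1 z.2).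
Proof.
move=> z; rewrite /flux_gap /edot; elim: (index_enum _) => [|i s IHs].
  rewrite (_ : (fun z : space * space => _) = fun=> 0); first exact: cst_continuous.
  by apply/funext => y; rewrite big_nil.
rewrite (_ : (fun z : space * space => _) =
    fun z : space * space => (flux z.1 ord0 i - flux z.2 ord0 i) * (z.1 ord0 i - z.2 ord0 i) +
      \sum_(j <- s) (flux z.1 - flux z.2) ord0 j * (z.1 - z.2) ord0 j).
  have c1 (h : space -> R) : continuous h -> (fun z : space * space => h z.1) @ z --> h z.1.
    by move=> ch; apply: (@continuous_comp _ _ _ fst h); [exact: cvg_fst|exact: ch].
  have c2 (h : space -> R) : continuous h -> (fun z : space * space => h z.2) @ z --> h z.2.
    by move=> ch; apply: (@continuous_comp _ _ _ snd h); [exact: cvg_snd|exact: ch].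
  apply: cvgD => //; apply: cvgM; apply: cvgB.
  - by apply: (c1 (fun x => flux x ord0 i)); exact: continuous_flux.
  - by apply: (c2 (fun x => flux x ord0 i)); exact: continuous_flux.
  - by apply: (c1 (fun x => x ord0 i)) => x; exact: coord_continuous.
  - by apply: (c2 (fun x => x ord0 i)) => x; exact: coord_continuous.
by apply/funext => y; rewrite big_cons !mxE.
Qed.

(** Once [y] is longer than fixed multiples of the bound on [x], the terms that
    mix [x] and [y] are absorbed by [enorm y `^ p]. *)
Lemma flux_gap_growth (K : R) : 0 <= K -> exists2 L : R, 1 <= L &
  forall x y, enorm x <= K -> L <= enorm y -> enorm y `^ p <= 2%:R * flux_gap x y.
Proof.
(* With [t * enorm x <= enorm y] the power of [x] is a quarter of that of [y]. *)
move=> K0; pose t := 4%:R `^ (p - 1)^-1 : R.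
have t0 : 0 <= t by exact: powR_ge0.
have tp : t `^ (p - 1) = 4%:R by rewrite -powRrM mulVf ?gt_eqF // powRr1.
exists (1 + 4%:R * K + t * K).
  by rewrite -addrA lerDl addr_ge0 // mulr_ge0.
move=> x y; set a := enorm x; set b := enorm y => aK Lb.
have a0 : 0 <= a := enorm_ge0 x; have b0 : 0 <= b := enorm_ge0 y.
have tK0 : 0 <= t * K by rewrite mulr_ge0.
have b4 : 4%:R * a <= b by move: Lb tK0; lra.
have bt : t * a <= b.
  apply: le_trans Lb; have := ler_wpM2l t0 aK; lra.
have bt' : 4%:R * a `^ (p - 1) <= b `^ (p - 1).
  rewrite -tp -powRM //; apply: ge0_ler_powR; rewrite ?nnegrE ?mulr_ge0 //.
  exact: ltW.
rewrite flux_gapE -/a -/b.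
have xy := edot_le x y; rewrite -/a -/b in xy.
have u0 : 0 <= a `^ (p - 2) by exact: powR_ge0.
have v0 : 0 <= b `^ (p - 2) by exact: powR_ge0.
have s0 := addr_ge0 u0 v0.
have e0 : 0 <= (a `^ (p - 2) + b `^ (p - 2)) * (a * b - edot x y).
  by rewrite mulr_ge0 // subr_ge0.
have bp : b `^ p = b `^ (p - 1) * b by rewrite powRm1.
rewrite bp.
have w0 : 0 <= a `^ (p - 1) by exact: powR_ge0.
move: e0; set E := (_ + _) * _ => e0.
move: bt' w0; move: (a `^ (p - 1)) (b `^ (p - 1)) => A B hAB A0.
have h1 := ler_wpM2r b0 hAB.
have B0 : 0 <= B by apply: le_trans hAB; rewrite mulr_ge0.
have h2 := ler_wpM2l B0 b4.
have h3 : 0 <= A * a by rewrite mulr_ge0.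
have h1' : 4%:R * (A * b) <= B * b by rewrite mulrA.
have h2' : 4%:R * (B * a) <= B * b by rewrite mulrCA.
have -> : (A - B) * (a - b) = A * a - A * b - B * a + B * b by ring.
move: h1' h2' h3 e0; clear.
move: (B * b) (A * b) (B * a) (A * a) => Bb Ab Ba Aa; lra.
Qed.

(** On the compact part of phase space where the difference of the source terms
    is at least [e] the gap has a positive minimum; outside of it the growth of
    the gap wins as [beta < p]. *)
Lemma source_le_flux_gap (f : space -> R) (Cf beta K e : R) :
  continuous f -> 0 < Cf -> 1 <= beta -> beta < p ->
  (forall xi, `|f xi| <= Cf * (1 + enorm xi `^ beta)) ->
  0 <= K -> 0 < e ->
  exists2 C, 0 <= C & forall x y, enorm x <= K ->
    `|f x - f y| <= e + C * flux_gap x y.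
Proof.
move=> cf Cf0 b1 bp fgr K0 e0.
have [L L1 hL] := flux_gap_growth K0.
have L0 : 0 <= L by apply: le_trans L1.
have be0 : 0 <= beta by apply: le_trans b1.
have mono (a b : R) : 0 <= a -> a <= b -> a `^ beta <= b `^ beta.
  by move=> a0 ab; apply: ge0_ler_powR; rewrite ?nnegrE // (le_trans a0).
pose B := Cf * (1 + K `^ beta) + Cf * (1 + L `^ beta).
have fb x (A : R) : enorm x <= A -> `|f x| <= Cf * (1 + A `^ beta).
  move=> xA; apply: le_trans (fgr x) _.
  by rewrite ler_wpM2l ?(ltW Cf0) // lerD2l mono // enorm_ge0.
have B0 : 0 <= B.
  by rewrite /B addr_ge0 // mulr_ge0 ?(ltW Cf0) // addr_ge0 // powR_ge0.
(* On this compact set [x] and [y] differ, as [f x] and [f y] do. *)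
pose S : set (space * space) :=
  [set z | enorm z.1 <= K /\ enorm z.2 <= L /\ e <= `|f z.1 - f z.2|].
have [C1 C10 hC1] : exists2 C1, 0 <= C1 & forall x y, S (x, y) ->
    `|f x - f y| <= C1 * flux_gap x y.
  have [[[x0 y0] Sxy]|nS] := pselect (S !=set0); last first.
    by exists 0 => // x y Sxy; case: nS; exists (x, y).
  have cB (A : R) : compact [set x : space | enorm x <= A].
    apply: bounded_closed_compact.
      exists A; split; first exact: num_real.
      move=> A' AA' x /= xA; apply: rV_norm_le => [|i].
        by apply: le_trans (enorm_ge0 x) _; apply: le_trans xA (ltW AA').
      by apply: le_trans (enorm_coord x i) _; apply: le_trans xA (ltW AA').
    apply: (@preimage_closed _ _ (@enorm R N) [set y | y <= A]); last exact: closed_le.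
    by move=> x _; exact: continuous_enorm.
  have cdiff : continuous (fun z : space * space => `|f z.1 - f z.2|).
    move=> z; apply: (@continuous_comp _ _ _ (fun z : space * space => f z.1 - f z.2) (fun x => `|x|)).
      have c1 : {for z, continuous (fun z : space * space => f z.1)}.
        by apply: (@continuous_comp _ _ _ fst f); [exact: cvg_fst|exact: cf].
      have c2 : {for z, continuous (fun z : space * space => f z.2)}.
        by apply: (@continuous_comp _ _ _ snd f); [exact: cvg_snd|exact: cf].
      exact: (cvgB c1 c2).
    exact: norm_continuous.
  have cS : compact S.
    have -> : S = ([set x : space | enorm x <= K] `*` [set y : space | enorm y <= L]) `&`
        [set z | e <= `|f z.1 - f z.2|].
      by apply/seteqP; split => [z [h1 [h2 h3]]|z [[h1 h2] h3]].
    apply: (@subclosed_compact _ _ ([set x : space | enorm x <= K] `*` [set y : space | enorm y <= L])).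
    - apply: closedI; first by apply: compact_closed; [exact: norm_hausdorff|exact: compact_setX].
      apply: (@preimage_closed _ _ (fun z : space * space => `|f z.1 - f z.2|) [set y | e <= y]); last exact: closed_ge.
      by move=> z _; exact: cdiff.
    - exact: compact_setX.
    - by move=> z [].
  have [z zS zmin] := compact_EVT_min (ex_intro _ (x0, y0) Sxy) cS
    (continuous_subspaceT continuous_flux_gap).
  have gz : 0 < flux_gap z.1 z.2.
    apply: flux_gap_gt0; apply/eqP => zz; move: zS; rewrite inE => -[_ [_]].
    by rewrite zz subrr normr0 leNgt e0.
  exists (B / flux_gap z.1 z.2); first by rewrite divr_ge0 // ltW.
  move=> x y [h1 [h2 h3]]; apply: (@le_trans _ _ B).
    by apply: le_trans (ler_normB _ _) _; apply: lerD; exact: fb.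
  rewrite -mulrA ler_peMr // mulrC ler_pdivlMr // mul1r.
  by apply: (zmin (x, y)); rewrite inE.
pose C2 := 2%:R * (Cf * (1 + K `^ beta) + 2%:R * Cf).
have C20 : 0 <= C2.
  by rewrite /C2 mulr_ge0 // addr_ge0 ?mulr_ge0 ?(ltW Cf0) // addr_ge0 // powR_ge0.
exists (C1 + C2); first exact: addr_ge0.
move=> x y xK; have g0 := flux_gap_ge0 x y.
have Cg1 : 0 <= C1 * flux_gap x y by exact: mulr_ge0.
have Cg2 : 0 <= C2 * flux_gap x y by exact: mulr_ge0.
rewrite mulrDl.
have [yL|yL] := leP (enorm y) L.
  have [h|h] := leP e `|f x - f y|; last by rewrite (le_trans (ltW h)) // lerDl addr_ge0.
  have Sxy : S (x, y) by [].
  apply: le_trans (hC1 x y Sxy) _.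
  by move: (C1 * _) (C2 * _) Cg1 Cg2 => A1 A2 ? ?; lra.
apply: (@le_trans _ _ (C2 * flux_gap x y)); last by rewrite addrA lerDr addr_ge0 // ltW.
have y1 : 1 <= enorm y by apply: le_trans (ltW yL).
have yp1 : 1 <= enorm y `^ p.
  rewrite -(powRr0 (enorm y)); apply: ler_powR => //; exact: ltW.
have ypb : enorm y `^ beta <= enorm y `^ p by apply: ler_powR => //; exact: ltW.
have t1 : `|f x| <= Cf * (1 + K `^ beta) * enorm y `^ p.
  apply: le_trans (fb x K xK) _; rewrite ler_peMr // mulr_ge0 ?(ltW Cf0) //.
  by rewrite addr_ge0 // powR_ge0.
have t2 : `|f y| <= 2%:R * Cf * enorm y `^ p.
  have -> : 2%:R * Cf * enorm y `^ p = Cf * (2%:R * enorm y `^ p) by ring.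
  apply: le_trans (fgr y) _; rewrite ler_wpM2l ?(ltW Cf0) //.
  by move: yp1 ypb; move: (enorm y `^ p) (enorm y `^ beta) => P Q; lra.
have hg := hL x y xK (ltW yL).
apply: le_trans (ler_normB _ _) _; apply: le_trans (lerD t1 t2) _.
rewrite -mulrDl /C2 [2%:R * (_ + _)]mulrC -mulrA ler_wpM2l //.
by rewrite addr_ge0 ?mulr_ge0 ?(ltW Cf0) // addr_ge0 // powR_ge0.
Qed.

End p_laplacian_flux.

(** * Compact subsets of the cylinder and the boundary condition *)

Section localization.
Variable R : realType.

(** Compactness turns the neighbourhoods provided by openness into a uniform
    radius. *)
Lemma compact_margin (V : normedModType R) (K O : set V) :
  compact K -> open O -> K `<=` O ->
  exists2 r : R, 0 < r & forall x y, K x -> `|y - x| <= r -> O y.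
Proof.
move=> /compact_near_coveringP cK oO KO.
have H : \forall r \near (0 : R)^'+, K `<=` (fun x => forall y, `|y - x| <= r -> O y).
  apply: cK => x Kx.
  have /nbhs_ballP[e /= e0 he] : nbhs x O by apply: open_nbhs_nbhs; split => //; exact: KO.
  have e2 : 0 < e / 2 by rewrite divr_gt0.
  exists (ball x (e / 2), [set r | r < e / 2]).
    by split; [exact: nbhsx_ballx|exact: nbhs_right_lt].
  move=> [x' r] /= [xx' re] y yx'; apply: he; rewrite (splitr e).
  apply: ball_triangle xx' _; rewrite -ball_normE /= distrC.
  exact: le_lt_trans yx' re.
near (0 : R)^'+ => r.
exists r; first by near: r; exact: nbhs_right_gt.
move=> x y Kx; have : K `<=` (fun x => forall y, `|y - x| <= r -> O y) by near: r.
exact.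
Unshelve. all: by end_near. Qed.

Lemma ball_connected (V : normedModType R) (x : V) (e : R) : connected (ball x e).
Proof.
have [e0|e0] := ltP 0 e; last first.
  rewrite (_ : ball x e = set0); first exact: connected0.
  apply/seteqP; split => // y; rewrite -ball_normE /= => /(le_lt_trans (normr_ge0 _)).
  by rewrite ltNge e0.
pose seg (y : V) : set V := (fun s : R => x + s *: (y - x)) @` `[0, 1]%classic.
have -> : ball x e = \bigcup_(y in ball x e) seg y.
  apply/seteqP; split => [y xy|z [y xy [s /=]]].
    exists y => //; exists 1; first by rewrite /= in_itv /= ler01 lexx.
    by rewrite scale1r addrC subrK.
  rewrite in_itv /= => /andP[s0 s1] <-.
  move: xy; rewrite -!ball_normE /= opprD addNKr normrN normrZ ger0_norm // distrC.
  by apply: le_lt_trans; rewrite ler_piMl.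
apply: bigcup_connected.
  exists x => y _; exists 0; first by rewrite /= in_itv /= ler01 lexx.
  by rewrite scale0r addr0.
move=> y _; apply: connected_continuous_connected; first exact: segment_connected.
apply: continuous_subspaceT => s; apply: cvgD; first exact: cvg_cst.
by apply: cvgZr_tmp; exact: cvg_id.
Qed.

(** A compact part of a domain lies in a compactly contained subdomain: those
    containing a fixed point form a directed family which covers the domain by
    connectedness. *)
Lemma compact_subdomain (n : nat) (Omega K : set 'rV[R]_n) :
  domain Omega -> compact K -> K `<=` Omega ->
  exists U, [/\ domain U, K `<=` U, compact (closure U) & closure U `<=` Omega].
Proof.
move=> [oO cO [x0 Ox0]] cK KO.
pose good (U : set 'rV[R]_n) := [/\ open U, connected U, U x0,
  compact (closure U) & closure U `<=` Omega].
have goodU U U' : good U -> good U' -> good (U `|` U').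
  move=> [h1 h2 h3 h4 h5] [k1 k2 k3 k4 k5]; split.
  - exact: openU.
  - by apply: connectedU => //; exists x0.
  - by left.
  - by rewrite closureU; exact: compactU.
  - by rewrite closureU => x [/h5|/k5].
have local x : Omega x -> exists2 e : R, 0 < e &
    compact (closure (ball x e)) /\ closure (ball x e) `<=` Omega.
  move=> Ox; have /nbhs_ballP[e /= e0 he] : nbhs x Omega by exact: open_nbhs_nbhs.
  have e2 : 0 < e / 2 by rewrite divr_gt0.
  have sub : closure (ball x (e / 2)) `<=` [set y | `|y - x| <= e / 2].
    rewrite [X in _ `<=` X](_ : _ = closure [set y | `|y - x| <= e / 2]).
      apply: closure_subset => y; rewrite -ball_normE /= distrC; exact: ltW.
    exact/closure_id/closed_norm_le.
  exists (e / 2) => //; split.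
    apply: bounded_closed_compact; last exact: closed_closure.
    exists (e / 2 + `|x|); split; first exact: num_real.
    move=> M hM y /sub /= ye; apply: le_trans (ltW hM).
    by rewrite -[y](subrK x); apply: le_trans (ler_normD _ _) _; rewrite lerD2r.
  move=> y /sub /= ye; apply: he; rewrite -ball_normE /= distrC.
  by apply: le_lt_trans ye _; rewrite ltr_pdivrMr // mulr_natr mulr2n ltrDl.
pose S : set 'rV[R]_n := [set x | exists2 U, good U & U x].
have gS : S x0.
  have [e e0 [h1 h2]] := local x0 Ox0.
  exists (ball x0 e); last exact: ballxx.
  by split => //; [exact: ball_open|exact: ball_connected|exact: ballxx].
have oS : open S.
  rewrite openE => x [U gU Ux]; have [oU _ _ _ _] := gU.
  apply: (@filterS _ _ _ U); first by move=> y Uy; exists U.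
  by apply: open_nbhs_nbhs.
have SO : S `<=` Omega by move=> x [U [_ _ _ _ UO] Ux]; apply: UO; exact: subset_closure.
have ES : S = Omega.
  apply: cO.
  - by exists x0.
  - by exists S => //; apply/seteqP; split => x; [split => //; exact: SO|case].
  - exists (closure S); first exact: closed_closure.
    apply/seteqP; split => [x Sx|x [Ox clS]]; first by split; [exact: SO|exact: subset_closure].
    have [e e0 [h1 h2]] := local x Ox.
    have [y [[U gU Uy] xy]] := clS _ (nbhsx_ballx x e e0).
    have [k1 k2 k3 k4 k5] := gU.
    exists (U `|` ball x e); last by right; exact: ballxx.
    split.
    + by apply: openU => //; exact: ball_open.
    + by apply: connectedU => //; [exists y|exact: ball_connected].
    + by left.
    + by rewrite closureU; exact: compactU.
    + by rewrite closureU => z [/k5|/h2].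
have FF : Filter (filter_from good (fun U => [set W : set 'rV[R]_n | U `<=` W])).
  apply: filter_from_filter.
    by have [U gU _] := gS; exists U.
  move=> U U' gU gU'; exists (U `|` U'); first exact: goodU.
  by move=> W UW; split => x Ux; apply: UW; [left|right].
have [U gU hU] : filter_from good (fun U => [set W : set 'rV[R]_n | U `<=` W])
    (fun W => K `<=` W).
  move/compact_near_coveringP : cK => /(_ _ _ (fun W x => W x) FF); apply => x Kx.
  have [U gU Ux] : S x by rewrite ES; exact: KO.
  have [oU _ _ _ _] := gU.
  exists (U, [set W | U `<=` W]).
    by split => /=; [exact: open_nbhs_nbhs|exists U].
  by move=> [x' W] /= [Ux' UW]; exact: UW.
have [oU coU Ux0 h1 h2] := gU.
exists U; split => //; last exact: hU.
by split => //; exists x0.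
Qed.

End localization.

Section boundary.
Variables (R : realType) (N : nat).
Local Notation point := ('rV[R]_N * R)%type.
Local Notation mpoint := ('rV[R]_N * measurableTypeR R)%type.
Local Notation mu := (lebesgue_xt R N).
Variables (Omega : set 'rV[R]_N) (T : R) (u v : point -> R) (M : R).
Hypotheses (oO : open Omega) (bO : bounded_set Omega) (T0 : 0 < T).
Hypothesis uM : \forall z \ae mu, cylinder Omega 0 T z -> `|u z| <= M.
Hypothesis vM : \forall z \ae mu, cylinder Omega 0 T z -> `|v z| <= M.
Hypothesis hbd : forall z0 : point, parabolic_boundary Omega T z0 ->
    (limf_esup (fun z => (u z)%:E) (within (cylinder Omega 0 T) (nbhs z0)) <=
     limf_einf (fun z => (v z)%:E) (within (cylinder Omega 0 T) (nbhs z0)))%E.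

Lemma open_cylinder (U : set 'rV[R]_N) (a b : R) : open U -> open (cylinder U a b).
Proof.
move=> oU.
have -> : cylinder U a b = (fst @^-1` U) `&` (snd @^-1` [set t | a < t < b]) by [].
apply: openI.
  by apply: open_comp => // z _; exact: cvg_fst.
apply: open_comp; first by move=> z _; exact: cvg_snd.
have -> : [set t : R | a < t < b] = [set t | a < t] `&` [set t | t < b].
  by apply/seteqP; split => t /=; [move=> /andP[]|move=> [-> ->]].
by apply: openI; [exact: open_gt|exact: open_lt].
Qed.

(** Moving slightly inwards in time: the closed time interval, both ends included,
    is reached from inside. *)
Lemma closure_cylinder (x : 'rV[R]_N) (t : R) :
  closure Omega x -> 0 <= t <= T -> closure (cylinder Omega 0 T) (x, t).
Proof.
move=> clx /andP[t0 tT] B /nbhs_ballP[e /= e0 he].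
have [x' [Ox' xx']] := clx _ (nbhsx_ballx x e e0).
pose s := Num.min 1 (e / (T + 1)).
have T1 : 0 < T + 1 by rewrite addr_gt0.
have s0 : 0 < s by rewrite lt_min ltr01 divr_gt0.
have s1 : s <= 1 by rewrite ge_min lexx.
have sT : s * T < e.
  apply: (@le_lt_trans _ _ (e / (T + 1) * T)).
    by rewrite ler_wpM2r ?(ltW T0) // ge_min lexx orbT.
  by rewrite mulrAC -mulrA gtr_pMr // ltr_pdivrMr // mul1r ltrDl.
have st : s * t <= t by rewrite ler_piMl.
have st' : s * (T - t) <= T - t by rewrite ler_piMl // subr_ge0.
have sT0 : 0 < s * T by rewrite mulr_gt0.
exists (x', t - s * t + s * T / 2); split.
  split => //=; move: st st' sT0; rewrite mulrBr.
  move: (s * t) (s * T) => a b *; apply/andP; split; lra.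
apply: he; split => //=; rewrite -ball_normE /=.
have st0 : 0 <= s * t by rewrite mulr_ge0 // ltW.
have stT : s * t <= s * T by rewrite ler_wpM2l // ltW.
move: sT sT0 st0 stT; move: (s * t) (s * T) => a b *.
by rewrite ltr_norml; apply/andP; split; lra.
Qed.

(** A real number separates the upper from the lower limit: these cannot both be
    infinite of the same sign, because near a point of the closure there are
    points of the cylinder that satisfy the bounds on [u] and [v]. *)
Lemma boundary_comparison (z0 : point) (d : R) :
  closure (cylinder Omega 0 T) z0 -> parabolic_boundary Omega T z0 -> 0 < d ->
  \forall z \near z0, cylinder Omega 0 T z -> u z - v z <= d.
Proof.
move=> clz bz d0; have := hbd bz.
set F := within _ _.
have FF : Filter F by exact: within_filter.
have oC : open (cylinder Omega 0 T) by exact: open_cylinder.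
have meets (A : set point) (P : point -> Prop) : F A ->
    (\forall z \ae mu, cylinder Omega 0 T z -> P z) -> exists2 z, A z & P z.
  rewrite /F /within /= nbhsE => -[B [oB Bz] BA] aeP.
  have [z [Cz Bz']] : exists z, cylinder Omega 0 T z /\ B z.
    by apply: clz; exact: open_nbhs_nbhs.
  have [|||y [By Cy] Py] := @ae_meets_open R N (B `&` cylinder Omega 0 T) P.
  - exact: openI.
  - by exists z.
  - by apply: ae_imply aeP => y h [_ /h].
  by exists y => //; exact: BA.
set l1 := limf_esup _ _; set l2 := limf_einf _ _ => l12.
have [L [hL1 hL2]] : exists L : R, (l1 <= L%:E)%E /\ (L%:E <= l2)%E.
  have n1 : l1 != +oo%E.
    apply/eqP => l1y; move: l12; rewrite l1y leye_eq => /eqP l2y.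
    have : (M%:E < l2)%E by rewrite l2y ltry.
    rewrite /l2 limf_einfE => /ereal_sup_gt [_ [A FA <-]] /= MA.
    have [z Az] := meets A _ FA vM.
    apply/negP; rewrite -ltNge; apply: lt_le_trans (ler_norm _).
    rewrite -lte_fin; apply: lt_le_trans MA _.
    by apply: ereal_inf_lbound; exists z.
  have n2 : l2 != -oo%E.
    apply/eqP => l2y; move: l12; rewrite l2y leeNy_eq => /eqP l1y.
    have : (l1 < (- M)%:E)%E by rewrite l1y ltNyr.
    rewrite /l1 limf_esupE => /ereal_inf_lt [_ [A FA <-]] /= MA.
    have [z Az] := meets A _ FA uM.
    apply/negP; rewrite -ltNge -normrN; apply: lt_le_trans (ler_norm _).
    rewrite ltrNr -lte_fin; apply: le_lt_trans MA.
    by apply: ereal_sup_ubound; exists z.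
  move: l12 n1 n2; clear; case: l1 => [a| |] //; case: l2 => [b| |] // ab _ _.
  - by exists a; split.
  - by exists a; split; rewrite ?leey.
  - by exists b; split; rewrite ?leNye.
  - by exists 0; split; rewrite ?leNye ?leey.
have : (l1 < (L + d / 2)%:E)%E.
  by apply: le_lt_trans hL1 _; rewrite lte_fin ltrDl divr_gt0.
rewrite /l1 limf_esupE => /ereal_inf_lt [_ [A FA <-]] /= uA.
have : ((L - d / 2)%:E < l2)%E.
  by apply: lt_le_trans hL2; rewrite lte_fin ltrBlDr ltrDl divr_gt0.
rewrite /l2 limf_einfE => /ereal_sup_gt [_ [B FB <-]] /= vB.
have : F (A `&` B) by exact: filterI.
rewrite /F /within /=; apply: filterS => z h /h [Az Bz].
have u1 : u z < L + d / 2.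
  rewrite -lte_fin; apply: le_lt_trans uA.
  by apply: ereal_sup_ubound; exists z.
have v1 : L - d / 2 < v z.
  rewrite -lte_fin; apply: lt_le_trans vB _.
  by apply: ereal_inf_lbound; exists z.
lra.
Qed.

(** Up to the time [c < T] the boundary of the cylinder is parabolic, so the points
    that have no neighbourhood on which the difference is small stay away from
    it. *)
Lemma compact_excess_set (d c : R) : 0 < d -> c < T ->
  exists K : set point, [/\ compact K, K `<=` cylinder Omega 0 T &
    forall z, cylinder Omega 0 T z -> z.2 <= c -> ~ K z -> u z - v z <= d].
Proof.
move=> d0 cT.
pose A : set point := [set z | cylinder Omega 0 T z -> u z - v z <= d].
pose K : set point := ((fst @^-1` closure Omega) `&` (snd @^-1` [set t | 0 <= t <= c])) `&` ~` A°.
have cK : closed K.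
  apply: closedI; last by apply: open_closedC; exact: open_interior.
  apply: closedI.
    by apply: preimage_closed; [move=> z _; exact: cvg_fst|exact: closed_closure].
  apply: preimage_closed; first by move=> z _; exact: cvg_snd.
  have -> : [set t : R | 0 <= t <= c] = [set t | 0 <= t] `&` [set t | t <= c].
    by apply/seteqP; split => t /=; [move=> /andP[]|move=> [-> ->]].
  by apply: closedI; [exact: closed_ge|exact: closed_le].
exists K; split.
- apply: point_bounded_closed_compact => //.
  have [B [Br hB]] := bO.
  have clB : closure Omega `<=` [set x | `|x - 0| <= `|B| + 1].
    rewrite [X in _ `<=` X](_ : _ = closure [set x | `|x - 0| <= `|B| + 1]).
      apply: closure_subset => x Ox /=; rewrite subr0; apply: (hB (`|B| + 1)) => //.
      by rewrite (le_lt_trans (ler_norm _)) // ltrDl.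
    exact/closure_id/closed_norm_le.
  exists (`|B| + 1 + `|c|); split; first exact: num_real.
  move=> M' M'h z [[/clB /=]]; rewrite subr0 => h1 /andP[h2 h3] _.
  apply: le_trans (ltW M'h); apply/point_normE; split.
    by apply: le_trans h1 _; rewrite lerDl.
  rewrite ger0_norm //; apply: le_trans h3 _; apply: le_trans (ler_norm _) _.
  by rewrite lerDr addr_ge0.
- move=> [x t] [[/= clx /andP[t0 tc]] nA].
  have tT : t < T by exact: le_lt_trans tc cT.
  have clz : closure (cylinder Omega 0 T) (x, t).
    by apply: closure_cylinder => //; rewrite t0 ltW.
  have nb : ~ parabolic_boundary Omega T (x, t).
    by move=> bz; apply: nA; exact: boundary_comparison.
  have Ox : Omega x.
    apply: contrapT => nO; apply: nb.
    have [tz|tz] := eqVneq t 0; first by left; split.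
    right; split; first by split => //= iO; apply: nO; exact: interior_subset.
    by rewrite /= lt_neqAle eq_sym tz t0 ltW.
  split => //=; rewrite tT andbT lt_neqAle t0 andbT.
  by apply/eqP => tz; apply: nb; left; split.
- move=> z Cz zc nK.
  have : A° z.
    apply: contrapT => nA; apply: nK; split => //; split.
      by case: Cz => Oz _; exact: subset_closure.
    by case: Cz => _ /= /andP[/ltW -> _].
  by move=> /interior_subset; apply.
Qed.

End boundary.

(** * Borel representatives and restriction of weak gradients *)

Section representatives.
Context d (T : measurableType d) (R : realType).
Variable mu : {measure set T -> \bar R}.

Lemma lebesgue_measurable_sub (D E : set T) (w : T -> R) :
  measurable D -> E `<=` D ->
  lebesgue_measurable mu D w -> lebesgue_measurable mu E w.
Proof.
move=> mD ED [g mg wg]; exists g; first exact: measurable_funS mg.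
by apply: ae_imply wg => x h /ED.
Qed.

Lemma representative (D : set T) (w : T -> R) : measurable D ->
  lebesgue_measurable mu D w ->
  exists g : T -> R, [/\ measurable_fun setT g, forall x, ~ D x -> g x = 0 &
    \forall x \ae mu, D x -> w x = g x].
Proof.
move=> mD [g mg wg]; exists (g \_ D); split.
- by apply/(measurable_restrictT _ mD).1.
- by move=> x nD; rewrite patchE memNset.
- by apply: ae_imply wg => x h Dx; rewrite patchE mem_set // h.
Qed.

(** Cutting off makes a bound hold everywhere, so that convolutions may be estimated
    pointwise. *)
Lemma bounded_representative (D : set T) (w : T -> R) (M : R) : measurable D ->
  0 <= M -> lebesgue_measurable mu D w -> (\forall x \ae mu, D x -> `|w x| <= M) ->
  exists g : T -> R, [/\ measurable_fun setT g, forall x, ~ D x -> g x = 0,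
    forall x, `|g x| <= M & \forall x \ae mu, D x -> w x = g x].
Proof.
move=> mD M0 lw wM; have [g [mg g0 wg]] := representative mD lw.
exists (fun x => Num.max (- M) (Num.min M (g x))); split.
- by apply: measurable_maxr => //; apply: measurable_minr.
- by move=> x /g0 ->; rewrite minC (min_idPl M0); apply/max_idPr; rewrite oppr_le0.
- by move=> x; rewrite ler_norml le_max lexx /= ge_max ge_min lexx /= ge0_cp.
- apply: ae_imply2 wM wg => x h1 h2 Dx; rewrite -h2 //.
  have := h1 Dx; rewrite ler_norml => /andP[l1 l2].
  by rewrite (min_idPr l2) (max_idPr l1).
Qed.

End representatives.

Section weak_gradients.
Variables (R : realType) (N : nat).
Local Notation space := 'rV[R]_N.
Local Notation point := ('rV[R]_N * R)%type.
Local Notation mpoint := ('rV[R]_N * measurableTypeR R)%type.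
Local Notation mu := (lebesgue_xt R N).
Local Notation nu := (lebesgue_rV R N).

Lemma open_measurable_rV (U : set space) : open U -> measurable U.
Proof.
move=> oU.
have mO : measurable (fst @^-1` U : set mpoint).
  by apply: open_measurable_point; apply: open_comp => // z _; exact: cvg_fst.
have ms : measurable_fun setT (fun x : space => (x, 0) : mpoint).
  by apply/measurable_fun_pairP; split; [exact: measurable_id|exact: measurable_cst].
by have := ms measurableT _ mO; rewrite setTI.
Qed.

(** The complement of the support is open, so the derivatives off the set see only
    zeros; this allows to change domains of integration freely. *)
Lemma test_function_off (V : normedModType R) (U : set V) (phi : V -> R) (x v : V) :
  test_function U phi -> ~ U x -> phi x = 0 /\ 'D_v phi x = 0.
Proof.
move=> [_ _ sU] nU.
have nb : nbhs x (~` closure [set x | phi x != 0]).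
  apply: open_nbhs_nbhs; split; first exact/closed_openC/closed_closure.
  by move=> /sU.
have h0 y : (~` closure [set x | phi x != 0]) y -> phi y = 0.
  move=> ny; apply/eqP; apply: contraT => p0; case: ny.
  exact: subset_closure.
split; first by apply: h0; exact: nbhs_singleton nb.
rewrite -[RHS](derive_cst (0 : R) x v); apply: near_eq_derive.
by apply: filterS nb => y /h0.
Qed.

Lemma test_function_sub (V : normedModType R) (U W : set V) (phi : V -> R) :
  U `<=` W -> test_function U phi -> test_function W phi.
Proof. by move=> UW [h1 h2 h3]; split => // x /h3 /UW. Qed.

Lemma integral_test_sub (U W : set space) (h phi : space -> R) :
  U `<=` W -> (forall x, ~ U x -> phi x = 0) ->
  (\int[nu]_(x in W) (h x * phi x)%:E = \int[nu]_(x in U) (h x * phi x)%:E)%E.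
Proof.
move=> UW p0; rewrite integral_mkcond [RHS]integral_mkcond.
apply: eq_integral => x _; rewrite !patchE.
have [Ux|nU] := pselect (U x); first by rewrite !mem_set //; exact: UW.
by rewrite (memNset nU) p0 // mulr0; case: ifP.
Qed.

Lemma weak_gradient_sub (U W : set space) (w : space -> R) (g : space -> space) :
  open W -> U `<=` W -> weak_gradient W w g -> weak_gradient U w g.
Proof.
move=> oW UW [[lw iw] hg wg]; have mW := open_measurable_rV oW.
split.
- split; first exact: lebesgue_measurable_sub UW lw.
  by move=> K cK KU; apply: iw => // x /KU /UW.
- move=> i; have [lg ig] := hg i; split; first exact: lebesgue_measurable_sub UW lg.
  by move=> K cK KU; apply: ig => // x /KU /UW.
- move=> i phi tphi; have := wg i phi (test_function_sub UW tphi).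
  rewrite !(integral_test_sub _ UW) //.
    by move=> x nU; have [] := test_function_off 0 tphi nU.
  by move=> x nU; have [_ ->] := test_function_off (delta_mx ord0 i) tphi nU.
Qed.

Lemma spatial_gradient_sub (U W : set space) (a b a' b' : R) (u : point -> R)
    (Du : point -> space) :
  open W -> U `<=` W -> a <= a' -> b' <= b ->
  spatial_gradient W a b u Du -> spatial_gradient U a' b' u Du.
Proof.
move=> oW UW aa bb [mD gD]; split.
  move=> i; apply: lebesgue_measurable_sub (mD i).
    by apply: open_measurable_point; exact: open_cylinder.
  by move=> z [/UW Uz /= /andP[h1 h2]]; split => //=; rewrite (le_lt_trans aa h1) (lt_le_trans h2 bb).
apply: ae_imply gD => t h /andP[h1 h2].
apply: weak_gradient_sub oW UW (h _).
by rewrite (le_lt_trans aa h1) (lt_le_trans h2 bb).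
Qed.

End weak_gradients.

(** * The equations for mollified functions *)

Section mollified_equations.
Variables (R : realType) (N : nat).
Local Notation space := 'rV[R]_N.
Local Notation point := ('rV[R]_N * R)%type.
Local Notation mpoint := ('rV[R]_N * measurableTypeR R)%type.
Local Notation mu := (lebesgue_xt R N).
Local Notation nu := (lebesgue_rV R N).

(** At a fixed time a translated mollifier is a test function in space, which is
    what a weak gradient on a time slice accepts. *)
Lemma slice_test_function (r : R) (rho : point -> R) (z : point) (t : R) (U : set space) :
  mollifier r rho -> (forall x, `|(x, t) - z| <= r -> U x) ->
  test_function U (fun x => rho ((x, t) - z)) /\
  forall v x, 'D_v (fun x => rho ((x, t) - z)) x = 'D_(v, 0) rho ((x, t) - z).
Proof.
move=> [rC r0 rs _ _] zU.
pose L (x : space) : point := (x, t) - z.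
pose L0 (v : space) : point := (v, 0).
have affL (h : R) v x : L (h *: v + x) = h *: L0 v + L x.
  rewrite /L /L0 addrA; congr (_ - _).
  by rewrite -[RHS]/(h *: v + x, h *: 0 + t) scaler0 add0r.
have cL : continuous L.
  move=> x; apply: (@cvgrPdist_lt _ _ _ (nbhs x) _ L (L x)).2 => e e0.
  have := nbhsx_ballx x e e0; apply: filterS => y.
  rewrite -ball_normE /= => xy.
  have -> : L x - L y = (x - y, 0).
    rewrite /L opprB addrA subrK.
    by rewrite -[LHS]/(x - y, t - t) subrr.
  by rewrite prod_normE normr0 gt_max xy.
split; last by move=> v x; exact: (derive_affine affL).
have cB : closed [set x | `|L x| <= r].
  apply: (@preimage_closed _ _ (fun y : space => `|L y|) [set y | y <= r]); last exact: closed_le.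
  by move=> y _; apply: continuous_comp; [exact: cL|exact: norm_continuous].
have sub : closure [set x | rho (L x) != 0] `<=` [set x | `|L x| <= r].
  rewrite [X in _ `<=` X](_ : _ = closure [set x | `|L x| <= r]); last exact/closure_id.
  by apply: closure_subset => y /= /rs /ltW.
split.
- by move=> k; exact: (Ck_affine affL).
- apply: bounded_closed_compact; last exact: closed_closure.
  exists (r + `|z|); split; first exact: num_real.
  move=> M hM x /sub /= xr; apply: le_trans (ltW hM).
  have : `|(x, t)| <= r + `|z|.
    rewrite -[(x, t)](subrK z); apply: le_trans (ler_normD _ _) _.
    by rewrite lerD2r.
  by move=> /point_normE[].
- by move=> x /sub; exact: zU.
Qed.

(** A weak gradient in space commutes with mollification in space and time: on
    almost every time slice the kernel is a test function in space, and Fubini's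
    theorem puts the slices together. *)
Lemma conv_spatial_gradient (U : set space) (a b : R) (u ut : point -> R)
    (Du Dt : point -> space) (r : R) (rho : point -> R) (z : point) i :
  mollifier r rho -> open U ->
  (\forall t \ae (@lebesgue_measure R), a < t < b ->
    weak_gradient U (fun x => u (x, t)) (fun x => Du (x, t))) ->
  L1 ut -> L1 (fun y => Dt y ord0 i) ->
  (forall y, ~ cylinder U a b y -> ut y = 0 /\ Dt y = 0) ->
  (\forall y \ae mu, cylinder U a b y -> u y = ut y) ->
  (\forall y \ae mu, cylinder U a b y -> Du y ord0 i = Dt y ord0 i) ->
  (forall y, `|y - z| <= r -> cylinder U a b y) ->
  conv ut ('D_(space_dir R i) rho) z = - conv (fun y => Dt y ord0 i) rho z.
Proof.
move=> mol oU wg Iu ID off eu eD zQ.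
have br := mollifier_bounded mol.
have bd := mollifier_derive_bounded mol (space_dir R i).
pose F (y : point) := ut y * 'D_(space_dir R i) rho (y - z).
pose G (y : point) := - (Dt y ord0 i * rho (y - z)).
have IF : L1 F := L1_conv_integrand z Iu bd.
have IG0 : L1 (fun y => Dt y ord0 i * rho (y - z)) := L1_conv_integrand z ID br.
have IG : L1 G.
  rewrite (_ : G = fun y => (-1) * (Dt y ord0 i * rho (y - z))); first exact: L1Z.
  by apply/funext => y; rewrite mulN1r.
suff FG : (\int[mu]_y (F y)%:E = \int[mu]_y (G y)%:E)%E.
  have -> : conv ut ('D_(space_dir R i) rho) z = \int[mu]_y G y.
    by rewrite /Rintegral -FG.
  rewrite (_ : G = fun y => (-1) * (Dt y ord0 i * rho (y - z))).
    by rewrite RintegralZl // mulN1r.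
  by apply/funext => y; rewrite mulN1r.
rewrite -(@integral21_prod_meas1 _ _ _ _ _ nu (@lebesgue_measure R) _ IF).
rewrite -(@integral21_prod_meas1 _ _ _ _ _ nu (@lebesgue_measure R) _ IG).
apply: eq_integral_ae.
have iG := @ae_integrable2 _ _ _ _ _ nu (@lebesgue_measure R) _ IG0.
have := ae_imply2 (fun t h1 h2 => conj h1 h2) (ae_slice eu) (ae_slice eD).
move=> uD.
have {iG} := ae_imply2 (fun t h1 h2 => conj h1 h2) uD iG.
apply: ae_imply2 wg => t wgt [[eut eDt] iGt] _.
have [ab|nab] := pselect (a < t < b); last first.
  apply: eq_integral => x _; have [] := off (x, t); first by move=> [].
  by rewrite /fubini_G /F /G /= => -> ->; rewrite mxE !mul0r oppr0.
have [tphi dphi] := @slice_test_function r rho z t U mol (fun x h => (zQ _ h).1).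
have [_ _ wgt0] := wgt ab; have {wgt0} := wgt0 i _ tphi.
under eq_integral do rewrite dphi.
move=> wgt0.
transitivity (\int[nu]_(x in U) (u (x, t) * 'D_(space_dir R i) rho ((x, t) - z))%:E)%E.
  rewrite [RHS]integral_mkcond; apply: eq_integral_ae.
  apply: ae_imply eut => x h _; rewrite patchE /F /=.
  case: ifPn => [/set_mem Ux|/negP nU]; first by rewrite h.
  have [-> _] := off (x, t) (fun h => nU (mem_set h.1)).
  by rewrite mul0r.
transitivity (- \int[nu]_x (Dt (x, t) ord0 i * rho ((x, t) - z))%:E)%E; last first.
  rewrite -integralN; first exact: eq_integral.
  by apply: (@integrable_add_def _ _ _ nu setT measurableT); exact: iGt.
rewrite wgt0; congr (- _)%E; rewrite integral_mkcond; apply: eq_integral_ae.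
apply: ae_imply eDt => x h _; rewrite patchE /=.
case: ifPn => [/set_mem Ux|/negP nU]; first by rewrite h.
have [_ ->] := off (x, t) (fun h => nU (mem_set h.1)).
by rewrite mxE mul0r.
Qed.


(** Integration by parts for the function [t], whose derivatives are constant; it
    enters the excess through the term [eta t]. *)
Lemma conv_time (Q : set point) (v z : point) (r : R) (rho : point -> R) :
  mollifier r rho -> L1 (fun y => y.2 * \1_Q y) ->
  (forall y, `|y - z| <= r -> Q y) ->
  conv (fun y => y.2 * \1_Q y) ('D_v rho) z = - v.2.
Proof.
move=> mol IQ zQ.
have br := mollifier_bounded mol.
have [mr [B rhoB]] := br.
have bd := mollifier_derive_bounded mol v.
have [mdr [B' drhoB]] := bd.
pose k y := rho (y - z).
have affL (h : R) (w x : point) : (h *: w + x) - z = h *: w + (x - z) by rewrite addrA.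
have dk y : is_derive y v k ('D_v rho (y - z)).
  have d1 := @derivable_affine _ _ _ (fun y : point => y - z) id affL rho v y
    (@mollifier_derivable _ _ _ _ mol v (y - z)).
  have <- := @derive_affine _ _ _ (fun y : point => y - z) id affL rho v y.
  exact/derivableP.
pose psi y := (y : point).2 * k y.
have aff2 (h : R) (w x : point) : (h *: w + x).2 = h *: w.2 + x.2 by [].
have d2 y : is_derive y v (snd : point -> R) v.2.
  have d1 := @derivable_affine _ _ _ (snd : point -> R) snd aff2 id v y
    (@derivable_id _ _ _ _).
  have <- : 'D_v (snd : point -> R) y = v.2.
    by rewrite (@derive_affine _ _ _ (snd : point -> R) snd aff2 id v y) derive_id.
  exact/derivableP.
have dpsi (y : point) : is_derive y v psi (y.2 * 'D_v rho (y - z) + k y * v.2).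
  exact: is_derive_mul.
have psi0 y : psi y != 0 -> `|y| <= r + `|z|.
  rewrite mulf_eq0 negb_or => /andP[_ /(mollifier_support mol) yr].
  by rewrite -[y](subrK z); apply: le_trans (ler_normD _ _) _; rewrite lerD2r.
have tM (F : point -> R) (M : R) : (forall y, F y != 0 -> `|y| <= r) -> (forall y, `|F y| <= M) ->
    forall y, `|y.2 * F (y - z)| <= (`|r| + `|z|) * M.
  move=> Fr FM y; have [->|F0] := eqVneq (F (y - z)) 0.
    by rewrite mulr0 normr0 mulr_ge0 ?addr_ge0 // (le_trans _ (FM 0)).
  have yr : `|y| <= `|r| + `|z|.
    by rewrite -[y](subrK z); apply: le_trans (ler_normD _ _) _; rewrite lerD2r (le_trans (Fr _ F0)) ?ler_norm.
  by rewrite normrM ler_pM //; have /point_normE[] := yr.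
have kM y : `|k y| <= B by exact: rhoB.
have bpsi : bounded_measurable psi.
  split; last by exists ((`|r| + `|z|) * B); apply: tM rhoB; exact: mollifier_support mol.
  apply: measurable_funM; first exact: measurable_snd.
  exact: (measurableT_comp mr (measurable_shiftN z)).
have psiM y : `|'D_v psi y| <= (`|r| + `|z|) * B' + B * `|v.2|.
  have [_ ->] := dpsi y; apply: le_trans (ler_normD _ _) _; apply: lerD.
    by apply: tM drhoB _; exact: derive_support (mollifier_support mol).
  by rewrite normrM ler_wpM2r.
have [] := @integral_derive_eq0 _ _ psi v (r + `|z|) _ bpsi psi0 _ psiM.
  by move=> y; have [] := dpsi y.
move=> _ I0.
have kQ (F : point -> R) y : (forall y, F y != 0 -> `|y| <= r) ->
    y.2 * \1_Q y * F (y - z) = y.2 * F (y - z).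
  move=> Fr; have [->|/Fr/zQ Qy] := eqVneq (F (y - z)) 0; first by rewrite !mulr0.
  by rewrite indicE mem_set // mulr1.
have J1 := L1_conv_integrand z IQ bd.
have Ik : L1 k.
  apply: (@integrable_bounded_support _ _ k B (r + `|z| + 1)) => //.
    exact: (measurableT_comp mr (measurable_shiftN z)).
  move=> y /(mollifier_support mol) yr; rewrite ltr_pwDr //.
  by rewrite -[y](subrK z); apply: le_trans (ler_normD _ _) _; rewrite lerD2r.
have J2 : L1 (fun y => v.2 * k y) := L1Z _ Ik.
apply/eqP; rewrite -addr_eq0 -[X in _ + X]mulr1; apply/eqP; rewrite -[RHS]I0.
have <- : \int[mu]_y k y = 1 by rewrite /Rintegral (mollifier_mass_left mol).
rewrite -RintegralZl // -RintegralD //.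
apply: eq_Rintegral => y _; have [_ ->] := dpsi y.
rewrite (mulrC (k y)); congr (_ + _).
by apply: (kQ ('D_v rho)); exact: derive_support (mollifier_support mol).
Qed.

Lemma L1_sum (I : Type) (s : seq I) (F : I -> point -> R) : (forall i, L1 (F i)) ->
  L1 (fun y => \sum_(i <- s) F i y) /\
  \int[mu]_y (\sum_(i <- s) F i y) = \sum_(i <- s) \int[mu]_y F i y.
Proof.
move=> IF; elim: s => [|i s [IHs Es]].
  have -> : (fun y => \sum_(i <- [::]) F i y) = fun=> 0 by apply/funext => y; rewrite big_nil.
  rewrite big_nil; split; last by rewrite Rintegral_cst // mul0r.
  exact: (@integrable0 _ _ _ mu setT).
have -> : (fun y => \sum_(j <- i :: s) F j y) = fun y => F i y + \sum_(j <- s) F j y.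
  by apply/funext => y; rewrite big_cons.
split; first exact: L1D.
by rewrite [RHS]big_cons -Es -RintegralD //; exact: IF.
Qed.

(** Tested with a translated mollifier, the equation becomes a relation between
    mollified functions at the centre of the mollifier. This holds pointwise, so
    afterwards it may be multiplied by functions that depend on the solution. *)
Lemma weak_form_mollifier (p : R) (f : space -> R) (Q Xi : set point) (u ut F : point -> R)
    (Du Dt : point -> space) (r : R) (rho : point -> R) (z : point) :
  mollifier r rho -> Q `<=` Xi ->
  L1 ut -> (forall i, L1 (fun y => flux p (Dt y) ord0 i)) -> L1 F ->
  (\forall y \ae mu, Q y -> [/\ u y = ut y, Du y = Dt y & f (Dt y) = F y]) ->
  (forall y, `|y - z| <= r -> Q y) ->
  weak_form p f Xi u Du (fun y => rho (y - z)) =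
  (- conv ut ('D_(time_dir R N) rho) z
   + \sum_i conv (fun y => flux p (Dt y) ord0 i) ('D_(space_dir R i) rho) z
   - conv F rho z)%:E.
Proof.
move=> mol QXi Iu IA IF eQ zQ.
have br := mollifier_bounded mol.
have bd v := mollifier_derive_bounded mol v.
have affL (h : R) (w x : point) : (h *: w + x) - z = h *: w + (x - z) by rewrite addrA.
have dE v y : 'D_v (fun y : point => rho (y - z)) y = 'D_v rho (y - z).
  exact: (@derive_affine _ _ _ (fun y : point => y - z) id affL rho v y).
have I1 := L1Z (- 1) (L1_conv_integrand z Iu (bd (time_dir R N))).
have I2 i := L1_conv_integrand z (IA i) (bd (space_dir R i)).
have I3 := L1Z (- 1) (L1_conv_integrand z IF br).
have [I2s E2] := L1_sum (index_enum _) I2.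
have I12 := L1D I1 I2s.
have IAll := L1D I12 I3.
rewrite -[conv ut _ _]mul1r -mulNr -[conv F _ _]mul1r -mulNr /conv -RintegralZl //; last first.
  exact: (L1_conv_integrand z Iu (bd (time_dir R N))).
rewrite -[X in _ + X]RintegralZl //; last exact: (L1_conv_integrand z IF br).
rewrite -E2 -RintegralD // -RintegralD //.
rewrite /Rintegral fineK; last exact: integrable_fin_num IAll.
rewrite /weak_form [LHS]integral_mkcond; apply: eq_integral_ae.
apply: ae_imply eQ => y h _; rewrite patchE.
have out : ~ Q y -> rho (y - z) = 0 /\ forall v, 'D_v rho (y - z) = 0.
  move=> nQ; have nr : ~ (`|y - z| <= r) by move=> /zQ.
  split=> [|v]; apply/eqP; apply: contraT => /=.
    by move=> /(mollifier_support mol).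
  by move=> /(derive_support (mollifier_support mol)).
rewrite /time_derivative /space_gradient dE.
have -> : \row_i 'D_(delta_mx ord0 i, 0) (fun y => rho (y - z)) y =
          \row_i 'D_(space_dir R i) rho (y - z) :> space.
  by apply/rowP => i; rewrite !mxE dE.
have fluxE (x : space) : enorm x `^ (p - 2) * edot x (\row_i 'D_(space_dir R i) rho (y - z)) =
    \sum_i flux p x ord0 i * 'D_(space_dir R i) rho (y - z).
  by rewrite /edot mulr_sumr; apply: eq_bigr => i _; rewrite !mxE mulrA.
rewrite fluxE; have [Qy|nQ] := pselect (Q y); last first.
  have [-> dy] := out nQ; rewrite /time_dir !dy.
  rewrite !big1 => [||]; try by move=> i _; rewrite dy mulr0.
  by rewrite !mulr0 !mul0r !addr0 oppr0 !addr0 if_same.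
rewrite mem_set; last exact: QXi.
have [-> -> ->] := h Qy.
by congr EFin; rewrite /time_dir; ring.
Qed.

End mollified_equations.

(** * A weight that dominates flux, gradient and source *)

Section energy_weight.
Variables (R : realType) (N : nat).
Local Notation space := 'rV[R]_N.
Local Notation point := ('rV[R]_N * R)%type.
Local Notation mpoint := ('rV[R]_N * measurableTypeR R)%type.
Local Notation mu := (lebesgue_xt R N).

Lemma powR_mix (p s t : R) : 1 < p -> 0 <= s -> 0 <= t ->
  s `^ (p - 1) * t <= s `^ p + t `^ p.
Proof.
move=> p1 s0 t0.
have p0 : 0 < p by exact: lt_trans p1.
have mulE (a : R) : 0 <= a -> a `^ (p - 1) * a = a `^ p.
  move=> a0; rewrite -{2}[a]powRr1 // -powRD ?subrK //.
  by rewrite (gt_eqF p0).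
have h (a b : R) : 0 <= a -> a <= b -> a `^ (p - 1) <= b `^ (p - 1).
  move=> a0 ab; apply: ge0_ler_powR; rewrite ?nnegrE ?(le_trans a0 ab) //.
  by rewrite subr_ge0 ltW.
have [st|/ltW ts] := leP s t.
  apply: (@le_trans _ _ (t `^ (p - 1) * t)); first by rewrite ler_wpM2r // h.
  by rewrite mulE // lerDr powR_ge0.
apply: (@le_trans _ _ (s `^ (p - 1) * s)); first by rewrite ler_wpM2l // powR_ge0.
by rewrite mulE // lerDl powR_ge0.
Qed.

Lemma flux_coord_le (p : R) (x : space) i : 1 < p ->
  `|flux p x ord0 i| <= enorm x `^ (p - 1).
Proof.
move=> p1; rewrite mxE normrM (ger0_norm (powR_ge0 _ _)).
apply: (@le_trans _ _ (enorm x `^ (p - 2) * enorm x)).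
  by rewrite ler_wpM2l ?powR_ge0 // enorm_coord.
have [->|x0] := eqVneq (enorm x) 0; first by rewrite mulr0 powR_ge0.
rewrite -{2}[enorm x]powRr1 ?enorm_ge0 // -powRD; last by rewrite x0 implybT.
by rewrite (_ : p - 2 + 1 = p - 1) //; ring.
Qed.

Lemma L1_dominated (h H : point -> R) (C : R) :
  measurable_fun setT (h : mpoint -> R) -> L1 H -> (forall y, `|h y| <= C * H y) -> L1 h.
Proof.
move=> mh IH hH; apply: (le_integrable measurableT _ _ (L1Z C IH)).
  exact/measurable_EFinP.
by move=> y _; rewrite lee_fin; apply: le_trans (hH y) (ler_norm _).
Qed.

Lemma gradient_representative (Q : set mpoint) (Du : point -> space) : measurable Q ->
  (forall i, lebesgue_measurable mu Q (fun z => Du z ord0 i)) ->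
  exists Dt : point -> space, [/\ forall i, measurable_fun setT (fun z : mpoint => Dt z ord0 i),
    forall z, ~ Q z -> Dt z = 0 & \forall z \ae mu, Q z -> Du z = Dt z].
Proof.
move=> mQ lD; pose g i := sval (cid (representative mQ (lD i))).
have gP i := svalP (cid (representative mQ (lD i))).
exists (fun z => \row_i g i z); split.
- by move=> i; under eq_fun do rewrite mxE; have [] := gP i.
- by move=> z nQ; apply/rowP => i; rewrite !mxE; have [_ h _] := gP i; exact: h.
- have : \forall z \ae mu, forall i, Q z -> Du z ord0 i = g i z.
    by apply: filter_forall => i; have [] := gP i.
  by apply: ae_imply => z h Qz; apply/rowP => i; rewrite mxE h.
Qed.

(** Replacing the gradient by 0 where the bound fails changes it on a null set
    only. *)
Lemma bounded_gradient_representative (Q : set mpoint) (Du : point -> space) (K : R) :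
  measurable Q -> 0 <= K ->
  (forall i, lebesgue_measurable mu Q (fun z => Du z ord0 i)) ->
  (\forall z \ae mu, Q z -> enorm (Du z) <= K) ->
  exists Dt : point -> space, [/\ forall i, measurable_fun setT (fun z : mpoint => Dt z ord0 i),
    forall z, ~ Q z -> Dt z = 0, forall z, enorm (Dt z) <= K &
    \forall z \ae mu, Q z -> Du z = Dt z].
Proof.
move=> mQ K0 lD DK; have [D0 [mD D0off DD0]] := gradient_representative mQ lD.
pose Dt z := if enorm (D0 z) <= K then D0 z else 0.
exists Dt; split.
- move=> i; have -> : (fun z => Dt z ord0 i) = fun z => if enorm (D0 z) <= K then D0 z ord0 i else 0.
    by apply/funext => z; rewrite /Dt; case: ifP => //; rewrite mxE.
  apply: measurable_fun_ifT => //.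
  exact: (measurable_fun_ler (measurable_enorm mD) (measurable_cst _)).
- by move=> z /D0off; rewrite /Dt => ->; case: ifP.
- by move=> z; rewrite /Dt; case: ifPn => // _; rewrite enorm0.
- by apply: ae_imply2 DK DD0 => z h1 h2 Qz; rewrite /Dt -h2 // h1.
Qed.

End energy_weight.

Section local_step.
Variables (R : realType) (N : nat).
Local Notation space := 'rV[R]_N.
Local Notation point := ('rV[R]_N * R)%type.
Local Notation mpoint := ('rV[R]_N * measurableTypeR R)%type.
Local Notation mu := (lebesgue_xt R N).
Variables (p : R) (f : space -> R) (Cf beta : R).
Hypotheses (p1 : 1 < p) (cf : continuous f) (Cf0 : 0 < Cf) (beta1 : 1 <= beta)
  (betap : beta < p) (fgr : forall xi, `|f xi| <= Cf * (1 + enorm xi `^ beta)).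

Let p0 : 0 < p. Proof. exact: lt_trans p1. Qed.

Section weight.
Variables (Q : set mpoint) (A B : point -> space) (K : R).
Hypotheses (mQ : measurable Q) (fQ : (mu Q < +oo)%E) (K0 : 0 <= K)
  (mA : forall i, measurable_fun setT (fun z : mpoint => A z ord0 i))
  (mB : forall i, measurable_fun setT (fun z : mpoint => B z ord0 i))
  (Aoff : forall z, ~ Q z -> A z = 0) (Boff : forall z, ~ Q z -> B z = 0)
  (AK : forall z, enorm (A z) <= K)
  (IB : (\int[mu]_(z in Q) (enorm (B z) `^ p)%:E < +oo)%E).

(** The power [p] of [1 + enorm A + enorm B] on [Q] and 0 elsewhere: the indicator
    in place of 1 makes the weight vanish off [Q] together with [A] and [B]. *)
Definition growth_weight (z : point) : R :=
  (\1_Q z + enorm (A z) + enorm (B z)) `^ p.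

Let S z : R := \1_Q z + enorm (A z) + enorm (B z).

Let S0 z : 0 <= S z. Proof. by rewrite !addr_ge0 ?enorm_ge0 // indicE. Qed.

Lemma growth_weight_ge0 z : 0 <= growth_weight z.
Proof. exact: powR_ge0. Qed.

Lemma growth_weight_off z : ~ Q z -> growth_weight z = 0.
Proof.
move=> nQ; rewrite /growth_weight Aoff // Boff // enorm0 indicE memNset // !addr0.
by rewrite powR0 // gt_eqF.
Qed.

Lemma le_growth_weight z s q : Q z -> 0 <= s -> s <= S z -> 0 <= q -> q <= p ->
  s `^ q <= growth_weight z.
Proof.
move=> Qz s0 sS q0 qp; have S1 : 1 <= S z.
  by rewrite /S indicE mem_set // -addrA lerDl addr_ge0 ?enorm_ge0.
apply: (@le_trans _ _ (S z `^ q)); first by rewrite ge0_ler_powR ?nnegrE.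
exact: ler_powR.
Qed.

(** As [A] is bounded, the weight is controlled by a constant on [Q] and the power
    [p] of [enorm B]. *)
Lemma L1_growth_weight : L1 growth_weight.
Proof.
have mb : measurable_fun setT (fun z : mpoint => enorm (B z) `^ p : R).
  by apply: measurableT_comp (measurable_powR p) _; exact: measurable_enorm.
have ms : measurable_fun setT (S : mpoint -> R).
  apply: measurable_funD; last exact: measurable_enorm.
  by apply: measurable_funD; [exact: measurable_indic|exact: measurable_enorm].
have I1 : L1 (\1_Q : mpoint -> R).
  apply/integrableP; split; first by apply/measurable_EFinP; exact: measurable_indic.
  rewrite (eq_integral (fun z => (\1_Q z)%:E)); first by rewrite integral_indic // setIT.
  by move=> z _ /=; rewrite ger0_norm // indicE.
have I2 : L1 (fun z => enorm (B z) `^ p).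
  apply/integrableP; split; first exact/measurable_EFinP.
  apply: le_lt_trans IB; rewrite [leRHS]integral_mkcond le_eqVlt; apply/orP; left; apply/eqP.
  apply: eq_integral => z _; rewrite patchE /= ger0_norm ?powR_ge0 //.
  case: ifPn => // /negP nQ; rewrite Boff; last by move=> Qz; apply: nQ; exact: mem_set.
  by rewrite enorm0 powR0 // gt_eqF.
have I3 := L1D (L1Z ((2 * (1 + K)) `^ p) I1) (L1Z (2 `^ p) I2).
apply: (@L1_dominated _ _ _ _ 1 _ I3) => [|z].
  exact: (measurableT_comp (measurable_powR p) ms).
rewrite mul1r ger0_norm ?powR_ge0 //.
have [Qz|nQ] := pselect (Q z); last first.
  by rewrite growth_weight_off // addr_ge0 // mulr_ge0 // powR_ge0.
rewrite indicE mem_set // mulr1 /growth_weight indicE mem_set //=.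
have e0 := enorm_ge0 (B z).
have K1 : 0 <= 1 + K by rewrite addr_ge0.
have [le|/ltW ge] := leP (enorm (B z)) (1 + K).
  apply: ler_wpDr; first by rewrite mulr_ge0 ?powR_ge0.
  rewrite ge0_ler_powR ?nnegrE ?mulr_ge0 ?addr_ge0 ?enorm_ge0 ?(ltW p0) //.
  by have := AK z; lra.
apply: ler_wpDl; first exact: powR_ge0.
rewrite -powRM // ge0_ler_powR ?nnegrE ?mulr_ge0 ?addr_ge0 ?enorm_ge0 ?(ltW p0) //.
by have := AK z; lra.
Qed.

End weight.

Section flux_bounds.
Variables (Q : set mpoint) (A B : point -> space).
Hypotheses (Aoff : forall z, ~ Q z -> A z = 0) (Boff : forall z, ~ Q z -> B z = 0).
Local Notation H := (growth_weight Q A B).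

Lemma growth_weightC : growth_weight Q B A = H.
Proof. by apply/funext => z; rewrite /growth_weight addrAC. Qed.

Lemma enorm_pow_le_weight z q : 0 < q -> q <= p -> enorm (A z) `^ q <= H z.
Proof.
move=> q0 qp; have [Qz|nQ] := pselect (Q z); last first.
  by rewrite Aoff // enorm0 powR0 ?powR_ge0 // gt_eqF.
apply: le_growth_weight; rewrite ?enorm_ge0 ?(ltW q0) //.
by rewrite addrAC lerDr addr_ge0 ?enorm_ge0 // indicE.
Qed.

Lemma coord_le_weight z i : `|A z ord0 i| <= H z.
Proof.
apply: le_trans (enorm_coord _ _) _.
by rewrite -[enorm _]powRr1 ?enorm_ge0 // enorm_pow_le_weight ?ltr01 ?ltW.
Qed.

Lemma flux_le_weight z i : `|flux p (A z) ord0 i| <= H z.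
Proof.
apply: le_trans (flux_coord_le _ _ p1) _.
by apply: enorm_pow_le_weight; rewrite ?subr_gt0 // lerBlDr lerDl.
Qed.

Lemma indic_le_weight z : \1_Q z <= H z.
Proof.
have [Qz|nQ] := pselect (Q z); last by rewrite indicE memNset // powR_ge0.
have -> : \1_Q z = 1 `^ p :> R by rewrite powR1 indicE mem_set.
apply: le_growth_weight => //; last exact: ltW.
by rewrite indicE mem_set //= -addrA lerDl addr_ge0 ?enorm_ge0.
Qed.

Lemma source_le_weight z : `|f (A z) * \1_Q z| <= 2 * Cf * H z.
Proof.
have [Qz|nQ] := pselect (Q z); last first.
  by rewrite indicE memNset // mulr0 normr0 !mulr_ge0 ?(ltW Cf0) ?powR_ge0.
rewrite indicE mem_set //= mulr1; apply: le_trans (fgr _) _.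
rewrite (mulrC 2) -mulrA ler_wpM2l ?(ltW Cf0) //.
have h1 := indic_le_weight z; rewrite indicE mem_set //= in h1.
have h2 := @enorm_pow_le_weight z beta (lt_le_trans ltr01 beta1) (ltW betap).
by lra.
Qed.

(** The exponents [p - 1] and 1 add up to [p], so the larger of the two weights
    decides, and the points separate. *)
Lemma flux_product_le i y z :
  `|flux p (A y) ord0 i - flux p (B y) ord0 i| * `|A z ord0 i - B z ord0 i| <= 2 * (H y + H z).
Proof.
pose S x : R := \1_Q x + enorm (A x) + enorm (B x).
have SA x : enorm (A x) <= S x.
  by rewrite /S addrAC lerDr addr_ge0 ?enorm_ge0 // indicE.
have SB x : enorm (B x) <= S x.
  by rewrite /S lerDr addr_ge0 ?enorm_ge0 // indicE.
have S0 x : 0 <= S x by apply: le_trans (SA x); exact: enorm_ge0.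
have pw x w : enorm x <= S w -> enorm x `^ (p - 1) <= S w `^ (p - 1).
  by move=> h; apply: ge0_ler_powR; rewrite ?nnegrE ?enorm_ge0 ?subr_ge0 ?(ltW p1).
apply: (@le_trans _ _ (2 * S y `^ (p - 1) * S z)).
  apply: ler_pM => //.
    rewrite mulr_natl mulr2n; apply: le_trans (ler_normB _ _) _.
    by apply: lerD; (apply: le_trans (flux_coord_le _ _ p1) _; apply: pw).
  apply: le_trans (ler_normB _ _) _.
  apply: (@le_trans _ _ (enorm (A z) + enorm (B z))); first by apply: lerD; exact: enorm_coord.
  by rewrite /S -addrA lerDr indicE.
by rewrite -mulrA ler_wpM2l //; exact: powR_mix.
Qed.

End flux_bounds.

End local_step.

(** * Improvement of a bound in a subcylinder *)

Section localized.
Variables (R : realType) (N : nat).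
Local Notation space := 'rV[R]_N.
Local Notation point := ('rV[R]_N * R)%type.
Local Notation mpoint := ('rV[R]_N * measurableTypeR R)%type.
Local Notation mu := (lebesgue_xt R N).
Variables (p : R) (f : space -> R) (Cf beta : R).
Hypotheses (p1 : 1 < p) (cf : continuous f) (Cf0 : 0 < Cf) (beta1 : 1 <= beta)
  (betap : beta < p) (fgr : forall xi, `|f xi| <= Cf * (1 + enorm xi `^ beta)).
Variables (U : set space) (a b : R) (Xi : set point) (u v : point -> R)
  (Du Dv : point -> space) (M K : R).
Local Notation Q := (cylinder U a b).
Hypotheses (oU : open U) (bQ : bounded_set Q) (QXi : Q `<=` Xi)
  (lu : lebesgue_measurable mu (Q : set mpoint) u)
  (lv : lebesgue_measurable mu (Q : set mpoint) v)
  (M0 : 0 <= M) (uM : \forall z \ae mu, Q z -> `|u z| <= M)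
  (vM : \forall z \ae mu, Q z -> `|v z| <= M)
  (sgu : spatial_gradient U a b u Du) (sgv : spatial_gradient U a b v Dv)
  (K0 : 0 <= K) (DuK : \forall z \ae mu, Q z -> enorm (Du z) <= K)
  (IDv : (\int[mu]_(z in Q) (enorm (Dv z) `^ p)%:E < +oo)%E)
  (subu : forall phi, test_function Q phi -> (forall z, 0 <= phi z) ->
    (weak_form p f Xi u Du phi <= 0)%E)
  (superv : forall phi, test_function Q phi -> (forall z, 0 <= phi z) ->
    (0 <= weak_form p f Xi v Dv phi)%E).

Let mQ : measurable (Q : set mpoint).
Proof. by apply: open_measurable_point; exact: open_cylinder. Qed.

Let fQ : (mu (Q : set mpoint) < +oo)%E. Proof. exact: bounded_finite_measure. Qed.

(** The energy inequality for the excess [u - v - eta t] on the cylinder, with test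
    functions above the level [k] and before the time [c]. Below the level the
    source is absorbed: its difference exceeds [eta / 2] only by [C] times the gap,
    and the factor [w - k <= m - k] compensates [C], so that the integrand is at
    least [eta / 2] times the test function. *)
Lemma localized_bound (K0' : set point) (r1 eta m k c c' C : R) :
  0 < r1 -> (forall x y, K0' x -> `|y - x| <= r1 -> Q y) ->
  0 < eta -> 0 <= k -> 0 <= a -> c < c' ->
  (forall z, Q z -> z.2 <= c' -> ~ K0' z -> u z - v z <= k) ->
  (\forall z \ae mu, Q z -> u z - v z - eta * z.2 <= m) ->
  0 <= C -> k <= m -> C * (m - k) <= 1 ->
  (forall x y, enorm x <= K -> `|f x - f y| <= eta / 2 + C * flux_gap p x y) ->
  \forall z \ae mu, Q z -> z.2 < c -> u z - v z - eta * z.2 <= k.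
Proof.
move=> r10 K0Q eta0 k0 a0 cc Qk wm C0 km Cmk srcC.
have [rQ Qr] : exists rQ, forall z, Q z -> `|z| < rQ.
  have [L [Lr hL]] := bQ; exists (L + 2) => z Qz.
  by apply: (@le_lt_trans _ _ (L + 1)); [apply: hL => //; rewrite ltrDl|rewrite ltrD2l ltr1n].
have [A [mA Aoff AK DA]] := bounded_gradient_representative mQ K0 sgu.1 DuK.
have [B [mB Boff DB]] := gradient_representative mQ sgv.1.
have [ut [mut utoff utM uut]] := bounded_representative mQ M0 lu uM.
have [vt [mvt vtoff vtM vvt]] := bounded_representative mQ M0 lv vM.
have IB : (\int[mu]_(z in Q) (enorm (B z) `^ p)%:E < +oo)%E.
  have <- // : (\int[mu]_(z in Q) (enorm (Dv z) `^ p)%:E =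
    \int[mu]_(z in Q) (enorm (B z) `^ p)%:E)%E.
  by apply: eq_integral_ae; apply: ae_imply DB => z h Qz; rewrite h.
pose H := growth_weight p (Q : set mpoint) A B.
have IH : L1 H by exact: (L1_growth_weight p1 mQ fQ K0 mA mB Aoff Boff AK IB).
have Hoff z : ~ Q z -> H z = 0 by move=> nQ; exact: growth_weight_off.
have Ig (h : point -> R) (L : R) : measurable_fun setT (h : mpoint -> R) ->
    (forall z, `|h z| <= L * H z) -> L1 h by move=> mh hL; exact: L1_dominated mh IH hL.
have Ibs (h : point -> R) (L : R) : measurable_fun setT (h : mpoint -> R) ->
    (forall z, ~ Q z -> h z = 0) -> (forall z, `|h z| <= L) -> L1 h.
  move=> mh hoff hL; apply: (@integrable_bounded_support _ _ _ L rQ) => // z hz.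
  by apply: Qr; apply: contrapT => /hoff h0; rewrite h0 eqxx in hz.
have Iu : L1 ut := Ibs _ _ mut utoff utM.
have Iv : L1 vt := Ibs _ _ mvt vtoff vtM.
have Qt z : Q z -> `|z.2| <= rQ by move=> /Qr/ltW/point_normE[].
have It : L1 (fun z => z.2 * \1_(Q : set mpoint) z).
  apply: (Ibs _ `|rQ|).
  - by apply: measurable_funM; [exact: measurable_snd|exact: measurable_indic].
  - by move=> z nQ; rewrite indicE memNset // mulr0.
  - move=> z; rewrite indicE; have [Qz|nQ] := pselect (Q z).
      by rewrite mem_set //= mulr1 (le_trans (Qt _ Qz)) // ler_norm.
    by rewrite memNset // mulr0 normr0.
have mflux (D : point -> space) i : (forall i, measurable_fun setT (fun z : mpoint => D z ord0 i)) ->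
    measurable_fun setT (fun z : mpoint => flux p (D z) ord0 i).
  move=> mD; have h : measurable_fun setT (fun x : space => flux p x ord0 i).
    by apply: continuous_measurable_rV; exact: continuous_flux.
  exact: (measurableT_comp h (measurable_fun_rV mD)).
have mf (D : point -> space) : (forall i, measurable_fun setT (fun z : mpoint => D z ord0 i)) ->
    measurable_fun setT (fun z : mpoint => f (D z) * \1_(Q : set mpoint) z).
  move=> mD; apply: measurable_funM; last exact: measurable_indic.
  exact: (measurableT_comp (continuous_measurable_rV cf) (measurable_fun_rV mD)).
have HC : growth_weight p (Q : set mpoint) B A = H := growth_weightC _ _ _ _.
have IA i : L1 (fun z => A z ord0 i).
  by apply: (Ig _ 1) => // z; rewrite mul1r; exact: coord_le_weight.
have IBi i : L1 (fun z => B z ord0 i).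
  by apply: (Ig _ 1) => // z; rewrite mul1r -HC; exact: coord_le_weight.
have IfA i : L1 (fun z => flux p (A z) ord0 i).
  by apply: (Ig _ 1) => [|z]; [exact: mflux|rewrite mul1r; exact: flux_le_weight].
have IfB i : L1 (fun z => flux p (B z) ord0 i).
  by apply: (Ig _ 1) => [|z]; [exact: mflux|rewrite mul1r -HC; exact: flux_le_weight].
pose Fu z := f (A z) * \1_(Q : set mpoint) z.
pose Fv z := f (B z) * \1_(Q : set mpoint) z.
have FuH z : `|Fu z| <= 2 * Cf * H z by exact: (source_le_weight p1 Cf0 beta1 betap fgr).
have FvH z : `|Fv z| <= 2 * Cf * H z.
  by rewrite -HC; exact: (source_le_weight p1 Cf0 beta1 betap fgr).
have IFu : L1 Fu by apply: (Ig _ _ (mf A mA)) FuH.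
have IFv : L1 Fv by apply: (Ig _ _ (mf B mB)) FvH.
have I1 : L1 (\1_(Q : set mpoint) : mpoint -> R).
  apply: (Ibs _ 1); first exact: measurable_indic.
    by move=> z nQ; rewrite indicE memNset.
  by move=> z; rewrite indicE; case: (_ \in _); rewrite ?normr1 ?normr0.
pose w z := ut z - vt z - eta * (z.2 * \1_(Q : set mpoint) z).
pose g z := Fu z - Fv z - eta * \1_(Q : set mpoint) z.
pose G i z := flux p (A z) ord0 i - flux p (B z) ord0 i.
pose D i z := A z ord0 i - B z ord0 i.
have Iw : L1 w by apply: L1B (L1Z _ It); exact: L1B.
have Igg : L1 g by apply: L1B (L1Z _ I1); exact: L1B.
have IG i : L1 (G i) by exact: L1B.
have ID i : L1 (D i) by exact: L1B.
(* Half of the margin is left to the mollifier, and averages at times before [c]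
   only involve times before [c']. *)
pose r0 := Num.min (r1 / 2) (c' - c).
have r00 : 0 < r0 by rewrite lt_min divr_gt0 //= subr_gt0.
pose r n := r0 * @harmonic R n.
have rgt0 n : 0 < r n by rewrite mulr_gt0 // harmonic_gt0.
have rle n : r n <= r0.
  by rewrite ler_piMr ?(ltW r00) // /harmonic invf_le1 // ler1n.
pose rho n := sval (cid (mollifier_exists N (rgt0 n))).
have mol n : mollifier (r n) (rho n) := svalP (cid (mollifier_exists N (rgt0 n))).
have r_to0 : r @ \oo --> 0.
  by rewrite -[X in _ --> X](mulr0 r0); apply: cvgM; [exact: cvg_cst|exact: cvg_harmonic].
have app (h : point -> R) : L1 h -> (forall z, ~ Q z -> h z = 0) -> approximable rho h.
  move=> Ih hoff; apply: (approximable_bounded_support mol r_to0 Ih (M := rQ)) => z hz.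
  by apply: Qr; apply: contrapT => /hoff h0; rewrite h0 eqxx in hz.
pose Kr : set point := [set z | exists2 y, K0' y & `|z - y| <= r1 / 2].
have KrQ n z y : Kr z -> `|y - z| <= r n -> Q y.
  move=> [y0 Ky0 zy0] yz; apply: (K0Q y0) => //.
  have -> : y - y0 = (y - z) + (z - y0) by rewrite addrA subrK.
  apply: le_trans (ler_normD _ _) _.
  have h1 : `|y - z| <= r1 / 2 by rewrite (le_trans yz) // (le_trans (rle n)) // ge_min lexx.
  by have := lerD h1 zy0; rewrite -splitr.
have woff z : ~ Q z -> w z = 0.
  by move=> nQ; rewrite /w utoff // vtoff // indicE memNset // !mulr0 !subr0.
have wQ z : Q z -> w z = ut z - vt z - eta * z.2.
  by move=> Qz; rewrite /w indicE mem_set // mulr1.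
(* Far from the excess set the average only involves values at most [k]; outside
   of the cylinder the value is 0, which is why [k] must not be negative. *)
have far n z : ~ Kr z -> z.2 <= c -> conv w (rho n) z <= k.
  move=> nK zc; apply: (conv_le_near (mol n) Iw).
  apply: ae_imply2 uut vvt => y hu hv yz.
  have [Qy|nQ] := pselect (Q y); last by rewrite woff.
  rewrite wQ // -hu // -hv //.
  have y0 : 0 <= eta * y.2.
    by rewrite mulr_ge0 ?(ltW eta0) //; have [_ /= /andP[/ltW ay _]] := Qy; exact: le_trans a0 ay.
  rewrite lerBlDr (le_trans _ (_ : k <= _)) ?lerDl //; apply: Qk => //.
    have h : y.2 - z.2 <= c' - c.
      apply: (le_trans (ler_norm _)); have [_ h] := (point_normE _ _).1 yz.
      by rewrite (le_trans h) // (le_trans (rle n)) // ge_min lexx orbT.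
    by lra.
  move=> Ky; apply: nK; exists y => //; rewrite distrC (le_trans yz) //.
  by rewrite (le_trans (rle n)) // ge_min lexx.
have ball1 n z : Kr z -> conv (\1_(Q : set mpoint) : mpoint -> R) (rho n) z = 1.
  move=> Kz; rewrite /conv -[RHS]/(fine 1%:E) -(mollifier_mass_left (mol n) z).
  congr fine; apply: eq_integral => y _; congr EFin.
  have [->|r1'] := eqVneq (rho n (y - z)) 0; first by rewrite mulr0.
  rewrite indicE mem_set ?mul1r //.
  by apply: (KrQ n z) => //; exact: (mollifier_support (mol n)).
(* The contributions [eta] of the time derivative of [eta t] and of the extra
   source term cancel. *)
have weak n z : Kr z ->
    - conv w ('D_(time_dir R N) (rho n)) z
    + \sum_i conv (G i) ('D_(space_dir R i) (rho n)) z - conv g (rho n) z <= 0.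
  move=> Kz; have br := mollifier_bounded (mol n).
  have bd e := mollifier_derive_bounded (mol n) e.
  have tst := mollifier_test_function (mol n) (KrQ n z ^~ Kz).
  have pos0 y : 0 <= rho n (y - z) by exact: mollifier_ge0 (mol n) _.
  have hu := subu tst pos0; have hv := superv tst pos0.
  have eqf (D0 : point -> space) y : Q y -> f (D0 y) = f (D0 y) * \1_(Q : set mpoint) y.
    by move=> Qy; rewrite indicE mem_set // mulr1.
  rewrite (@weak_form_mollifier _ _ p f Q Xi u ut Fu Du A _ _ _ (mol n)) // in hu; last 2 first.
  - by apply: ae_imply2 uut DA => y h1 h2 Qy; split; rewrite ?h1 ?h2 //; exact: eqf.
  - by move=> y; exact: KrQ.
  rewrite (@weak_form_mollifier _ _ p f Q Xi v vt Fv Dv B _ _ _ (mol n)) // in hv; last 2 first.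
  - by apply: ae_imply2 vvt DB => y h1 h2 Qy; split; rewrite ?h1 ?h2 //; exact: eqf.
  - by move=> y; exact: KrQ.
  rewrite !lee_fin in hu hv.
  have -> : conv w ('D_(time_dir R N) (rho n)) z =
      conv ut ('D_(time_dir R N) (rho n)) z - conv vt ('D_(time_dir R N) (rho n)) z + eta.
    rewrite /w (convB _ (L1B Iu Iv) (L1Z _ It) (bd _)) (convB _ Iu Iv (bd _)).
    rewrite (convZ _ _ It (bd _)) (@conv_time _ _ _ _ z _ _ (mol n) It) /=; last by move=> y; exact: KrQ.
    by rewrite mulrN1 opprK.
  have -> : conv g (rho n) z = conv Fu (rho n) z - conv Fv (rho n) z - eta.
    rewrite /g (convB _ (L1B IFu IFv) (L1Z _ I1) br) (convB _ IFu IFv br).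
    by rewrite (convZ _ _ I1 br) ball1 // mulr1.
  have -> : \sum_i conv (G i) ('D_(space_dir R i) (rho n)) z =
      \sum_i conv (fun z => flux p (A z) ord0 i) ('D_(space_dir R i) (rho n)) z -
      \sum_i conv (fun z => flux p (B z) ord0 i) ('D_(space_dir R i) (rho n)) z.
    by rewrite -sumrB; apply: eq_bigr => i _; rewrite convB.
  by lra.
have grad n i z : Kr z ->
    conv w ('D_(space_dir R i) (rho n)) z = - conv (D i) (rho n) z.
  move=> Kz; have br := mollifier_bounded (mol n).
  have bd e := mollifier_derive_bounded (mol n) e.
  have zQ y : `|y - z| <= r n -> Q y by exact: KrQ.
  rewrite /w (convB _ (L1B Iu Iv) (L1Z _ It) (bd _)) (convB _ Iu Iv (bd _)).
  rewrite (convZ _ _ It (bd _)) (@conv_time _ _ _ _ z _ _ (mol n) It) //= oppr0 mulr0 subr0.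
  rewrite /D (convB _ (IA i) (IBi i) br).
  rewrite (conv_spatial_gradient (mol n) oU sgu.2 Iu (IA i) _ uut _ zQ).
  - rewrite (conv_spatial_gradient (mol n) oU sgv.2 Iv (IBi i) _ vvt _ zQ); first by ring.
    + by move=> y nQ; split; [exact: vtoff|exact: Boff].
    + by apply: ae_imply DB => y h Qy; rewrite h.
  - by move=> y nQ; split; [exact: utoff|exact: Aoff].
  - by apply: ae_imply DA => y h Qy; rewrite h.
pose C1 := 2 + 4 * Cf + eta.
have Cf00 := ltW Cf0; have eta00 := ltW eta0.
have H0 z : 0 <= H z by exact: growth_weight_ge0.
have [] := @energy_inequality _ _ r rho w g H G D Kr k c (M + M + eta * `|rQ|) C1 (rQ + r1) mol r_to0.
- exact: app.
- by apply: app => // z nQ; rewrite /g /Fu /Fv indicE memNset // !mulr0 !subr0.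
- exact: app.
- by move=> i; apply: app => // z nQ; rewrite /G Aoff // Boff // subrr.
- by move=> i; apply: app => // z nQ; rewrite /D Aoff // Boff // subrr.
- move=> z; apply: (le_trans (ler_normB _ _)); apply: lerD.
    by apply: (le_trans (ler_normB _ _)); apply: lerD.
  rewrite normrM (ger0_norm eta00) ler_wpM2l // indicE.
  have [Qz|nQ] := pselect (Q z); last by rewrite memNset // mulr0 normr0.
  by rewrite mem_set //= mulr1 (le_trans (Qt _ Qz)) // ler_norm.
- exact: H0.
- by rewrite /C1; lra.
- move=> i y y'; apply: (le_trans (flux_product_le p1 (Q : set mpoint) A B i y y')).
  apply: ler_wpM2r; first by rewrite addr_ge0 // H0.
  by rewrite /C1; lra.
- move=> y; apply: (@le_trans _ _ (`|Fu y| + `|Fv y| + eta * \1_(Q : set mpoint) y)).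
    apply: (le_trans (ler_normB _ _)); apply: lerD; first exact: ler_normB.
    by rewrite normrM (ger0_norm eta00) ger0_norm // indicE.
  have h1 : \1_(Q : set mpoint) y <= H y by exact: (indic_le_weight p1).
  have h2 : eta * \1_(Q : set mpoint) y <= eta * H y by rewrite ler_wpM2l.
  by have := FuH y; have := FvH y; have := H0 y; rewrite /C1; lra.
- move=> z [y Ky zy]; have Qy : Q y by apply: (K0Q y) => //; rewrite subrr normr0 ltW.
  rewrite -[z](subrK y) addrC; apply: (le_trans (ler_normD _ _)); apply: lerD; first exact/ltW/Qr.
  by apply: (le_trans zy); rewrite ler_pdivrMr // ler_peMr ?ltW // ltr1n.
- exact: far.
- exact: weak.
- exact: grad.
move=> IL LL.
pose P z := pos (w z - k) ^+ 2 * pos (c - z.2) ^+ 2.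
have P0 z : 0 <= P z by rewrite mulr_ge0 // sqr_ge0.
have mw : measurable_fun setT (w : mpoint -> R) := L1_measurable Iw.
have mP : measurable_fun setT (P : mpoint -> R).
  have mpos (h : mpoint -> R) : measurable_fun setT h ->
      measurable_fun setT (fun z => pos (h z) ^+ 2).
    by move=> mh; apply: measurable_funX; exact: (measurable_maxr mh (measurable_cst _)).
  have m1 := mpos _ (measurable_funB mw (measurable_cst k)).
  have m2 := mpos _ (measurable_funB (measurable_cst c) (measurable_snd : measurable_fun setT (snd : mpoint -> R))).
  exact: (measurable_funM m1 m2).
pose L z := limit_density w g G D k c z.
have LP : \forall z \ae mu, eta / 2 * P z <= L z.
  have uv : \forall z \ae mu, Q z -> u z = ut z /\ v z = vt z.
    by apply: ae_imply2 uut vvt => z h1 h2 Qz; rewrite h1 ?h2.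
  apply: ae_imply2 uv wm => z huv hm.
  rewrite /L /limit_density /P; set X := pos (c - z.2) ^+ 2.
  have X0 : 0 <= X by exact: sqr_ge0.
  have [Qz|nQ] := pselect (Q z); last first.
    have -> : pos (w z - k) = 0 by rewrite pos_eq0 // woff // sub0r oppr_le0.
    by rewrite expr0n /= !mul0r !mulr0 subr0.
  have -> : \sum_i G i z * D i z = flux_gap p (A z) (B z).
    by apply: eq_bigr => i _; rewrite /G /D !mxE.
  set s := pos (w z - k); set gap := flux_gap _ _ _.
  have s0 : 0 <= s by exact: pos_ge0.
  have gap0 : 0 <= gap by exact: flux_gap_ge0.
  have sm : s <= m - k.
    rewrite /s /pos ge_max subr_ge0 km andbT lerD2r wQ //.
    by have [<- <-] := huv Qz; exact: hm.
  have Cs : C * s <= 1 by apply: le_trans Cmk; exact: ler_wpM2l.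
  have hg : g z <= - (eta / 2) + C * gap.
    have := srcC (A z) (B z) (AK z); rewrite /g /Fu /Fv indicE mem_set //= !mulr1.
    by move=> h; have := le_trans (ler_norm _) h; rewrite /gap; lra.
  rewrite -subr_ge0.
  have -> : 2 * gap * (s * X) - g z * (s ^+ 2 * X) - eta / 2 * (s ^+ 2 * X) =
      X * (s * (gap * (1 - C * s) + gap + s * (- (eta / 2) + C * gap - g z))) by ring.
  rewrite mulr_ge0 // mulr_ge0 // !addr_ge0 // mulr_ge0 // subr_ge0 //.
have I0 : (\int[mu]_z (eta / 2 * P z)%:E = 0)%E.
  apply/eqP; rewrite eq_le; apply/andP; split; last first.
    by apply: integral_ge0 => z _; rewrite lee_fin mulr_ge0 // divr_ge0.
  have LE : (\int[mu]_z (L z)%:E = \int[mu]_z (Num.max (L z) (eta / 2 * P z))%:E)%E.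
    by apply: eq_integral_ae; apply: ae_imply LP => z h _; rewrite (max_idPl h).
  have : (\int[mu]_z (L z)%:E <= 0)%E.
    by rewrite -(fineK (integrable_fin_num _ IL)) // lee_fin.
  rewrite LE; apply: le_trans; apply: ge0_le_integral => //.
  - by move=> z _; rewrite lee_fin mulr_ge0 // divr_ge0.
  - by apply/measurable_EFinP; exact: measurable_funM.
  - by apply/measurable_EFinP; apply: measurable_maxr; [exact: L1_measurable|exact: measurable_funM].
  - by move=> z _; rewrite lee_fin le_max lexx orbT.
have P00 : \forall z \ae mu, P z = 0.
  have mP2 : measurable_fun setT (fun z : mpoint => (eta / 2 * P z)%:E).
    by apply/measurable_EFinP; exact: measurable_funM.
  have := (ae_eq_integral_abs mu measurableT mP2).1.
  rewrite (eq_integral (fun z => (eta / 2 * P z)%:E)) => [|z _]; last first.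
    by rewrite /= ger0_norm // mulr_ge0 // divr_ge0.
  move=> /(_ I0); apply: ae_imply => z /(_ Logic.I) [/eqP].
  by rewrite mulf_eq0 mulf_eq0 invr_eq0 pnatr_eq0 orbF gt_eqF //= => /eqP.
have uv : \forall z \ae mu, Q z -> u z = ut z /\ v z = vt z.
  by apply: ae_imply2 uut vvt => z h1 h2 Qz; rewrite h1 ?h2.
apply: ae_imply2 P00 uv => z Pz huv Qz zc.
have [-> ->] := huv Qz; rewrite -wQ // leNgt; apply/negP => wk.
move: Pz; rewrite /P => /eqP; rewrite mulf_eq0 !expf_eq0 /= /pos.
by rewrite !max_l ?subr_ge0 ?ltW // !subr_eq0 !gt_eqF.
Qed.

End localized.

(** * Subcylinders *)

Section subcylinders.
Context d (X : measurableType d) (R : realType).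
Variable nu : {measure set X -> \bar R}.

Import HBNNSimple.

(** The integral of a nonnegative function is a supremum over the simple functions
    below it, and enlarging the function only adds candidates. *)
Lemma le_integral_nonneg (D : set X) (g h : X -> \bar R) :
  (forall x, D x -> 0 <= g x)%E -> (forall x, D x -> g x <= h x)%E ->
  (\int[nu]_(x in D) g x <= \int[nu]_(x in D) h x)%E.
Proof.
move=> g0 gh; rewrite integral_mkcond [leRHS]integral_mkcond.
have g1 x : (0 <= (g \_ D) x)%E by rewrite patchE; case: ifPn => // /set_mem; exact: g0.
have gh1 x : ((g \_ D) x <= (h \_ D) x)%E.
  by rewrite !patchE; case: ifPn => // /set_mem; exact: gh.
rewrite [leLHS]ge0_integralTE // [leRHS]ge0_integralTE //; last first.
  by move=> x; exact: le_trans (g1 x) (gh1 x).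
apply: ge_ereal_sup => _ [s /= sg <-]; apply: ereal_sup_ubound; exists s => //= x.
exact: le_trans (sg x) (gh1 x).
Qed.

End subcylinders.

Section cylinders.
Variables (R : realType) (N : nat).
Local Notation space := 'rV[R]_N.
Local Notation point := ('rV[R]_N * R)%type.

Lemma subcylinder_compactly_contained (U Omega : set space) (a b T : R) :
  compact (closure U) -> closure U `<=` Omega -> 0 < a -> b < T ->
  compactly_contained (cylinder U a b) (cylinder Omega 0 T).
Proof.
move=> cU UO a0 bT; pose A : set point := closure U `*` [set t | t \in `[a, b]].
have cA : compact A by apply: compact_setX => //; exact: segment_compact.
have clA : closed A by apply: compact_closed => //; exact: norm_hausdorff.
have sub : closure (cylinder U a b) `<=` A.
  rewrite [X in _ `<=` X](_ : A = closure A); last exact/closure_id.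
  apply: closure_subset => z [Uz /= /andP[h1 h2]]; split; first exact: subset_closure.
  by rewrite /= in_itv /= !ltW.
split; first by apply: (subclosed_compact _ cA) => //; exact: closed_closure.
move=> z /sub [/UO Oz /=]; rewrite in_itv /= => /andP[h1 h2]; split => //=.
by rewrite (lt_le_trans a0 h1) (le_lt_trans h2 bT).
Qed.

(** The margin may be used in the direction of time: half of it for the shrinking of
    the time interval, the other half remains. *)
Lemma subcylinder_margin (U : set space) (K : set point) (T r : R) : 0 < r ->
  (forall x y, K x -> `|y - x| <= r -> cylinder U 0 T y) ->
  forall x y, K x -> `|y - x| <= r / 2 -> cylinder U (r / 2) (T - r / 2) y.
Proof.
move=> r0 hK x y Kx yx.
have shift (s : R) : `|s| <= r / 2 -> cylinder U 0 T (y.1, y.2 + s).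
  move=> sr; apply: (hK x) => //.
  have -> : ((y.1, y.2 + s) : point) - x = (y - x) + ((0, s) : point).
    by rewrite addrAC; congr (_ - _); rewrite -[RHS]/(y.1 + 0, y.2 + s) addr0.
  apply: le_trans (ler_normD _ _) _; rewrite [r]splitr; apply: lerD => //.
  by rewrite prod_normE normr0 ge_max sr divr_ge0 // ltW.
have h : `|r / 2| <= r / 2 by rewrite ger0_norm // divr_ge0 // ltW.
have [Uy /= /andP[_ h1]] := shift (r / 2) h.
have [_ /= /andP[h2 _]] : cylinder U 0 T (y.1, y.2 - r / 2) by apply: shift; rewrite normrN.
by split => //=; apply/andP; split; lra.
Qed.

End cylinders.

(** * Comparison *)

Section comparison.
Variables (R : realType) (N : nat).
Local Notation space := 'rV[R]_N.
Local Notation point := ('rV[R]_N * R)%type.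
Local Notation mpoint := ('rV[R]_N * measurableTypeR R)%type.
Local Notation mu := (lebesgue_xt R N).
Variables (p : R) (f : space -> R) (Cf beta : R).
Hypotheses (p1 : 1 < p) (cf : continuous f) (Cf0 : 0 < Cf) (beta1 : 1 <= beta)
  (betap : beta < p) (fgr : forall xi, `|f xi| <= Cf * (1 + enorm xi `^ beta)).
Variables (Omega : set space) (T : R) (u v : point -> R) (Du : point -> space) (M K : R).
Local Notation Xi := (cylinder Omega 0 T).
Hypotheses (dO : domain Omega) (bO : bounded_set Omega) (T0 : 0 < T)
  (lu : lebesgue_measurable mu (Xi : set mpoint) u)
  (lv : lebesgue_measurable mu (Xi : set mpoint) v)
  (M0 : 0 <= M) (uM : \forall z \ae mu, Xi z -> `|u z| <= M)
  (vM : \forall z \ae mu, Xi z -> `|v z| <= M)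
  (hu : weak_subsolution p f Xi u) (hv : weak_supersolution p f Xi v)
  (hbd : forall z0 : point, parabolic_boundary Omega T z0 ->
    (limf_esup (fun z => (u z)%:E) (within Xi (nbhs z0)) <=
     limf_einf (fun z => (v z)%:E) (within Xi (nbhs z0)))%E)
  (hDu : spatial_gradient Omega 0 T u Du)
  (K0 : 0 <= K) (DuK : \forall z \ae mu, Xi z -> enorm (Du z) <= K).

(** Up to a time between [c] and [T], the excess is above [k] only in a compact part
    of the cylinder; a connected subcylinder around it that is compactly contained
    carries the equations. *)
Lemma excess_decreases_before (eta m k c C : R) : 0 < eta -> 0 < k -> c < T -> 0 <= C ->
  k <= m -> C * (m - k) <= 1 ->
  (forall x y, enorm x <= K -> `|f x - f y| <= eta / 2 + C * flux_gap p x y) ->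
  (\forall z \ae mu, Xi z -> u z - v z - eta * z.2 <= m) ->
  \forall z \ae mu, Xi z -> z.2 < c -> u z - v z - eta * z.2 <= k.
Proof.
move=> eta0 k0 cT C0 km Cmk srcC hm.
have oO : open Omega by have [] := dO.
pose c' := (c + T) / 2.
have cc' : c < c' by rewrite /c'; lra.
have c'T : c' < T by rewrite /c'; lra.
have [K1 [cK1 K1Xi exK1]] := compact_excess_set oO bO T0 uM vM hbd k0 c'T.
have out z : Xi z -> z.2 < c -> ~ K1 z -> u z - v z - eta * z.2 <= k.
  move=> Xz zc nK; rewrite lerBlDr (le_trans (exK1 z Xz _ nK)) //; first by rewrite ltW // (lt_trans zc).
  by rewrite lerDl mulr_ge0 ?(ltW eta0) //; have [_ /= /andP[/ltW]] := Xz.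
have [[x0 Kx0]|nK] := pselect (exists x, K1 x); last first.
  by apply: aeW => z Xz zc; apply: out => // Kz; apply: nK; exists z.
have cK1x : compact (fst @` K1).
  apply: continuous_compact => //; apply: continuous_subspaceT => z; exact: cvg_fst.
have K1x : fst @` K1 `<=` Omega by move=> _ [z /K1Xi [Oz _] <-].
have [U [dU KU cU UO]] := compact_subdomain dO cK1x K1x.
have oU : open U by have [] := dU.
have UsO : U `<=` Omega by move=> x Ux; apply: UO; exact: subset_closure.
have K1U : K1 `<=` cylinder U 0 T.
  by move=> z Kz; split; [apply: KU; exists z|have [] := K1Xi _ Kz].
have [r r0 rK1] := compact_margin cK1 (@open_cylinder _ _ U 0 T oU) K1U.
have mar := subcylinder_margin r0 rK1.
pose a := r / 2; pose b := T - r / 2.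
have a0 : 0 < a by rewrite divr_gt0.
have bT : b < T by rewrite /b; lra.
have K1Q z : K1 z -> cylinder U a b z.
  by move=> Kz; apply: (mar z) => //; rewrite subrr normr0 ltW.
have ab : a < b by have [_ /= /andP[h1 h2]] := K1Q _ Kx0; exact: lt_trans h1 h2.
have bU : bounded_set U.
  have [L [Lr hL]] := bO; exists L; split => // L' LL' x Ux; apply: hL LL' _ _; exact: UsO.
have cc := subcylinder_compactly_contained cU UO a0 bT.
have QXi : cylinder U a b `<=` Xi.
  by move=> z Qz; apply: cc.2; exact: subset_closure.
have [_ subu] := hu dU bU ab cc.
have [[_ _ [Dv sgv IDv]] superv] := hv dU bU ab cc.
have sgu : spatial_gradient U a b u Du := spatial_gradient_sub oO UsO (ltW a0) (ltW bT) hDu.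
have mXi : measurable (Xi : set mpoint).
  by apply: open_measurable_point; exact: open_cylinder.
have bQ : bounded_set (cylinder U a b).
  have [L [Lr hL]] := compact_bounded cc.1.
  by exists L; split => // L' LL' z Qz; apply: hL LL' _ _; exact: subset_closure.
have IDv' : (\int[mu]_(z in cylinder U a b) (enorm (Dv z) `^ p)%:E < +oo)%E.
  apply: le_lt_trans IDv; apply: le_integral_nonneg => z _; first by rewrite lee_fin powR_ge0.
  by rewrite lee_fin lerDr powR_ge0.
have toQ (S : point -> Prop) : (\forall z \ae mu, Xi z -> S z) ->
    \forall z \ae mu, cylinder U a b z -> S z.
  by apply: ae_imply => z h /QXi.
have := @localized_bound _ _ p f Cf beta p1 cf Cf0 beta1 betap fgr U a b Xi u v Du Dv M K
  oU bQ QXi (lebesgue_measurable_sub mXi QXi lu) (lebesgue_measurable_sub mXi QXi lv)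
  M0 (toQ _ uM) (toQ _ vM) sgu sgv K0 (toQ _ DuK) IDv'
  (fun phi => subu Du phi sgu) (fun phi => superv Dv phi sgv)
  K1 (r / 2) eta m k c c' C a0 mar eta0 (ltW k0) (ltW a0) cc' _ (toQ _ hm) C0 km Cmk srcC.
have exQ z : cylinder U a b z -> z.2 <= c' -> ~ K1 z -> u z - v z <= k.
  by move=> /QXi; exact: exK1.
move=> /(_ exQ); apply: ae_imply => z hz Xz zc.
have [Qz|nQ] := pselect (cylinder U a b z); first exact: hz.
by apply: out => // /K1Q.
Qed.
Lemma excess_decreases (eta m k C : R) : 0 < eta -> 0 < k -> 0 <= C ->
  k <= m -> C * (m - k) <= 1 ->
  (forall x y, enorm x <= K -> `|f x - f y| <= eta / 2 + C * flux_gap p x y) ->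
  (\forall z \ae mu, Xi z -> u z - v z - eta * z.2 <= m) ->
  \forall z \ae mu, Xi z -> u z - v z - eta * z.2 <= k.
Proof.
move=> eta0 k0 C0 km Cmk srcC hm.
have h n : \forall z \ae mu, Xi z -> z.2 < T - @harmonic R n ->
    u z - v z - eta * z.2 <= k.
  apply: (excess_decreases_before eta0 k0 _ C0 km Cmk srcC hm).
  by rewrite ltrBlDr ltrDl harmonic_gt0.
have := ae_foralln h; apply: ae_imply => z hz Xz.
have [_ /= /andP[_ zT]] := Xz.
have zT' : 0 < T - z.2 by rewrite subr_gt0.
have [n _ hn] := cvgr_lt _ (@cvg_harmonic R) _ zT'.
by apply: (hz n Xz); rewrite ltrBrDl -ltrBrDr; exact: (hn n (leqnn n)).
Qed.

(** A bound [m] of the excess may be lowered to [m - 1 / (C + 1)] or [m / 2],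
    whichever is larger, and [C] depends on [eta] but not on [m]; so no positive
    number is the infimum of the bounds. *)
Lemma excess_le_time (eta : R) : 0 < eta ->
  \forall z \ae mu, Xi z -> u z - v z <= eta * z.2.
Proof.
move=> eta0; have e20 : 0 < eta / 2 by rewrite divr_gt0.
have [C C0 srcC] := source_le_flux_gap p1 cf Cf0 beta1 betap fgr K0 e20.
pose S : set R := [set m | 0 < m /\ \forall z \ae mu, Xi z -> u z - v z - eta * z.2 <= m].
have S0 : S (M + M + 1).
  split; first by rewrite ltr_wpDl ?addr_ge0.
  apply: ae_imply2 uM vM => z h1 h2 Xz; have [_ /= /andP[t0 _]] := Xz.
  have := ler_norm (u z); have := ler_norm (- v z); rewrite normrN.
  have := h1 Xz; have := h2 Xz; have := mulr_ge0 (ltW eta0) (ltW t0); lra.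
have lbS : lbound S 0 by move=> m [/ltW].
have hS : has_inf S by split; [exists (M + M + 1)|exists 0].
pose i := inf S.
have i0 : 0 <= i by apply: lb_le_inf => //; exists (M + M + 1).
have iS m : S m -> i <= m by move=> Sm; apply: ge_inf => //; exists 0.
have {}i0 : i = 0.
  apply/eqP; rewrite eq_le i0 andbT leNgt; apply/negP => ipos.
  pose s := (C + 1)^-1.
  have C10 : 0 < C + 1 by rewrite ltr_wpDl.
  have s0 : 0 < s by rewrite invr_gt0.
  have ms0 : 0 < Num.min s i by rewrite lt_min s0.
  have [m [m0 hm] mi] := inf_adherent ms0 hS.
  pose k := Num.max (m - s) (m / 2).
  have k0 : 0 < k by rewrite lt_max divr_gt0 ?orbT.
  have km : k <= m by rewrite /k ge_max; apply/andP; split; lra.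
  have Cmk : C * (m - k) <= 1.
    apply: (@le_trans _ _ (C * s)).
      by apply: ler_wpM2l => //; rewrite lerBlDr -lerBlDl /k le_max lexx.
    by rewrite /s ler_pdivrMr // mul1r lerDl.
  have Sk : S k by split => //; exact: (excess_decreases eta0 k0 C0 km Cmk srcC hm).
  have := iS _ Sk; rewrite leNgt => /negP; apply.
  have : m < i + s by apply: (lt_le_trans mi); rewrite lerD2l ge_min lexx.
  have : m < i + i by apply: (lt_le_trans mi); rewrite lerD2l ge_min lexx orbT.
  by rewrite /k gt_max => h1 h2; apply/andP; split; lra.
have h n : \forall z \ae mu, Xi z -> u z - v z - eta * z.2 <= @harmonic R n.
  have [m [m0 hm] mi] := inf_adherent (@harmonic_gt0 R n) hS.
  apply: ae_imply hm => z hz Xz; apply: (le_trans (hz Xz)); apply: ltW.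
  by move: mi; rewrite -/i i0 add0r.
have := ae_foralln h; apply: ae_imply => z hz Xz.
rewrite -subr_le0; apply/ler_addgt0Pr => e e0; rewrite add0r.
have [n _ hn] := cvgr_lt _ (@cvg_harmonic R) _ e0.
by apply: (le_trans (hz n Xz)); apply/ltW/hn => /=.
Qed.

(** The term [eta t] made the inequality strict; now [eta] tends to 0. *)
Lemma weak_comparison : \forall z \ae mu, Xi z -> u z <= v z.
Proof.
have h n : \forall z \ae mu, Xi z -> u z - v z <= @harmonic R n * z.2.
  exact: excess_le_time (harmonic_gt0 n).
have := ae_foralln h; apply: ae_imply => z hz Xz; have [_ /= /andP[_ zT]] := Xz.
rewrite -subr_le0; apply/ler_addgt0Pr => e e0; rewrite add0r.
have eT : 0 < e / T by rewrite divr_gt0.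
have [n _ hn] := cvgr_lt _ (@cvg_harmonic R) _ eT.
apply: (le_trans (hz n Xz)).
have hnT : @harmonic R n <= e / T by apply/ltW/hn => /=.
apply: (@le_trans _ _ (@harmonic R n * T)).
  by rewrite ler_wpM2l ?harmonic_ge0 // ltW.
by rewrite -ler_pdivlMr.
Qed.

End comparison.


Theorem theorem3p4 (R : realType) (N : nat) (hN : (0 < N)%N)
  (p : R) (hp : 1 < p)
  (f : 'rV[R]_N -> R) (hf : continuous f)
  (Cf beta : R) (hCf : 0 < Cf) (hbeta1 : 1 <= beta) (hbetap : beta < p)
  (hgrowth : forall xi : 'rV[R]_N, `|f xi| <= Cf * (1 + enorm xi `^ beta))
  (Omega : set 'rV[R]_N) (hOmega : domain Omega) (bOmega : bounded_set Omega)
  (T : R) (hT : 0 < T)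
  (u v : 'rV[R]_N * R -> R)
  (uLinfty : Linfty (lebesgue_xt R N) (cylinder Omega 0 T) u)
  (vLinfty : Linfty (lebesgue_xt R N) (cylinder Omega 0 T) v)
  (hu : weak_subsolution p f (cylinder Omega 0 T) u)
  (hv : weak_supersolution p f (cylinder Omega 0 T) v)
  (hbd : forall z0 : 'rV[R]_N * R, parabolic_boundary Omega T z0 ->
    (limf_esup (fun z => (u z)%:E) (within (cylinder Omega 0 T) (nbhs z0)) <=
     limf_einf (fun z => (v z)%:E) (within (cylinder Omega 0 T) (nbhs z0)))%E)
  (Du : 'rV[R]_N * R -> 'rV[R]_N)
  (hDu : spatial_gradient Omega 0 T u Du)
  (DuLinfty : Linfty (lebesgue_xt R N) (cylinder Omega 0 T)
     (fun z => enorm (Du z))) :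
  \forall z \ae lebesgue_xt R N, cylinder Omega 0 T z -> u z <= v z.
Proof.
have [lu [M1 uM]] := uLinfty; have [lv [M2 vM]] := vLinfty.
have [_ [K DuK]] := DuLinfty.
pose M := Num.max 0 (Num.max M1 M2).
apply: (weak_comparison hp hf hCf hbeta1 hbetap hgrowth hOmega bOmega hT lu lv (M := M)
  _ _ _ hu hv hbd hDu (K := Num.max 0 K)).
- by rewrite /M le_max lexx.
- by apply: ae_imply uM => z h /h h1; rewrite /M !le_max h1 orbT.
- by apply: ae_imply vM => z h /h h1; rewrite /M !le_max h1 !orbT.
- by rewrite le_max lexx.
- by apply: ae_imply DuK => z h /h /(le_trans (ler_norm _)) h1; rewrite le_max h1 orbT.
Qed.
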